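(* Let $\mathcal L$ be a centerless Lie torus of type $(\Delta,\Lambda)$, $\Delta$ reduced, let $D$ be a permissible subalgebra of $\mathrm{SCDer}(\mathcal L)$, and consider the extended affine Lie algebra $E=E(\mathcal L,D,0)$ equipped with a Chevalley involution $\tau$. Let $\tau_c=\tau|_{E_c}$. Suppose that any one of the following conditions holds: (i) $D=D^0=\mathrm{SCDer}(\mathcal L)^0$; (ii) $D=\mathrm{SCDer}(\mathcal L)$ and $\chi^\mu(\mathcal B_c\cap\mathcal L^\lambda_{\dot\alpha})\subseteq\mathrm{span}_{\mathbb Z}\mathcal B_c$ for all $\mu\in\Gamma$, $\lambda\in\Lambda$, $\dot\alpha\in\Delta^\times$, where $\mathcal B_c$ is the Chevalley basis under consideration. Then any Chevalley basis $\mathcal B_c$ for $(E_c,\tau_c)$ extends to (i.e. is contained in) a Chevalley basis for $(E,\tau)$.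
   Context: All vector spaces are over $\mathbb C$. Lie tori. $\Lambda$ is a free abelian group of finite rank and $\Delta$ an irreducible finite root system (containing $0$; $\Delta^\times=\Delta\setminus\{0\}$) with root lattice $Q$. A Lie torus of type $(\Delta,\Lambda)$ is a $(Q\times\Lambda)$-graded Lie algebra $\mathcal L=\bigoplus_{(\alpha,\lambda)}\mathcal L^\lambda_\alpha$ with $\mathcal L^\lambda_\alpha=0$ for $\alpha\notin\Delta$ such that: for $\alpha\in\Delta^\times$, $\dim\mathcal L^\lambda_\alpha\le1$, and $\dim\mathcal L^0_\alpha=1$ if $\frac12\alpha\notin\Delta$; if $\dim\mathcal L^\lambda_\alpha=1$ ($\alpha\in\Delta^\times$) there are $0\ne e^{\pm\lambda}_{\pm\alpha}\in\mathcal L^{\pm\lambda}_{\pm\alpha}$ with $[[e^\lambda_\alpha,e^{-\lambda}_{-\alpha}],x]=\langle\beta,\alpha^\vee\rangle x$ for all $\beta\in\Delta$, $\mu\in\Lambda$, $x\in\mathcal L^\mu_\beta$; $\mathcal L^\lambda_0=\sum_{\alpha\in\Delta^\times,\mu\in\Lambda}[\mathcal L^\mu_\alpha,\mathcal L^{\lambda-\mu}_{-\alpha}]$; and $\Lambda=\mathrm{span}_{\mathbb Z}\{\lambda\mid\mathcal L^\lambda_\alpha\neq0\text{ for some }\alpha\in\Delta\}$. It is centerless if its center is $0$. $\mathcal L^\lambda=\sum_\alpha\mathcal L^\lambda_\alpha$. Fix a non-degenerate invariant $\Lambda$-graded symmetric bilinear form $(\cdot,\cdot)_{\mathcal L}$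 on $\mathcal L$ (one exists). Derivations. The centroid of $\mathcal L$ is $\mathcal C(\mathcal L)=\bigoplus_{\mu\in\Gamma}\mathbb C\chi^\mu$, $\Gamma$ a subgroup of $\Lambda$, $\chi^\mu$ an endomorphism of degree $\mu$, $\chi^\mu\chi^\nu=\chi^{\mu+\nu}$. For $\theta\in\mathrm{Hom}_{\mathbb Z}(\Lambda,\mathbb C)$, $\partial_\theta(x)=\theta(\lambda)x$ for $x\in\mathcal L^\lambda$; $\mathcal D=\{\partial_\theta\}$. $\mathrm{SCDer}(\mathcal L)=\bigoplus_{\mu\in\Gamma}\mathrm{SCDer}(\mathcal L)^\mu$, $\mathrm{SCDer}(\mathcal L)^\mu=\chi^\mu\{\partial_\theta\in\mathcal D\mid\theta(\mu)=0\}$ (so $\mathrm{SCDer}(\mathcal L)^0=\mathcal D$), with bracket $[\chi^\mu\partial_\theta,\chi^\nu\partial_\psi]=\chi^{\mu+\nu}(\theta(\nu)\partial_\psi-\psi(\mu)\partial_\theta)$. A $\Gamma$-graded subalgebra $D=\bigoplus_\mu D^\mu$ of $\mathrm{SCDer}(\mathcal L)$ is permissible if the map $\mathrm{ev}:\Lambda\to(D^0)^\star$, $\mathrm{ev}(\lambda)(\partial_\theta)=\theta(\lambda)$, is injective with discrete image and there is an affine cocycle $\kappa:D\times D\to D^{gr\star}$; here the cocycle is $\kappa=0$, which is always an affine cocycle. The graded dual is $D^{gr\star}=\sum_\mu(D^\mu)^\star$, with $(D^{gr\star})^\mu=(D^{-\mu})^\star$, and $D$-action $(d\cdot\varphi)(d')=\varphi([d',d])$.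 The algebra $E(\mathcal L,D,0)=\mathcal L\oplus D^{gr\star}\oplus D$ has bracket $[x_1+c_1+d_1,x_2+c_2+d_2]=([x_1,x_2]_{\mathcal L}+d_1(x_2)-d_2(x_1))+(\sigma_D(x_1,x_2)+d_1\cdot c_2-d_2\cdot c_1)+[d_1,d_2]$, where $\sigma_D(x,y)(d)=(d(x),y)_{\mathcal L}$, and form $(x_1+c_1+d_1,x_2+c_2+d_2)=(x_1,x_2)_{\mathcal L}+c_1(d_2)+c_2(d_1)$. With $\mathcal H=\mathcal L^0_0\oplus(D^0)^\star\oplus D^0$ it is an extended affine Lie algebra, with root space decomposition $E=\sum_{\alpha\in R}E_\alpha$ with respect to $\mathcal H$, where $R=\{\alpha\in\mathcal H^\star\mid E_\alpha\neq0\}$. For $\alpha\in R$, $t_\alpha\in\mathcal H$ represents $\alpha$ via the form, $(\alpha,\beta)=(t_\alpha,t_\beta)$, $R^0=\{\alpha\in R\mid(\alpha,\alpha)=0\}$, $R^\times=R\setminus R^0$, $h_\alpha=2t_\alpha/(\alpha,\alpha)$ for $\alpha\in R^\times$. The core $E_c$ is the subalgebra generated by $E_\alpha$, $\alpha\in R^\times$; $E_c=\mathcal L\oplus D^{gr\star}$. Chevalley involutions. For $E$: a finite order automorphism with $\tau(E_\alpha)=E_{-\alpha}$, $\alpha\in R$. For $E_c$: a finite order automorphism of $E_c$ with $\tau(E_\alpha)=E_{-\alpha}$, $\alpha\in R^\times$. Integral structures and Chevalley bases. A Chevalley system for $(E_c,\tau)$ is a set $\{x_\alpha\in E_\alpha\mid\alpha\in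 R^\times\}$ with $[x_\alpha,x_{-\alpha}]=h_\alpha$, $\tau(x_\alpha)=-x_{-\alpha}$. An integral structure for $(E_c,\tau)$ is $\mathcal B_c\subseteq E_c$ with: elements of $\mathcal B_c$ are root vectors of $E$; $\tau(\mathcal B_c)=-\mathcal B_c$; $\{\mathcal B_c\cap E_\alpha\mid\alpha\in R^\times\}$ is a Chevalley system for $(E_c,\tau)$; for $\sigma\in R^0$, $\mathrm{span}_{\mathbb Z}(\mathcal B_c\cap E_\sigma)=\sum_{\alpha\in R^\times}\mathbb Z[\mathcal B_c\cap E_{\alpha+\sigma},\mathcal B_c\cap E_{-\alpha}]$. It is a Chevalley basis for $(E_c,\tau)$ if it is a $\mathbb C$-basis of $E_c$. An integral structure for $(E,\tau)$ is $\mathcal B\subseteq E$ such that, with $\mathcal B\cap E_c=:\mathcal B_c$: $\mathcal B$ spans $E$ and consists of root vectors; $\tau(\mathcal B)=-\mathcal B$; $[\mathcal B\cap E_\alpha,\mathcal B\cap E_{-\alpha}]=\{h_\alpha\}$ for $\alpha\in R^\times$; for $\sigma\in R^0$, $\mathrm{span}_{\mathbb Z}(\mathcal B_c\cap E_\sigma)=\sum_{\alpha\in R^\times}\mathbb Z[\mathcal B\cap E_{\alpha+\sigma},\mathcal B\cap E_{-\alpha}]$; $[\mathcal B\setminus\mathcal B_c,\mathcal B]\subseteq\mathrm{span}_{\mathbb Z}\mathcal B$. It is a Chevalley basis for $(E,\tau)$ if it is a $\mathbb C$-basis of $E$. *)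

(* Defs.v *)
(* The definitions are over an arbitrary numFieldType K; the intended field is
   that of the complex numbers R[i], with R : realType. *)
From HB Require Import structures.
From mathcomp Require Export all_boot all_order all_algebra.
From mathcomp Require Export boolp classical_sets functions cardinality reals.
From mathcomp Require Export topology normedtype.
From mathcomp Require Export complex.

Set Implicit Arguments.
Unset Strict Implicit.
Unset Printing Implicit Defensive.

Import Order.TTheory GRing.Theory Num.Theory.
Import numFieldNormedType.Exports.
Local Open Scope classical_set_scope.
Local Open Scope ring_scope.

Section LinearAlgebra.
Context {K : numFieldType}.
Implicit Types U W : lmodType K.

Definition lspan {U} (A : set U) : set U := [set x | exists s : seq (K * U),
  (forall p, p \in s -> A p.2) /\ x = \sum_(p <- s) p.1 *: p.2].

Definition zspan {M : zmodType} (A : set M) : set M :=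
  [set x | exists s : seq (int * M),
    (forall p, p \in s -> A p.2) /\ x = \sum_(p <- s) p.2 *~ p.1].

Definition subspace {U} (A : set U) : Prop :=
  A 0 /\ forall (a : K) x y, A x -> A y -> A (a *: x + y).

Definition lin_indep {U} (B : set U) : Prop :=
  forall (s : seq U) (c : U -> K), uniq s -> (forall b, b \in s -> B b) ->
    \sum_(b <- s) c b *: b = 0 -> forall b, b \in s -> c b = 0.

Definition basis_of_set {U} (B A : set U) : Prop := lin_indep B /\ lspan B = A.

Definition dim_le1 {U} (A : set U) : Prop := exists e, A = lspan [set e].

Definition dim_eq1 {U} (A : set U) : Prop :=
  exists2 e, e != 0 & A = lspan [set e].

Definition direct_sum {U} {I : eqType} (P : set I) (F : I -> set U)
    (A : set U) : Prop :=
  [/\ forall i, P i -> subspace (F i),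
      A = lspan (\bigcup_(i in P) F i) &
      forall (s : seq I) (x : I -> U), uniq s ->
        (forall i, i \in s -> P i /\ F i (x i)) ->
        \sum_(i <- s) x i = 0 -> forall i, i \in s -> x i = 0].

(* A linear functional on a subspace A of U is encoded as the function on U
   that is linear on A and 0 off A, so that equality of functionals on A is
   equality of functions and sums are pointwise; [zero_ext A] is the
   restriction to A, in this encoding. *)
Definition zero_ext {T : Type} {U} (A : set T) (f : T -> U) : T -> U :=
  patch (fun=> 0) A f.

Definition dual {U} (A : set U) : set (U -> K^o) := [set f |
  (forall (a : K) x y, A x -> A y -> f (a *: x + y) = a * f x + f y) /\
  (forall x, ~ A x -> f x = 0)].

Definition linear_on {U W} (A : set U) (f : U -> W) : Prop :=
  forall (a : K) x y, A x -> A y -> f (a *: x + y) = a *: f x + f y.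

Definition lie_algebra {U} (br : U -> U -> U) : Prop :=
  [/\ bilinear_for *:%R *:%R br,
      forall x, br x x = 0 &
      forall x y z, br x (br y z) + br y (br z x) + br z (br x y) = 0].

Definition centerless {U} (br : U -> U -> U) : Prop :=
  forall x, (forall y, br x y = 0) -> x = 0.

Definition subalgebra {U} (br : U -> U -> U) (A : set U) : Prop :=
  subspace A /\ forall x y, A x -> A y -> A (br x y).

Definition lie_aut {U} (br : U -> U -> U) (A : set U) (tau : U -> U) : Prop :=
  [/\ set_bij A A tau, linear_on A tau &
      forall x y, A x -> A y -> tau (br x y) = br (tau x) (tau y)].

Definition finite_order {U} (A : set U) (tau : U -> U) : Prop :=
  exists n, (0 < n)%N /\ forall x, A x -> iter n tau x = x.

Definition commutator {U} (d d' : U -> U) : U -> U :=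
  fun x => d (d' x) - d' (d x).

End LinearAlgebra.

Definition free_of_finite_rank (M : zmodType) : Prop :=
  exists (n : nat) (b : 'I_n -> M), forall x : M,
    exists! c : {ffun 'I_n -> int}, x = \sum_(i < n) b i *~ c i.

Section RootSystem.
Context {K : numFieldType} {V : vectType K}.
Variable Delta : set V.

Definition nonzero_roots : set V := Delta `\ 0.

Definition is_coroot (a : V) (f : V -> K) : Prop :=
  [/\ linear_for *%R f, f a = 2,
      forall b, Delta b -> Delta (b - f b *: a) &
      forall b, Delta b -> exists m : int, f b = m%:~R].

Definition coroot (a : V) : V -> K := xget (fun=> 0) (is_coroot a).

Definition root_system : Prop :=
  [/\ finite_set Delta, Delta 0, lspan Delta = [set: V] &
      forall a, nonzero_roots a -> exists f, is_coroot a f].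

Definition irreducible_root_system : Prop :=
  [/\ root_system, nonzero_roots !=set0 &
      forall A : set V, A `<=` nonzero_roots -> A !=set0 ->
        (forall a b, A a -> (nonzero_roots `\` A) b -> coroot a b = 0) ->
        A = nonzero_roots].

Definition reduced_root_system : Prop :=
  forall a (k : K), nonzero_roots a -> nonzero_roots (k *: a) ->
    k = 1 \/ k = -1.

End RootSystem.

Section LieTorus.
Context {K : numFieldType} {V : vectType K} {Lam : zmodType} {L : lmodType K}.
Variables (Delta : set V) (br : L -> L -> L) (gr : V -> Lam -> set L).

(* The pieces [gr a l] are indexed by all a in V rather than by a in the root
   lattice Q; [lt_supp] forces those outside Delta, hence outside Q, to be 0. *)
Record lie_torus : Prop := LieTorus {
  lt_lie : lie_algebra br;
  lt_sum : direct_sum [set: V * Lam] (fun i => gr i.1 i.2) [set: L];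
  lt_grad : forall a b l m x y,
    gr a l x -> gr b m y -> gr (a + b) (l + m) (br x y);
  lt_supp : forall a l, ~ Delta a -> gr a l = [set 0];
  lt_dim : forall a l, nonzero_roots Delta a -> dim_le1 (gr a l);
  lt_dim0 : forall a, nonzero_roots Delta a -> ~ Delta (2^-1 *: a) ->
    dim_eq1 (gr a 0);
  lt_sl2 : forall a l, nonzero_roots Delta a -> dim_eq1 (gr a l) ->
    exists e f, [/\ gr a l e, gr (- a) (- l) f, e != 0, f != 0 &
      forall b m x, Delta b -> gr b m x ->
        br (br e f) x = coroot Delta a b *: x];
  lt_zero : forall l, gr 0 l = lspan [set z | exists a m x y,
    [/\ nonzero_roots Delta a, gr a m x, gr (- a) (l - m) y & z = br x y]];
  lt_full : zspan [set l | exists a x, [/\ Delta a, gr a l x & x != 0]]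
            = [set: Lam] }.

Definition gr_Lam (l : Lam) : set L := lspan (\bigcup_a gr a l).

Record graded_form (frm : L -> L -> K) : Prop := GradedForm {
  gf_bilin : bilinear_for *%R *%R frm;
  gf_sym : forall x y, frm x y = frm y x;
  gf_inv : forall x y z, frm (br x y) z = frm x (br y z);
  gf_nondeg : forall x, (forall y, frm x y = 0) -> x = 0;
  gf_grad : forall l m x y, gr_Lam l x -> gr_Lam m y -> l + m != 0 ->
    frm x y = 0 }.

Definition centroid : set (L -> L) := [set f | linear f /\
  forall x y, f (br x y) = br (f x) y /\ f (br x y) = br x (f y)].

Record centroid_basis (Gam : set Lam) (chi : Lam -> L -> L) : Prop :=
  CentroidBasis {
  cb_zero : Gam 0;
  cb_sub : forall m n, Gam m -> Gam n -> Gam (m - n);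
  cb_neq0 : forall m, Gam m -> chi m != 0;
  cb_sum : direct_sum Gam (fun m => lspan [set chi m]) centroid;
  cb_deg : forall m l x, Gam m -> gr_Lam l x -> gr_Lam (l + m) (chi m x);
  cb_mul : forall m n, Gam m -> Gam n -> chi m \o chi n = chi (m + n) }.

Definition degree_der (th : {additive Lam -> K}) (d : L -> L) : Prop :=
  linear d /\ forall l x, gr_Lam l x -> d x = th l *: x.

Variables (Gam : set Lam) (chi : Lam -> L -> L).

Definition SCDer_piece (m : Lam) : set (L -> L) :=
  [set d | exists th d0, [/\ degree_der th d0, th m = 0 & d = chi m \o d0]].

Definition SCDer : set (L -> L) := lspan (\bigcup_(m in Gam) SCDer_piece m).

End LieTorus.

(* The choices behind E(L, D, 0): the bracket and (Q x Lam)-grading of L, its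
   invariant form, the basis (chi m), m in Gam, of the centroid, and D. The
   values of chi outside Gam are irrelevant. *)
Record eala_data (K : numFieldType) (V : vectType K) (Lam : zmodType)
    (L : lmodType K) := EalaData {
  br : L -> L -> L;
  gr : V -> Lam -> set L;
  form : L -> L -> K;
  Gam : set Lam;
  chi : Lam -> L -> L;
  der : set (L -> L) }.

Section Eala.
Context {K : numFieldType} {V : vectType K} {Lam : zmodType} {L : lmodType K}.
Variable X : eala_data V Lam L.
Local Notation D := (der X).

Definition der_piece (m : Lam) : set (L -> L) :=
  D `&` SCDer_piece (gr X) (chi X) m.

(* (D^m)^*, as the subspace of D^* of functionals that vanish on the other
   homogeneous components of D; it is the component of degree -m of D^gr* *)
Definition der_piece_dual (m : Lam) : set ((L -> L) -> K^o) :=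
  [set c | dual D c /\
    forall n d, Gam X n -> n != m -> der_piece n d -> c d = 0].

Definition gr_dual : set ((L -> L) -> K^o) :=
  lspan (\bigcup_(m in Gam X) der_piece_dual m).

Definition der_act (d : L -> L) (c : (L -> L) -> K^o) : (L -> L) -> K^o :=
  zero_ext D (fun d' => c (commutator d' d)).

Definition sigma (x y : L) : (L -> L) -> K^o :=
  zero_ext D (fun d => form X (d x) y).

(* The scalar is th l for the th with d = partial_th, which d determines when
   gr is the grading of a Lie torus. *)
Definition ev (l : Lam) : (L -> L) -> K^o :=
  zero_ext (der_piece 0) (fun d => xget 0 [set k |
    exists th : {additive Lam -> K}, degree_der (gr X) th d /\ k = th l]).

Record affine_cocycle (kap : (L -> L) -> (L -> L) -> (L -> L) -> K^o) : Prop :=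
  AffineCocycle {
  ac_val : forall d d', D d -> D d' -> gr_dual (kap d d');
  ac_linl : forall d', D d' -> linear_on D (fun d => kap d d');
  ac_linr : forall d, D d -> linear_on D (kap d);
  ac_alt : forall d, D d -> kap d d = 0;
  ac_jacobi : forall d1 d2 d3, D d1 -> D d2 -> D d3 ->
    kap (commutator d1 d2) d3 + kap (commutator d2 d3) d1
      + kap (commutator d3 d1) d2 =
    der_act d1 (kap d2 d3) + der_act d2 (kap d3 d1) + der_act d3 (kap d1 d2);
  ac_inv : forall d1 d2 d3, D d1 -> D d2 -> D d3 ->
    kap d1 d2 d3 = kap d2 d3 d1;
  ac_deg : forall m n d d', Gam X m -> Gam X n ->
    der_piece m d -> der_piece n d' -> der_piece_dual (- (m + n)) (kap d d');
  ac_zero : forall d d', der_piece 0 d -> D d' -> kap d d' = 0 }.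

(* (D^0)^* is finite-dimensional, so its usual topology is the one of
   pointwise convergence on D^0. *)
Record permissible : Prop := Permissible {
  perm_subalg : subalgebra (@commutator K L) D;
  perm_sub : D `<=` SCDer (gr X) (Gam X) (chi X);
  perm_graded : direct_sum (Gam X) der_piece D;
  perm_inj : injective ev;
  perm_discrete :
    range ev `<=` isolated (range ev : set {ptws (L -> L) -> K^o});
  perm_cocycle : exists kap, affine_cocycle kap }.

(* Carrier of an ambient space containing E = L (+) D^gr* (+) D; elements are
   triples (x, c, d). *)
Definition ambient : lmodType K := (L * ((L -> L) -> K^o) * (L -> L))%type.
Implicit Types (u v : ambient) (a s : ambient -> K^o) (B : set ambient).

Definition eala : set ambient := [set u | gr_dual u.1.2 /\ D u.2].

(* The summand kap(d1, d2) of the general bracket is absent: the affine cocycle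
   is 0. *)
Definition brE u v : ambient :=
  (br X u.1.1 v.1.1 + u.2 v.1.1 - v.2 u.1.1,
   sigma u.1.1 v.1.1 + der_act u.2 v.1.2 - der_act v.2 u.1.2,
   commutator u.2 v.2).

Definition formE u v : K :=
  form X u.1.1 v.1.1 + u.1.2 v.2 + v.1.2 u.2.

Definition injL (x : L) : ambient := (x, 0, 0).

Definition cartan : set ambient :=
  [set u | [/\ gr X 0 0 u.1.1, der_piece_dual 0 u.1.2 & der_piece 0 u.2]].

Definition root_space a : set ambient :=
  [set u | eala u /\ forall h, cartan h -> brE h u = a h *: u].

Definition roots : set (ambient -> K^o) :=
  [set a | dual cartan a /\ exists2 u, root_space a u & u != 0].

Definition t_root a : ambient :=
  xget 0 [set t | cartan t /\ forall h, cartan h -> formE t h = a h].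

Definition form_root a s : K := formE (t_root a) (t_root s).

Definition isotropic_roots : set (ambient -> K^o) :=
  [set a | roots a /\ form_root a a = 0].

Definition nonisotropic_roots : set (ambient -> K^o) :=
  roots `\` isotropic_roots.

Definition h_root a : ambient := (2 / form_root a a) *: t_root a.

Definition core : set ambient :=
  smallest (subalgebra brE) (\bigcup_(a in nonisotropic_roots) root_space a).

(* Maps out of eala are total on the ambient space; their values off eala are
   irrelevant. *)
Definition chevalley_involution (tau : ambient -> ambient) : Prop :=
  [/\ lie_aut brE eala tau, finite_order eala tau &
      forall a, roots a -> tau @` root_space a = root_space (- a)].

Definition root_vector u : Prop :=
  u != 0 /\ exists2 a, roots a & root_space a u.

Definition brackets (A B : set ambient) : set ambient :=
  [set brE u v | u in A & v in B].

Definition chevalley_system (tau : ambient -> ambient)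
    (x : (ambient -> K^o) -> ambient) : Prop :=
  forall a, nonisotropic_roots a ->
    [/\ root_space a (x a), brE (x a) (x (- a)) = h_root a &
        tau (x a) = - x (- a)].

Record integral_structure_core (tau : ambient -> ambient) B : Prop :=
  IntegralStructureCore {
  isc_sub : B `<=` core;
  isc_root : forall b, B b -> root_vector b;
  isc_tau : tau @` B = -%R @` B;
  isc_sys : exists2 x, chevalley_system tau x &
    forall a, nonisotropic_roots a -> B `&` root_space a = [set x a];
  isc_iso : forall s, isotropic_roots s ->
    zspan (B `&` root_space s) =
    zspan (\bigcup_(a in nonisotropic_roots)
      brackets (B `&` root_space (a + s)) (B `&` root_space (- a))) }.

Definition chevalley_basis_core (tau : ambient -> ambient) B : Prop :=
  integral_structure_core tau B /\ basis_of_set B core.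

Record integral_structure (tau : ambient -> ambient) B : Prop :=
  IntegralStructure {
  is_sub : B `<=` eala;
  is_span : lspan B = eala;
  is_root : forall b, B b -> root_vector b;
  is_tau : tau @` B = -%R @` B;
  is_sys : forall a, nonisotropic_roots a ->
    brackets (B `&` root_space a) (B `&` root_space (- a)) = [set h_root a];
  is_iso : forall s, isotropic_roots s ->
    zspan ((B `&` core) `&` root_space s) =
    zspan (\bigcup_(a in nonisotropic_roots)
      brackets (B `&` root_space (a + s)) (B `&` root_space (- a)));
  is_int : brackets (B `\` core) B `<=` zspan B }.

Definition chevalley_basis (tau : ambient -> ambient) B : Prop :=
  integral_structure tau B /\ basis_of_set B eala.

End Eala.

(* Main.v *)
(* Write rt a l for the root through which the Cartan subalgebra acts on L_a^l; it
   is isotropic iff a = 0, the core is L (+) D^gr*, and in both cases D is the sum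
   of all chi^m {d_th | th(m) = 0} with m in a subgroup G of Gam. The integrality
   of chi^m on Bc forces chi^m x_r = +- x_(r + m) on the Chevalley system, with the
   same sign for -m and -r, hence tau chi^m = chi^-m tau on L. Therefore tau sends
   chi^m d_th to -chi^-m d_th up to an element of D^gr*, and finiteness of its
   order makes tau an involution. Averaging the inclusion D -> E with its
   conjugate by tau gives a lift of D to a subalgebra of E on which
   tau(chi^m d_th) = -chi^-m d_th holds exactly. The extending vectors are the
   lifts of chi^m d_th, for th in a Z-basis of {th in Hom(Lam, Z) | th(m) = 0}
   that spans {th in Hom(Lam, K) | th(m) = 0}; it comes from a basis of Lam in
   which m has at most one nonzero coordinate. *)
Require Import Defs.
From HB Require Import structures.
Set Implicit Arguments.
Unset Strict Implicit.
Unset Printing Implicit Defensive.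
Import Order.TTheory GRing.Theory Num.Theory.
Import numFieldNormedType.Exports.
Local Open Scope classical_set_scope.
Local Open Scope ring_scope.

(** * Linear algebra over subsets *)

(** The obstacle is that brackets with root vectors determine [tau (0, 0, d)] only modulo the graded
    dual of D, which acts trivially on L; so the summand D need not be stable under [tau]. On the
    core [tau] squares to the identity, because it does so on the Chevalley system. Hence tau^2 (0,
    0, d) = (0, 0, d) + g with g in the core and fixed by tau^2; iterating n times adds n g, which
    vanishes when n is the order. Both d |-> (0, 0, d) and its conjugate are homomorphisms, so their
    difference is a 1-cocycle of D in an abelian ideal; half of a cocycle is again a cocycle, and
    the factor 1/2 is the one that makes the lift symmetric under [tau]. Integrality of brackets
    then depends on the kind of vector. Two lifts bracket with integral structure constants. On a
    root vector of degree l a lift acts by the integer th(l) times chi^m. A basis vector of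
    isotropic degree is an integral combination of brackets of root vectors, on which a lift acts as
    a derivation. Under condition (i) G = {0} and chi^0 = id, so the integrality of chi is
    automatic. *)

Section Spans.
Context {K : numFieldType}.
Implicit Types U W : lmodType K.

Lemma subspaceD U (A : set U) x y : subspace A -> A x -> A y -> A (x + y).
Proof. by move=> [_ h] hx hy; rewrite -[x]scale1r; apply: h. Qed.

Lemma subspaceZ U (A : set U) a x : subspace A -> A x -> A (a *: x).
Proof. by move=> [h0 h] hx; rewrite -[_ *: _]addr0; apply: h. Qed.

Lemma subspaceN U (A : set U) x : subspace A -> A x -> A (- x).
Proof. by move=> hA hx; rewrite -scaleN1r; apply: subspaceZ. Qed.

Lemma subspaceB U (A : set U) x y : subspace A -> A x -> A y -> A (x - y).
Proof. by move=> hA hx hy; apply: subspaceD => //; apply: subspaceN. Qed.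

Lemma subspace_sum U (A : set U) (I : eqType) (s : seq I) (F : I -> U) :
  subspace A -> (forall i, i \in s -> A (F i)) -> A (\sum_(i <- s) F i).
Proof.
move=> hA; elim: s => [|i s IH] hF; first by rewrite big_nil; case: hA.
rewrite big_cons; apply: subspaceD => //; first by apply: hF; rewrite mem_head.
by apply: IH => j hj; apply: hF; rewrite inE hj orbT.
Qed.

Lemma lspan_subspace U (A : set U) : subspace (lspan A).
Proof.
split; first by exists [::]; rewrite big_nil; split.
move=> a x y [s [hs ->]] [t [ht ->]].
exists ([seq (a * p.1, p.2) | p <- s] ++ t); split.
  move=> p; rewrite mem_cat => /orP [/mapP[q qs ->]|]; last exact: ht.
  exact: (hs q).
rewrite big_cat big_map scaler_sumr; congr (_ + _).
by apply: eq_bigr => p _; rewrite scalerA.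
Qed.

Lemma lspan_incl U (A : set U) : A `<=` lspan A.
Proof.
move=> x Ax; exists [:: (1, x)]; split; last by rewrite big_seq1 scale1r.
by move=> p; rewrite inE => /eqP ->.
Qed.

Lemma lspan_min U (A W : set U) : subspace W -> A `<=` W -> lspan A `<=` W.
Proof.
move=> hW hA x [s [hs ->]]; apply: subspace_sum => // p ps.
by apply: subspaceZ => //; apply/hA/hs.
Qed.

Lemma lspan_sub U (A B : set U) : A `<=` B -> lspan A `<=` lspan B.
Proof.
move=> hA; apply: lspan_min; first exact: lspan_subspace.
exact: subset_trans (@lspan_incl _ B).
Qed.

Lemma lspan1P U (e x : U) : lspan [set e] x <-> exists a, x = a *: e.
Proof.
split; last first.
  by move=> [a ->]; apply: subspaceZ; [exact: lspan_subspace|exact: lspan_incl].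
apply: (@lspan_min _ _ [set x | exists a, x = a *: e]); last first.
  by move=> y ->; exists 1; rewrite scale1r.
split; first by exists 0; rewrite scale0r.
by move=> a y z [b ->] [c ->]; exists (a * b + c); rewrite scalerA scalerDl.
Qed.

Lemma dim_le1_prop U (A : set U) (x y : U) : dim_le1 A -> A x -> x != 0 ->
  A y -> exists a, y = a *: x.
Proof.
move=> [e ->] /lspan1P[a ->] + /lspan1P[b ->].
rewrite scaler_eq0 negb_or => /andP[a0 _].
by exists (b / a); rewrite scalerA divfK.
Qed.

Lemma dim_le1_eq1 U (A : set U) (x : U) : dim_le1 A -> A x -> x != 0 ->
  dim_eq1 A.
Proof.
move=> [e ->] /lspan1P[a ->]; rewrite scaler_eq0 negb_or => /andP[_ e0].
by exists e.
Qed.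

Lemma dim_eq1_neq0 U (A : set U) : dim_eq1 A -> exists2 x, A x & x != 0.
Proof. by move=> [e e0 ->]; exists e => //; apply: lspan_incl. Qed.

Lemma scaler_inj U (k k' : K) (x : U) : x != 0 -> k *: x = k' *: x -> k = k'.
Proof.
move=> x0 /eqP; rewrite -subr_eq0 -scalerBl scaler_eq0 (negPf x0) orbF subr_eq0.
by move=> /eqP.
Qed.

(** * Integral spans *)

Section ZSpan.
Context {M : zmodType}.
Implicit Types A B : set M.

Lemma zspan0 A : zspan A 0.
Proof. by exists [::]; rewrite big_nil. Qed.

Lemma zspan_incl A : A `<=` zspan A.
Proof.
move=> x Ax; exists [:: (1, x)]; split; last by rewrite big_seq1.
by move=> p; rewrite inE => /eqP ->.
Qed.

Lemma zspanD A x y : zspan A x -> zspan A y -> zspan A (x + y).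
Proof.
move=> [s [hs ->]] [t [ht ->]]; exists (s ++ t); rewrite big_cat; split => //.
by move=> p; rewrite mem_cat => /orP [|]; [exact: hs|exact: ht].
Qed.

Lemma zspanMz A x (k : int) : zspan A x -> zspan A (x *~ k).
Proof.
move=> [s [hs ->]]; exists [seq (p.1 * k, p.2) | p <- s]; split.
  by move=> p /mapP[q qs ->]; exact: (hs q).
by rewrite big_map mulrz_suml; apply: eq_bigr => p _; rewrite mulrzA.
Qed.

Lemma zspanN A x : zspan A x -> zspan A (- x).
Proof. by move=> /(zspanMz (-1)); rewrite mulrN1z. Qed.

Lemma zspanB A x y : zspan A x -> zspan A y -> zspan A (x - y).
Proof. by move=> hx hy; apply: zspanD => //; apply: zspanN. Qed.

Lemma zspan_sum A (I : Type) (s : seq I) (P : pred I) (F : I -> M) :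
  (forall i, P i -> zspan A (F i)) -> zspan A (\sum_(i <- s | P i) F i).
Proof.
move=> h; elim/big_rec: _ => [|i x Pi]; first exact: zspan0.
by apply: zspanD; exact: h.
Qed.

Lemma zspan_ind A (P : M -> Prop) :
  P 0 -> (forall x y, P x -> P y -> P (x - y)) -> (forall x, A x -> P x) ->
  forall x, zspan A x -> P x.
Proof.
move=> P0 PB PA x [s [hs ->]].
have PN y : P y -> P (- y) by move=> /(PB _ _ P0); rewrite sub0r.
have PD y z : P y -> P z -> P (y + z).
  by move=> hy hz; rewrite -[z]opprK; apply: PB => //; apply: PN.
have PM y (n : nat) : P y -> P (y *+ n).
  by move=> hy; elim: n => [|n IH]; rewrite ?mulr0n // mulrS; apply: PD.
have PZ y (k : int) : P y -> P (y *~ k).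
  move=> hy; case: k => n; first exact: PM.
  by rewrite NegzE mulrNz; apply/PN/(PM _ n.+1).
elim: s hs => [|p s IH] hs; rewrite ?big_nil // big_cons; apply: PD.
  by apply/PZ/PA/hs; rewrite mem_head.
by apply: IH => q hq; apply: hs; rewrite inE hq orbT.
Qed.

Lemma zspan_sub A B : A `<=` zspan B -> zspan A `<=` zspan B.
Proof.
move=> h x; apply: zspan_ind => //; [exact: zspan0|move=> y z; exact: zspanB].
Qed.

End ZSpan.

(** Lets combinations with different supports be compared over a common one. *)
Lemma sum_seq_zero_ext U (s t : seq U) (c : U -> K) :
  uniq s -> uniq t -> {subset s <= t} ->
  \sum_(b <- t) (if b \in s then c b else 0) *: b = \sum_(b <- s) c b *: b.
Proof.
move=> us ut st.
rewrite (eq_bigr (fun b => if b \in s then c b *: b else 0)); last first.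
  by move=> b _; case: ifP; rewrite ?scale0r.
rewrite -big_mkcond -big_filter; apply: perm_big; apply: uniq_perm => //.
  exact: filter_uniq.
by move=> b; rewrite mem_filter; case: (boolP (b \in s)) => //= /st ->.
Qed.

(** Collects repeated vectors, since [lin_indep] speaks only of duplicate-free sequences with
    coefficients given by a function. *)
Lemma zspan_uniq U (A : set U) x : zspan A x ->
  exists (s : seq U) (c : U -> K), [/\ uniq s, forall b, b \in s -> A b,
    forall b, exists k : int, c b = k%:~R & x = \sum_(b <- s) c b *: b].
Proof.
move: x; apply: zspan_ind.
- exists [::], (fun=> 0); split => //; last by rewrite big_nil.
  by move=> _; exists 0.
- move=> x y [s [c [us hs hc ->]]] [t [d [ut ht hd ->]]].
  exists (undup (s ++ t)), (fun b => (if b \in s then c b else 0)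
     - (if b \in t then d b else 0)); split.
  + exact: undup_uniq.
  + by move=> b; rewrite mem_undup mem_cat => /orP[/hs|/ht].
  + move=> b; have [k ->] : exists k : int, (if b \in s then c b else 0) = k%:~R.
      by case: ifP => _ //; exists 0.
    have [l ->] : exists k : int, (if b \in t then d b else 0) = k%:~R.
      by case: ifP => _ //; exists 0.
    by exists (k - l); rewrite intrB.
  + rewrite (eq_bigr _ (fun b _ => scalerBl _ _ _)) big_split /= sumrN.
    by rewrite !sum_seq_zero_ext ?undup_uniq // => b; rewrite mem_undup mem_cat
       => ->; rewrite ?orbT.
- move=> x Ax; exists [:: x], (fun=> 1); split => //.
  + by move=> b; rewrite inE => /eqP ->.
  + by move=> _; exists 1.
  + by rewrite big_seq1 scale1r.
Qed.

(** Comparison of the coefficients at [x]. This turns the integrality hypothesis on chi into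
    integers: a multiple of one basis vector inside the integral span has an integral factor. *)
Lemma lin_indep_zspan U (B : set U) (x : U) (k : K) :
  lin_indep B -> B x -> zspan B (k *: x) -> exists n : int, k = n%:~R.
Proof.
move=> hB Bx /zspan_uniq[s [c [us hs hc e]]].
have [k' ek'] : exists k' : int, (if x \in s then c x else 0) = k'%:~R.
  by case: ifP => _; [exact: hc|exists 0].
set t := undup (x :: s).
have xt : x \in t by rewrite mem_undup mem_head.
pose d b := (if b \in s then c b else 0) - (if b \in [:: x] then k else 0).
have hd : \sum_(b <- t) d b *: b = 0.
  rewrite (eq_bigr _ (fun b _ => scalerBl _ _ _)) big_split /= sumrN.
  rewrite !(sum_seq_zero_ext _ (t := t)) ?undup_uniq //.
  - by rewrite big_seq1 -e subrr.
  - by move=> b; rewrite inE => /eqP ->.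
  - by move=> b hb; rewrite mem_undup inE hb orbT.
have := hB t d (undup_uniq _) _ hd x xt.
rewrite /d mem_head ek' => hk; exists k'; apply/esym/subr0_eq/hk => b.
by rewrite mem_undup inE => /orP[/eqP ->//|/hs].
Qed.


Lemma lin_indep_neq0 U (B : set U) (x : U) : lin_indep B -> B x -> x != 0.
Proof.
move=> hB Bx; apply/eqP => x0; have /eqP := oner_neq0 K; apply.
apply: (hB [:: x] (fun=> 1)) => //; last exact: mem_head.
  by move=> b; rewrite inE => /eqP ->.
by rewrite big_seq1 x0 scaler0.
Qed.

Lemma linear_on_sum U W (A : set U) (f : U -> W) (I : eqType) (s : seq I)
    (c : I -> K) (x : I -> U) :
  subspace A -> linear_on A f -> (forall i, i \in s -> A (x i)) ->
  f (\sum_(i <- s) c i *: x i) = \sum_(i <- s) c i *: f (x i).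
Proof.
move=> hA hf; elim: s => [|i s IH] hs.
  rewrite !big_nil; have := hf (-1) 0 0 hA.1 hA.1.
  by rewrite scaler0 addr0 scaleN1r addNr.
rewrite !big_cons hf ?IH //.
- by move=> j hj; apply: hs; rewrite inE hj orbT.
- by apply: hs; rewrite mem_head.
- apply: subspace_sum => // j hj; apply: subspaceZ => //.
  by apply: hs; rewrite inE hj orbT.
Qed.

(** Applying [Phi] to a relation isolates the coefficient of [n]. Once the coefficients on [N] are
    gone, the rest is a relation inside [A]. The functionals used later factor through the
    D-component, which kills the core. *)
Lemma lin_indep_setU U (A N W : set U) :
  lin_indep A -> subspace W -> A `|` N `<=` W ->
  (forall n, N n -> exists Phi : U -> K^o, [/\ linear_on W Phi, Phi n != 0 &
    forall b, (A `|` N) b -> b != n -> Phi b = 0]) ->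
  lin_indep (A `|` N).
Proof.
move=> iA sW AN hN s c us hs e.
have cN b : b \in s -> N b -> c b = 0.
  move=> bs /[dup] Nb /hN[Phi [lin nz0 van]].
  have := linear_on_sum c sW lin (fun i hi => AN _ (hs i hi)); rewrite e.
  have -> : Phi 0 = 0.
    by have := lin (-1) 0 0 sW.1 sW.1; rewrite scaler0 addr0 scaleN1r addNr.
  rewrite (bigD1_seq b) //= big_seq_cond big1 ?addr0.
    by move/esym/eqP; rewrite /GRing.scale /= mulf_eq0 (negPf nz0) orbF => /eqP.
  by move=> i /andP[/hs ? ?]; rewrite van ?scaler0.
move=> b bs; have [/cN->//|nNb] := pselect (N b).
set t := [seq x <- s | x \notin [set x | N x]].
apply: (iA t) => //.
- exact: filter_uniq.
- move=> x; rewrite mem_filter => /andP[nx /hs[]//].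
  by move=> Nx; rewrite mem_set in nx.
- rewrite big_filter; move: e; rewrite (bigID (mem [set x | N x])) /=.
  rewrite big_seq_cond big1 ?add0r // => x /andP[xs].
  by rewrite inE => Nx; rewrite cN ?scale0r.
- by rewrite mem_filter bs andbT; apply/negP; rewrite inE.
Qed.

(** * Direct sums and simultaneous eigenvectors *)

Section DirectSum.
Context {U : lmodType K} {I : eqType} {P : set I} {F : I -> set U} {A : set U}.
Hypothesis hA : direct_sum P F A.

Lemma direct_sum_subspace i : P i -> subspace (F i).
Proof. by case: hA => h _ _; exact: h. Qed.

Lemma direct_sum_incl i : P i -> F i `<=` A.
Proof. by case: hA => _ -> _ Pi x Fx; apply: lspan_incl; exists i. Qed.

Lemma direct_sum_ind (Q : U -> Prop) :
  Q 0 -> (forall (a : K) x y, Q x -> Q y -> Q (a *: x + y)) ->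
  (forall i x, P i -> F i x -> Q x) -> forall x, A x -> Q x.
Proof.
case: hA => _ -> _ Q0 QD QF; apply: (@lspan_min _ _ Q); first by [].
by move=> x [i Pi Fx]; exact: QF Fx.
Qed.

(** The components are set to 0 off the support [s], so that decompositions with different supports
    can be added over the union. *)
Lemma direct_sum_decomp x : A x -> exists (s : seq I) (xs : I -> U),
  [/\ uniq s, forall i, i \in s -> P i, forall i, P i -> F i (xs i),
      forall i, i \notin s -> xs i = 0 & x = \sum_(i <- s) xs i].
Proof.
move: x; apply: direct_sum_ind.
- exists [::], (fun=> 0); split => //; last by rewrite big_nil.
  by move=> i /direct_sum_subspace[].
- move=> a x y [s [xs [us hs hxs nxs ->]]] [t [ys [ut ht hys nys ->]]].
  exists (undup (s ++ t)), (fun i => a *: xs i + ys i); split.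
  + exact: undup_uniq.
  + by move=> i; rewrite mem_undup mem_cat => /orP[/hs|/ht].
  + by move=> i Pi; apply: (direct_sum_subspace Pi).2; [exact: hxs|exact: hys].
  + move=> i; rewrite mem_undup mem_cat negb_or => /andP[/nxs -> /nys ->].
    by rewrite scaler0 addr0.
  + have ext (r : seq I) (z : I -> U) : uniq r -> {subset r <= s ++ t} ->
        (forall i, i \notin r -> z i = 0) ->
        \sum_(i <- undup (s ++ t)) z i = \sum_(i <- r) z i.
      move=> ur hr hz; rewrite (bigID (mem r)) /= [X in _ + X]big1 // addr0.
      rewrite -big_filter; apply: perm_big; apply: uniq_perm => //.
        by rewrite filter_uniq ?undup_uniq.
      move=> i; rewrite mem_filter mem_undup.
      by case: (boolP (i \in r)) => //= /hr ->.
    rewrite big_split -scaler_sumr /= (ext s) ?(ext t) // => i; rewrite mem_cat => ->//.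
    by rewrite orbT.
- move=> i x Pi Fx; exists [:: i], (fun j => if j == i then x else 0); split => //.
  + by move=> j; rewrite inE => /eqP ->.
  + move=> j Pj; case: eqP => [->//|_]; exact: (direct_sum_subspace Pj).1.
  + by move=> j; rewrite inE => /negPf ->.
  + by rewrite big_seq1 eqxx.
Qed.

Lemma direct_sum_uniq (s : seq I) (x : I -> U) : uniq s ->
  (forall i, i \in s -> P i) -> (forall i, i \in s -> F i (x i)) ->
  \sum_(i <- s) x i = 0 -> forall i, i \in s -> x i = 0.
Proof.
by case: hA => _ _ h us hP hF; apply: h => // i hi; split; [exact: hP|exact: hF].
Qed.

Lemma direct_sum_disjoint i j x : P i -> P j -> i != j -> F i x -> F j x ->
  x = 0.
Proof.
move=> Pi Pj ij Fi Fj.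
have := @direct_sum_uniq [:: i; j] (fun k => if k == i then x else - x).
rewrite big_cons big_seq1 eqxx eq_sym (negPf ij) subrr => /(_ _ _ _ erefl i).
rewrite eqxx mem_head; apply => //=; first by rewrite inE ij.
  by move=> k; rewrite !inE => /orP[/eqP->|/eqP->].
move=> k; rewrite !inE => /orP[/eqP->|/eqP->]; rewrite ?eqxx //.
by rewrite eq_sym (negPf ij); apply: subspaceN => //; exact: direct_sum_subspace.
Qed.

Lemma direct_sum_eigen (s : seq I) (x : I -> U) (phi : I -> K) (k : K) :
  uniq s -> (forall i, i \in s -> P i) -> (forall i, i \in s -> F i (x i)) ->
  \sum_(i <- s) phi i *: x i = k *: \sum_(i <- s) x i ->
  forall i, i \in s -> x i != 0 -> phi i = k.
Proof.
move=> us hP hF e i hi nz.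
have : \sum_(i <- s) (phi i - k) *: x i = 0.
  rewrite (eq_bigr _ (fun i _ => scalerBl _ _ _)) big_split /= sumrN e.
  by rewrite -scaler_sumr subrr.
move=> e0; have /eqP : (phi i - k) *: x i = 0.
  apply: (direct_sum_uniq (x := fun i => (phi i - k) *: x i) us hP _ e0 hi).
  by move=> j hj; apply: subspaceZ; [exact: direct_sum_subspace (hP _ hj)|exact: hF].
by rewrite scaler_eq0 (negPf nz) orbF subr_eq0 => /eqP.
Qed.

End DirectSum.

(** Source of the degree derivations: the diagonal operator with prescribed eigenvalues on the
    pieces. *)
Lemma direct_sum_scale (U : lmodType K) (I : eqType) (F : I -> set U)
    (phi : I -> K) : direct_sum [set: I] F [set: U] ->
  exists2 T : U -> U, linear T & forall i x, F i x -> T x = phi i *: x.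
Proof.
move=> hA.
(* [R] is the graph of the operator: it is total because every vector decomposes, and linear because
   supports can be merged. *)
pose R x y := exists (s : seq I) (xs : I -> U),
  [/\ uniq s, forall i, F i (xs i), x = \sum_(i <- s) xs i
    & y = \sum_(i <- s) phi i *: xs i].
have Rtot x : exists y, R x y.
  have [s [xs [us _ hxs _ e]]] := direct_sum_decomp hA (Logic.I : setT x).
  exists (\sum_(i <- s) phi i *: xs i), s, xs; split => // i; exact: hxs.
have Rlin a x y x' y' : R x y -> R x' y' -> R (a *: x + x') (a *: y + y').
  move=> [s [xs [us hxs -> ->]]] [t [ys [ut hys -> ->]]].
  pose zs i := (if i \in s then a *: xs i else 0) + (if i \in t then ys i else 0).
  exists (undup (s ++ t)), zs.
  have ext (r : seq I) (z : I -> U) : uniq r -> {subset r <= s ++ t} ->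
      \sum_(i <- undup (s ++ t)) (if i \in r then z i else 0) = \sum_(i <- r) z i.
    move=> ur hr; rewrite -big_mkcond -big_filter; apply: perm_big.
    apply: uniq_perm => //; first by rewrite filter_uniq ?undup_uniq.
    move=> i; rewrite mem_filter mem_undup.
    by case: (boolP (i \in r)) => //= /hr ->.
  have st : {subset s <= s ++ t} by move=> i; rewrite mem_cat => ->.
  have tt : {subset t <= s ++ t} by move=> i; rewrite mem_cat orbC => ->.
  split.
  - exact: undup_uniq.
  - move=> i; have sF := direct_sum_subspace hA (Logic.I : setT i).
    by apply: subspaceD => //; case: ifP => // _; rewrite ?sF.1 //;
       [apply: subspaceZ|case: sF|case: sF].
  - by rewrite big_split /= !ext // scaler_sumr.
  - rewrite scaler_sumr -(ext s) // -(ext t) // -big_split /=.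
    apply: eq_bigr => i _; rewrite /zs scalerDr.
    by do 2 case: ifP => _; rewrite ?scaler0 // !scalerA mulrC.
(* By linearity this reduces to a decomposition of 0, all of whose components vanish. *)
have Runiq x y y' : R x y -> R x y' -> y = y'.
  move=> h h'; have := Rlin (-1) _ _ _ _ h h'.
  rewrite !scaleN1r addNr => -[s [xs [us hxs /esym e0 e1]]].
  have z := direct_sum_uniq hA us (fun _ _ => Logic.I) (fun i _ => hxs i) e0.
  have /eqP : - y + y' = 0 by rewrite e1 big_seq big1 // => i /z ->; rewrite scaler0.
  by rewrite addrC subr_eq0 => /eqP ->.
pose T x := xget 0 [set y | R x y].
have hT x : R x (T x) by exact: (xgetPex 0 (Rtot x)).
exists T; first by move=> a x y; apply: Runiq (hT _) _; apply: Rlin.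
move=> i x Fx; apply: Runiq (hT _) _.
exists [:: i], (fun j => if j == i then x else 0); split => //.
- move=> j; case: eqP => [->//|_]; exact: (direct_sum_subspace hA (Logic.I : setT j)).1.
- by rewrite big_seq1 eqxx.
- by rewrite big_seq1 eqxx.
Qed.

End Spans.

(** Every nonzero component of a joint eigenvector has its eigenvalues, so when the eigenvalues
    separate the pieces only one component can be nonzero. Separation is asked only of nonzero
    pieces, because weights separate roots and not arbitrary elements of [V]. *)
Lemma direct_sum_weight (K : numFieldType) (U : lmodType K) (I : eqType)
    (P : set I) (F : I -> set U) (A : set U) (J : Type) (Jp : set J)
    (T : J -> U -> U) (phi : J -> I -> K) (k : J -> K) (x : U) :
  direct_sum P F A -> (forall j, Jp j -> linear_on A (T j)) ->
  (forall j i y, Jp j -> P i -> F i y -> T j y = phi j i *: y) ->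
  (forall i i' y y', P i -> P i' -> F i y -> y != 0 -> F i' y' -> y' != 0 ->
     (forall j, Jp j -> phi j i = phi j i') -> i = i') ->
  A x -> x != 0 -> (forall j, Jp j -> T j x = k j *: x) ->
  exists i, [/\ P i, F i x & forall j, Jp j -> k j = phi j i].
Proof.
move=> hA lT hT sep Ax x0 hx.
have [s [xs [us hs hxs nxs ex]]] := direct_sum_decomp hA Ax.
have hF i : i \in s -> F i (xs i) by move=> /hs; exact: hxs.
have e j i : Jp j -> i \in s -> xs i != 0 -> phi j i = k j.
  move=> hj; apply: (direct_sum_eigen hA us hs hF).
  rewrite -ex -hx // [in RHS]ex.
  have := linear_on_sum (fun=> 1) _ (lT j hj)
    (fun i hi => direct_sum_incl hA (hs i hi) (hF i hi)).
  rewrite (eq_bigr (fun i => xs i)) => [->|i0 _]; last by rewrite scale1r.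
    by apply: eq_big_seq => i0 hi; rewrite scale1r (hT _ _ _ hj (hs _ hi) (hF _ hi)).
  by case: hA => _ -> _; exact: lspan_subspace.
have [i [hi nz]] : exists i, i \in s /\ xs i != 0.
  apply: contrapT => h; case/eqP: x0; rewrite ex big_seq big1 // => i hi.
  by apply/eqP/negPn/negP => nz; apply: h; exists i.
exists i; split; first exact: hs.
  rewrite ex (bigD1_seq i) //= big_seq_cond big1 ?addr0; first exact: hF.
  move=> i' /andP[hi' ii']; apply/eqP/negPn/negP => nz'; case/eqP: ii'.
  apply: (sep _ _ (xs i') (xs i)) => //; [exact: hs|exact: hs|exact: hF|exact: hF|].
  by move=> j hj; rewrite !e.
by move=> j hj; rewrite -(e j i).
Qed.

Section LinearFor.
Context {K : numFieldType} {U : lmodType K} {W : zmodType}.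
Variables (s : GRing.Scale.law K W) (f : U -> W).
Hypothesis lf : linear_for s f.

Let g : {linear U -> W | s} := HB.pack f (GRing.isLinear.Build K U W s f lf).

Lemma linear_for0 : f 0 = 0. Proof. exact: (raddf0 g). Qed.
Lemma linear_forD x y : f (x + y) = f x + f y. Proof. exact: (raddfD g). Qed.
Lemma linear_forN x : f (- x) = - f x. Proof. exact: (raddfN g). Qed.
Lemma linear_forB x y : f (x - y) = f x - f y. Proof. exact: (raddfB g). Qed.
Lemma linear_forZ a x : f (a *: x) = s a (f x). Proof. exact: (linearZ_LR g). Qed.
Lemma linear_for_sum I r (P : pred I) (F : I -> U) :
  f (\sum_(i <- r | P i) F i) = \sum_(i <- r | P i) f (F i).
Proof. exact: (raddf_sum g). Qed.

End LinearFor.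

Section ZmodMorphism.
Context {M N : zmodType} (f : M -> N) (hf : zmod_morphism f).
Let g : {additive M -> N} := HB.pack f (GRing.isZmodMorphism.Build M N f hf).
Lemma zmod_morph0 : f 0 = 0. Proof. exact: (raddf0 g). Qed.
Lemma zmod_morphD x y : f (x + y) = f x + f y. Proof. exact: (raddfD g). Qed.
Lemma zmod_morphN x : f (- x) = - f x. Proof. exact: (raddfN g). Qed.
Lemma zmod_morphMz x n : f (x *~ n) = f x *~ n. Proof. exact: (raddfMz g). Qed.
Lemma zmod_morph_sum I r (P : pred I) (F : I -> M) :
  f (\sum_(i <- r | P i) F i) = \sum_(i <- r | P i) f (F i).
Proof. exact: (raddf_sum g). Qed.
End ZmodMorphism.

Section ZeroExt.
Context {K : numFieldType} {T : Type} {U : lmodType K}.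
Implicit Types (A : set T) (f : T -> U).

Lemma zero_extE A f x : A x -> zero_ext A f x = f x.
Proof. by move=> Ax; rewrite /zero_ext /patch mem_set. Qed.

Lemma zero_extN A f x : ~ A x -> zero_ext A f x = 0.
Proof. by move=> nAx; rewrite /zero_ext /patch memNset. Qed.

End ZeroExt.

Section Dual.
Context {K : numFieldType} {U : lmodType K} (A : set U).

Lemma dual_subspace : subspace (dual A).
Proof.
split; first by split=> // a x y _ _; rewrite /= mulr0 addr0.
move=> c f g [lf zf] [lg zg]; split.
  move=> a x y Ax Ay; rewrite !fctE lf // lg // mulrDr scalerDr addrACA.
  by congr (_ + _ + _); rewrite /GRing.scale /= mulrCA.
by move=> x nx; rewrite !fctE zf // zg // scaler0 addr0.
Qed.

Lemma dual_ext (c c' : U -> K^o) : dual A c -> dual A c' ->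
  (forall x, A x -> c x = c' x) -> c = c'.
Proof.
move=> [_ h] [_ h'] e; apply/funext => x; have [Ax|nAx] := pselect (A x).
  exact: e.
by rewrite h // h'.
Qed.

Hypothesis sA : subspace A.

Lemma dual_linear_on (c : U -> K^o) : dual A c -> linear_on A c.
Proof. by case. Qed.

Lemma dual0 (c : U -> K^o) : dual A c -> c 0 = 0.
Proof.
by case=> h _; have := h (-1) 0 0 sA.1 sA.1; rewrite scaler0 addr0 mulN1r addNr.
Qed.

Lemma dualZ (c : U -> K^o) k x : dual A c -> A x -> c (k *: x) = k * c x.
Proof.
move=> hc Ax; have := hc.1 k x 0 Ax sA.1.
by rewrite (dual0 hc) !addr0.
Qed.

End Dual.

(** * Bases of a free abelian group adapted to an element *)

Section AdaptedBasis.
Context {M : zmodType} {n : nat}.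

(** By [ad_one], the coordinates [t i] that vanish at [m] form a basis of all functionals vanishing
    at [m], both over the integers and over K. *)
Record adapted (m : M) (b : 'I_n -> M) (t : 'I_n -> M -> int) : Prop := Adapted {
  ad_morph : forall i, zmod_morphism (t i);
  ad_expand : forall l, l = \sum_(i < n) b i *~ t i l;
  ad_dual : forall i j, t i (b j) = (i == j)%:R;
  ad_one : forall i j, t i m != 0 -> t j m != 0 -> i = j }.

Lemma adaptedN m b t : adapted m b t -> adapted (- m) b t.
Proof.
move=> [h1 h2 h3 h4]; split=> // i j.
have tN k : t k (- m) = - t k m.
  have t0 : t k 0 = 0 by have := h1 k 0 0; rewrite !subrr.
  by rewrite -sub0r h1 t0 sub0r.
by rewrite !tN !oppr_eq0; exact: h4.
Qed.

(** Smith normal form of the coordinate column of [m]: a unimodular change of basis leaves it a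
    multiple of the first basis vector. *)
Lemma adapted_exists (b : 'I_n -> M) m :
  (forall x, exists! c : {ffun 'I_n -> int}, x = \sum_(i < n) b i *~ c i) ->
  exists b' t, adapted m b' t.
Proof.
move=> hb.
pose c x := xget [ffun=> 0] [set c : {ffun 'I_n -> int} | x = \sum_(i < n) b i *~ c i].
have cP x : x = \sum_(i < n) b i *~ c x i.
  have [c0 [e _]] := hb x.
  exact: (@xgetPex _ [ffun=> 0] [set c : {ffun 'I_n -> int} | _] (ex_intro _ c0 e)).
have cU x (d : {ffun 'I_n -> int}) : x = \sum_(i < n) b i *~ d i -> c x = d.
  by move=> e; have [c0 [_ u]] := hb x; rewrite -(u _ (cP x)) (u _ e).
have cB x y i : c (x - y) i = c x i - c y i.
  rewrite (cU (x - y) [ffun i => c x i - c y i]) ?ffunE //.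
  rewrite {1}[x]cP {1}[y]cP -sumrB; apply: eq_bigr => j _.
  by rewrite ffunE mulrzBr.
pose col x : 'cV[int]_n := \col_i c x i.
have [A uA [B uB [d _ eM]]] := int_Smith_normal_form (col m).
(* The new basis consists of the columns of [A], so the new coordinates are obtained from the old
   ones by [invmx A]. *)
exists (fun j => \sum_(i < n) b i *~ A i j), (fun j x => (invmx A *m col x) j 0).
split.
- move=> i x y; have -> : col (x - y) = col x - col y.
    by apply/matrixP => j k; rewrite !mxE cB.
  by rewrite mulmxBr !mxE.
- move=> l.
  have e i : c l i = \sum_j A i j * (invmx A *m col l) j 0.
    have -> : \sum_j A i j * (invmx A *m col l) j 0 = (A *m (invmx A *m col l)) i 0.
      by rewrite [RHS]mxE.
    by rewrite mulmxA mulmxV // mul1mx mxE.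
  rewrite {1}[l]cP.
  rewrite (eq_bigr (fun i => \sum_j b i *~ (A i j * (invmx A *m col l) j 0))).
    rewrite exchange_big /=; apply: eq_bigr => j _; rewrite mulrz_suml.
    by apply: eq_bigr => i _; rewrite mulrzA.
  by move=> i _; rewrite [in LHS]e mulrz_sumr.
- move=> i j.
  have -> : col (\sum_(k < n) b k *~ A k j) = A *m delta_mx j 0.
    apply/matrixP => k l; rewrite -colE !mxE.
    rewrite (cU _ [ffun k => A k j]) ?ffunE //.
    by apply: eq_bigr => p _; rewrite ffunE.
  by rewrite mulmxA mulVmx // mul1mx mxE eqxx andbT.
(* In the new coordinates [m] is the diagonal factor, a single column, times a 1 x 1 matrix; only
   row 0 can be nonzero. *)
- have e i : (invmx A *m col m) i 0 != 0 -> i = 0%N :> nat.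
    rewrite eM !mulmxA mulVmx // mul1mx mxE big_ord1 !mxE /=.
    by rewrite mulrb; case: (val i =P 0%N) => // _; rewrite mul0r eqxx.
  by move=> i j /e ei /e ej; apply/val_inj; rewrite /= ei ej.
Qed.

End AdaptedBasis.

(** Opposite elements must share one basis: [tau] exchanges the degrees m and -m and has to carry
    the chosen functionals to the same functionals. *)
Lemma adapted_choice (M : zmodType) : free_of_finite_rank M ->
  exists n (b : M -> 'I_n -> M) (t : M -> 'I_n -> M -> int),
    forall m, [/\ adapted m (b m) (t m), b (- m) = b m & t (- m) = t m].
Proof.
move=> [n [b0 hb]]; exists n.
pose Q m : set (('I_n -> M) * ('I_n -> M -> int)) := [set p | adapted m p.1 p.2].
(* [xget] depends only on the set it chooses from, so equality of these sets makes the choices for m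
   and -m coincide. *)
have QN m : Q (- m) = Q m.
  by apply/seteqP; split => p /adaptedN //=; rewrite opprK.
pose g m := xget (fun=> 0, fun=> fun=> 0) (Q m).
have gP m : Q m (g m).
  by apply: xgetPex; have [b [t h]] := adapted_exists m hb; exists (b, t).
exists (fun m => (g m).1), (fun m => (g m).2) => m.
by rewrite /g QN; split => //; exact: gP.
Qed.

Lemma zmod_morph_sep (K : numFieldType) (M : zmodType) (l m : M) :
  free_of_finite_rank M ->
  (forall th : M -> K^o, zmod_morphism th -> th l = th m) -> l = m.
Proof.
move=> /adapted_choice[n [b [t h]]] e; have [had _ _] := h 0.
rewrite (ad_expand had l) (ad_expand had m); apply: eq_bigr => i _; congr (_ *~ _).
have := e (fun x => (t 0 i x)%:~R); move=> /(_ _)/eqP; rewrite eqr_int => E.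
by apply/eqP/E => x y; rewrite (ad_morph had) intrB.
Qed.

Lemma adapted_expand (K : numFieldType) (M : zmodType) n (m : M) (b : 'I_n -> M) t
    (th : M -> K^o) : adapted m b t -> zmod_morphism th -> th m = 0 ->
  th = \sum_(i < n | t i m == 0) th (b i) *: (fun l => (t i l)%:~R : K^o).
Proof.
move=> ad ath tm; apply/funext => l.
rewrite fct_sumE [in LHS](ad_expand ad l) (zmod_morph_sum ath) [RHS]big_mkcond /=.
apply: eq_bigr => i _; rewrite (zmod_morphMz ath); case: ifPn => [_|ti].
  by rewrite fctE -mulrzr.
(* Only coordinate i of [m] is nonzero, so 0 = th(m) is th(b i) times the nonzero integer
   [t i m]. *)
suff -> : th (b i) = 0 by rewrite mul0rz.
apply/eqP; move: tm; rewrite (ad_expand ad m) (zmod_morph_sum ath) (bigD1 i) //=.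
rewrite big1 ?addr0; last first.
  move=> j ji; rewrite (zmod_morphMz ath); have [->|tj] := eqVneq (t j m) 0.
    by rewrite mulr0z.
  by rewrite (ad_one ad tj ti) eqxx in ji.
by rewrite (zmod_morphMz ath) -mulrzr => /eqP; rewrite mulf_eq0 intr_eq0 (negPf ti) orbF.
Qed.

(** * Root systems and Lie tori *)

Section RootSystem.
Context {K : numFieldType} {V : vectType K} {Delta : set V}.
Hypothesis rs : root_system Delta.
Local Notation roots0 := (nonzero_roots Delta).

Lemma corootP a : roots0 a -> is_coroot Delta a (coroot Delta a).
Proof. by case: rs => _ _ _ h /h; exact: xgetPex. Qed.

Lemma coroot_refl a : roots0 a -> coroot Delta a a = 2.
Proof. by case/corootP. Qed.

Lemma coroot_linear a : roots0 a -> linear_for *%R (coroot Delta a).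
Proof. by case/corootP. Qed.

Lemma reflP a b : roots0 a -> Delta b -> Delta (b - coroot Delta a b *: a).
Proof. by case/corootP => _ _ h _; exact: h. Qed.

Lemma rootN a : roots0 a -> roots0 (- a).
Proof.
move=> ha; split; last by move=> /eqP; rewrite oppr_eq0 => /eqP; case: ha.
have := reflP ha ha.1; rewrite coroot_refl // scaler_nat mulr2n opprD addrA.
by rewrite subrr add0r.
Qed.

(* Composing the reflections in a and b gives a + 2 k (b - a) in Delta for all
   k, which is impossible in a finite set unless a = b. *)
Lemma coroot_sep a b : roots0 a -> roots0 b ->
  (forall c, roots0 c -> coroot Delta c a = coroot Delta c b) -> a = b.
Proof.
move=> ha hb e; apply/eqP; rewrite -subr_eq0; apply/negPn/negP => nz.
pose d := b - a.
have cd c : roots0 c -> coroot Delta c d = 0.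
  by move=> hc; rewrite (linear_forB (coroot_linear hc)) e // subrr.
have ed : b = a + d by rewrite /d addrC subrK.
have d0 : d != 0 by rewrite /d -opprB oppr_eq0.
clearbody d.
have step x : Delta (a + x *: d) -> Delta (a + (x + 2) *: d).
  move=> h; have := reflP ha h.
  have E1 : a + x *: d - coroot Delta a (a + x *: d) *: a = - a + x *: d.
    rewrite (linear_forD (coroot_linear ha)) (linear_forZ (coroot_linear ha)) /=.
    rewrite cd // coroot_refl // mulr0 addr0 scaler_nat mulr2n opprD addrACA.
    by rewrite subrr add0r addrC.
  rewrite E1 => h1; have := reflP hb h1.
  rewrite (linear_forD (coroot_linear hb)) (linear_forZ (coroot_linear hb)) /=.
  rewrite cd // (linear_forN (coroot_linear hb)) mulr0 addr0 e // coroot_refl //.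
  rewrite scaleNr opprK {1}ed scalerDr scaler_nat mulr2n addrACA (addrA (- a)).
  by rewrite addNr add0r -scalerDl.
have all k : Delta (a + (2 * k%:R) *: d).
  elim: k => [|k IH]; first by rewrite mulr0 scale0r addr0; case: ha.
  by rewrite -[k.+1%:R]natr1 mulrDr mulr1; apply: step.
have fD : finite_set Delta by case: rs.
pose g (k : nat) := a + (2 * k%:R) *: d.
have ginj : injective g.
  move=> k l /addrI /eqP; rewrite -subr_eq0 -scalerBl scaler_eq0 => /orP[].
    by rewrite -mulrBr mulf_eq0 pnatr_eq0 /= subr_eq0 eqr_nat => /eqP.
  by rewrite (negPf d0).
apply: infinite_nat; have := finite_preimage (in2W ginj) fD.
by congr finite_set; apply/seteqP; split => k //= _; exact: all.
Qed.

End RootSystem.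

Record torus_data (K : numFieldType) (V : vectType K) (Lam : zmodType)
    (L : lmodType K) (Delta : set V) (X : eala_data V Lam L) : Prop :=
  TorusData {
  td_free : free_of_finite_rank Lam;
  td_rs : root_system Delta;
  td_red : reduced_root_system Delta;
  td_torus : lie_torus Delta (br X) (gr X);
  td_cless : centerless (br X);
  td_form : graded_form (br X) (gr X) (form X);
  td_cent : centroid_basis (br X) (gr X) (Gam X) (chi X) }.

Section LieTorus.
Context {K : numFieldType} {V : vectType K} {Lam : zmodType} {L : lmodType K}.
Context {Delta : set V} {X : eala_data V Lam L}.
Hypothesis H : torus_data Delta X.
Local Notation br := (br X).
Local Notation gr := (gr X).
Local Notation form := (form X).
Local Notation chi := (chi X).
Local Notation roots0 := (nonzero_roots Delta).
Let rs := td_rs H.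
Let T := td_torus H.

Lemma br_linl y : linear_for *:%R (br^~ y).
Proof. by case: (lt_lie T) => -[h _] _ _; exact: h. Qed.
Lemma br_linr x : linear_for *:%R (br x).
Proof. by case: (lt_lie T) => -[_ h] _ _; exact: h. Qed.
Lemma brDl x y z : br (x + y) z = br x z + br y z.
Proof. exact: (linear_forD (br_linl z)). Qed.
Lemma brDr x y z : br z (x + y) = br z x + br z y.
Proof. exact: (linear_forD (br_linr z)). Qed.
Lemma brZl a x z : br (a *: x) z = a *: br x z.
Proof. exact: (linear_forZ (br_linl z)). Qed.
Lemma brZr a x z : br z (a *: x) = a *: br z x.
Proof. exact: (linear_forZ (br_linr z)). Qed.
Lemma br0l z : br 0 z = 0. Proof. exact: (linear_for0 (br_linl z)). Qed.
Lemma br0r z : br z 0 = 0. Proof. exact: (linear_for0 (br_linr z)). Qed.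
Lemma brNr x z : br z (- x) = - br z x.
Proof. exact: (linear_forN (br_linr z)). Qed.

Lemma br_anti x y : br y x = - br x y.
Proof.
have [_ alt _] := lt_lie T; have := alt (x + y).
by rewrite brDl !brDr !alt add0r addr0 => /eqP; rewrite addrC addr_eq0 => /eqP.
Qed.

Lemma br_jacobi x y z : br x (br y z) = br (br x y) z + br y (br x z).
Proof.
have [_ _ jac] := lt_lie T; have := jac x y z => /eqP.
rewrite -addrA addr_eq0 => /eqP ->.
by rewrite (br_anti x z) brNr (br_anti (br x y) z) opprD opprK addrC opprK.
Qed.

Lemma gr_sub a l : subspace (gr a l).
Proof. exact: (direct_sum_subspace (lt_sum T) (I : setT (a, l))). Qed.

Lemma gr_ind (Q : L -> Prop) : Q 0 ->
  (forall (c : K) x y, Q x -> Q y -> Q (c *: x + y)) ->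
  (forall a l x, gr a l x -> Q x) -> forall x, Q x.
Proof.
move=> Q0 QD Qg x; apply: (direct_sum_ind (lt_sum T) Q0 QD _ (I : setT x)).
by move=> [a l] y _; exact: Qg.
Qed.

Lemma gr_Delta a l x : gr a l x -> x != 0 -> Delta a.
Proof.
move=> h x0; apply: contrapT => nD.
by move: h; rewrite (lt_supp T l nD) /= => h; rewrite h eqxx in x0.
Qed.

Lemma gr_notDelta a l x : ~ Delta a -> gr a l x -> x = 0.
Proof.
by move=> na h; apply/eqP/negPn/negP => /(gr_Delta h).
Qed.

Lemma gr_prop a l x y : roots0 a -> gr a l x -> x != 0 -> gr a l y ->
  exists c, y = c *: x.
Proof. by move=> ha; apply: dim_le1_prop; exact: (lt_dim T). Qed.

(** Reducedness enters here: a/2 is not a root, so [lt_dim0] applies to every nonzero root. *)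
Lemma gr_zero_degree a : roots0 a -> exists2 x, gr a 0 x & x != 0.
Proof.
move=> ha; apply: dim_eq1_neq0; apply: (lt_dim0 T) => // h.
have a2 : roots0 (2^-1 *: a).
  split => // /eqP; rewrite scaler_eq0 invr_eq0 pnatr_eq0 /= => /eqP.
  by case: ha.
have := td_red H ha a2; have n2 : (2 : K) != 0 by rewrite pnatr_eq0.
case=> /(congr1 ( *%R 2)); rewrite mulfV ?mulr1 ?mulrN1 // => /eqP.
  by rewrite (eqr_nat _ 1 2).
by rewrite -subr_eq0 opprK -[1 + 2](natrD _ 1 2) pnatr_eq0.
Qed.

(** [lt_sl2] provides some pair (e, f); since the root space is a line, e can be rescaled to [x] and
    f inversely. *)
Lemma sl2_partner a l x : roots0 a -> gr a l x -> x != 0 ->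
  exists y, [/\ gr (- a) (- l) y, y != 0 & forall b m z, gr b m z ->
    br (br x y) z = coroot Delta a b *: z].
Proof.
move=> ha gx x0.
have [e [f [ge gf e0 f0 hef]]] :=
  lt_sl2 T ha (dim_le1_eq1 (lt_dim T l ha) gx x0).
have [c ec] := gr_prop ha ge e0 gx.
have c0 : c != 0 by apply: contraNneq x0 => c0; rewrite ec c0 scale0r.
exists (c^-1 *: f); split.
- by apply: subspaceZ => //; exact: gr_sub.
- by rewrite scaler_eq0 negb_or invr_eq0 c0.
- move=> b m z gz; rewrite ec brZl brZr scalerA mulfV // scale1r.
  have [Db|nDb] := pselect (Delta b); first exact: hef gz.
  by rewrite (gr_notDelta nDb gz) br0r scaler0.
Qed.

Definition is_weight (h : L) (f : V -> K) :=
  linear_for *%R f /\ forall b m x, gr b m x -> br h x = f b *: x.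

(** Evaluation of roots on the degree-zero part of L, extended linearly to all of [V]; on an sl2
    bracket it is the coroot. *)
Definition wt (h : L) : V -> K := xget (fun=> 0) [set f | is_weight h f].

Lemma is_weight_lin h h' f g c : is_weight h f -> is_weight h' g ->
  is_weight (c *: h + h') (fun b => c * f b + g b).
Proof.
move=> [lf hf] [lg hg]; split.
  move=> a x y /=; rewrite lf lg /=.
  by rewrite !mulrDr !addrA; congr (_ + _); rewrite addrAC mulrCA.
by move=> b m x gx; rewrite brDl brZl (hf _ _ _ gx) (hg _ _ _ gx) scalerA scalerDl.
Qed.

Lemma is_weight0 : is_weight 0 (fun=> 0).
Proof.
by split=> [a x y|b m x _]; rewrite ?mulr0 ?addr0 // br0l scale0r.
Qed.

(** L_0^0 is spanned by brackets of opposite root vectors, and since root spaces are lines each such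
    bracket is a multiple of one acting by a coroot. *)
Lemma wtP h : gr 0 0 h -> is_weight h (wt h).
Proof.
move=> hh; apply: (@xgetPex _ (fun=> 0) [set f | is_weight h f]).
move: h hh; rewrite (lt_zero T).
apply: (@lspan_min _ _ _ [set h | exists f, is_weight h f]).
  split; first by exists (fun=> 0); exact: is_weight0.
  move=> c x y [f hf] [g hg].
  by exists (fun b => c * f b + g b); exact: is_weight_lin.
move=> h [a [m [x [y [ha gx]]]]]; rewrite sub0r => gy ->.
have [->|x0] := eqVneq x 0; first by exists (fun=> 0); rewrite br0l; exact: is_weight0.
have [y' [gy' y'0 hy]] := sl2_partner ha gx x0.
have [c ->] := gr_prop (rootN rs ha) gy' y'0 gy.
exists (fun b => c * coroot Delta a b); split.
  move=> d u v; rewrite (coroot_linear rs ha) /= mulrDr; congr (_ + _).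
  by rewrite mulrCA.
by move=> b n z gz; rewrite brZr brZl (hy _ _ _ gz) scalerA.
Qed.

(** The action detects the value at each nonzero root, since its degree-0 root space is nonzero; the
    roots span [V]. *)
Lemma is_weight_uniq h f g : is_weight h f -> is_weight h g -> f = g.
Proof.
move=> [lf hf] [lg hg].
have e b : roots0 b -> f b = g b.
  move=> hb; have [x gx x0] := gr_zero_degree hb.
  have := hf _ _ _ gx; rewrite (hg _ _ _ gx) => /eqP.
  by rewrite -subr_eq0 -scalerBl scaler_eq0 (negPf x0) orbF subr_eq0 => /eqP.
apply/funext => v; have : [set: V] v by [].
case: rs => _ _ <- _; apply: (@lspan_min _ _ _ [set v | f v = g v]).
  split; first by rewrite /= (linear_for0 lf) (linear_for0 lg).
  by move=> a x y /= ex ey; rewrite lf lg ex ey.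
move=> b Db /=; have [->|b0] := eqVneq b 0.
  by rewrite (linear_for0 lf) (linear_for0 lg).
by apply: e; split => //; apply/eqP.
Qed.

Lemma wt_eq h f : gr 0 0 h -> is_weight h f -> wt h = f.
Proof. by move=> /wtP; exact: is_weight_uniq. Qed.

Lemma wt_linear h : gr 0 0 h -> linear_for *%R (wt h).
Proof. by case/wtP. Qed.

Lemma wt_act h b m x : gr 0 0 h -> gr b m x -> br h x = wt h b *: x.
Proof. by move=> /wtP[_]; exact. Qed.

Lemma wt_lin c h h' b : gr 0 0 h -> gr 0 0 h' ->
  wt (c *: h + h') b = c * wt h b + wt h' b.
Proof.
move=> hh hh'; rewrite (@wt_eq (c *: h + h') _ _ (is_weight_lin c (wtP hh) (wtP hh'))) //.
by apply: (gr_sub _ _).2.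
Qed.

Lemma sl2_degree a l x y : gr a l x -> gr (- a) (- l) y -> gr 0 0 (br x y).
Proof. by move=> gx gy; have := lt_grad T gx gy; rewrite !subrr. Qed.

Lemma wt_sl2 a l x : roots0 a -> gr a l x -> x != 0 ->
  exists y, [/\ gr (- a) (- l) y, y != 0, gr 0 0 (br x y) &
    wt (br x y) = coroot Delta a].
Proof.
move=> ha gx x0; have [y [gy y0 hy]] := sl2_partner ha gx x0.
have g0 := sl2_degree gx gy.
exists y; split => //; apply: wt_eq => //; split => //; exact: coroot_linear.
Qed.

(** Such an element acts by 0 on every homogeneous vector, hence is central. *)
Lemma wt_inj h : gr 0 0 h -> (forall b, roots0 b -> wt h b = 0) -> h = 0.
Proof.
move=> gh h0; apply: (td_cless H); apply: gr_ind; first exact: br0r.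
  by move=> c x y ex ey; rewrite brDr brZr ex ey scaler0 addr0.
move=> b m x gx; have [->|x0] := eqVneq x 0; first exact: br0r.
rewrite (wt_act gh gx); have [->|b0] := eqVneq b 0.
  by rewrite (linear_for0 (wt_linear gh)) scale0r.
by rewrite h0 ?scale0r //; split; [exact: gr_Delta gx x0|apply/eqP].
Qed.

(** All coroots occur among the weights; they separate nonzero roots by [coroot_sep], and a nonzero
    root from 0 by the value 2. *)
Lemma wt_sep a b : Delta a -> Delta b ->
  (forall h, gr 0 0 h -> wt h a = wt h b) -> a = b.
Proof.
move=> Da Db e.
have ec c : roots0 c -> coroot Delta c a = coroot Delta c b.
  move=> hc; have [x gx x0] := gr_zero_degree hc.
  by have [y [_ _ g0 <-]] := wt_sl2 hc gx x0; exact: e.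
have z u : roots0 u -> coroot Delta u u != 0.
  by move=> hu; rewrite coroot_refl // pnatr_eq0.
have [a0|a0] := pselect (a = 0); have [b0|b0] := pselect (b = 0).
- by rewrite a0 b0.
- have := z b (conj Db b0); rewrite -ec ?a0 ?(linear_for0 (coroot_linear rs _)) ?eqxx //.
- have := z a (conj Da a0); rewrite ec ?b0 ?(linear_for0 (coroot_linear rs _)) ?eqxx //.
- by apply: (coroot_sep rs) => //.
Qed.

Lemma gr_gr_Lam a l x : gr a l x -> gr_Lam gr l x.
Proof. by move=> h; apply: lspan_incl; exists a. Qed.

Lemma gr_Lam_sum l : direct_sum [set: V] (gr^~ l) (gr_Lam gr l).
Proof.
split => [a _|//|s x us hs e a ha]; first exact: gr_sub.
have inj : injective (fun a : V => (a, l)) by move=> ? ? [].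
have := direct_sum_uniq (lt_sum T) (s := [seq (a, l) | a <- s]) (x := x \o fst).
rewrite map_inj_uniq // big_map => /(_ us (fun _ _ => I) _ e (a, l)); apply.
  by move=> _ /mapP[b bs ->]; case: (hs b bs).
by rewrite mem_map.
Qed.

Lemma gr_of_wt a l x : Delta a -> gr_Lam gr l x ->
  (forall h, gr 0 0 h -> br h x = wt h a *: x) -> gr a l x.
Proof.
move=> Da gx hx.
have [s [xs [us _ gxs nxs ex]]] := direct_sum_decomp (gr_Lam_sum l) gx.
have e b : b \in s -> b != a -> xs b = 0.
  move=> bs ba; apply/eqP/negPn/negP => nz; case/eqP: ba.
  apply: wt_sep => //; first exact: gr_Delta (gxs b I) nz.
  move=> h hh; apply: (direct_sum_eigen (gr_Lam_sum l) us) bs nz => //.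
    by move=> i _; exact: gxs.
  rewrite -ex -hx // [in RHS]ex (linear_for_sum (br_linr h)).
  by apply: eq_bigr => i _; rewrite (wt_act hh (gxs i I)).
rewrite ex; have [as_|nas] := boolP (a \in s).
  rewrite (bigD1_seq a) //= big_seq_cond big1 ?addr0; first exact: gxs.
  by move=> i /andP[]; exact: e.
rewrite big_seq big1; first by case: (gr_sub a l).
by move=> i si; apply: e => //; apply: contraNneq nas => <-.
Qed.

End LieTorus.

Arguments wt {K V Lam L} X h _.

(** * The invariant form, the centroid and the degrees of root vectors *)

Section FormCentroid.
Context {K : numFieldType} {V : vectType K} {Lam : zmodType} {L : lmodType K}.
Context {Delta : set V} {X : eala_data V Lam L}.
Hypothesis H : torus_data Delta X.
Local Notation br := (br X).
Local Notation gr := (gr X).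
Local Notation form := (form X).
Local Notation chi := (chi X).
Local Notation Gam := (Gam X).
Local Notation roots0 := (nonzero_roots Delta).
Let rs := td_rs H.
Let T := td_torus H.
Let C := td_cent H.

Lemma form_linl y : linear_for *%R (form^~ y).
Proof. by case: (gf_bilin (td_form H)) => h _; exact: h. Qed.
Lemma form_linr x : linear_for *%R (form x).
Proof. by case: (gf_bilin (td_form H)) => _ h; exact: h. Qed.
Lemma formZl c x y : form (c *: x) y = c * form x y.
Proof. exact: (linear_forZ (form_linl y)). Qed.
Lemma formZr c x y : form y (c *: x) = c * form y x.
Proof. exact: (linear_forZ (form_linr y)). Qed.
Lemma formDl x y z : form (x + y) z = form x z + form y z.
Proof. exact: (linear_forD (form_linl z)). Qed.
Lemma formDr x y z : form z (x + y) = form z x + form z y.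
Proof. exact: (linear_forD (form_linr z)). Qed.
Lemma form0l z : form 0 z = 0. Proof. exact: (linear_for0 (form_linl z)). Qed.
Lemma form0r z : form z 0 = 0. Proof. exact: (linear_for0 (form_linr z)). Qed.

(** The form is graded by [Lam] only. Orthogonality in the [V]-direction comes from invariance under
    L_0^0, whose weights separate roots. *)
Lemma form_orth a b l m x y : gr a l x -> gr b m y ->
  (a, l) != (- b, - m) -> form x y = 0.
Proof.
move=> gx gy; rewrite xpair_eqE negb_and => /orP[ab|lm]; last first.
  apply: (gf_grad (td_form H) (gr_gr_Lam gx) (gr_gr_Lam gy)).
  by rewrite addr_eq0.
have [->|x0] := eqVneq x 0; first exact: form0l.
have [->|y0] := eqVneq y 0; first exact: form0r.
have Da := gr_Delta H gx x0; have Db := gr_Delta H gy y0.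
have Dnb : Delta (- b).
  have [b0|b0] := pselect (b = 0); first by rewrite b0 oppr0 -b0.
  by have [] := rootN rs (conj Db b0 : roots0 b).
apply/eqP/negPn/negP => nz; case/eqP: ab; apply: (wt_sep H) => // h hh.
have := gf_inv (td_form H) x h y.
rewrite (br_anti H) (wt_act H hh gx) (wt_act H hh gy) formZr.
rewrite -scaleNr formZl => /(mulIf nz) e.
by rewrite (linear_forN (wt_linear H hh)) -e opprK.
Qed.

Lemma form_pairing a l x : gr a l x -> x != 0 ->
  exists2 y, gr (- a) (- l) y & form x y != 0.
Proof.
move=> gx x0; apply: contrapT => h; case/eqP: x0.
apply: (gf_nondeg (td_form H)); apply: (gr_ind H); first exact: form0r.
  by move=> c u v eu ev; rewrite formDr formZr eu ev mulr0 addr0.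
move=> b m y gy; have [e|ne] := eqVneq (a, l) (- b, - m); last first.
  exact: form_orth gx gy ne.
move: e => [ea el]; apply: contrapT => ne; apply: h.
by exists y; [rewrite ea el !opprK|apply/eqP].
Qed.

Lemma form_pair_root a l x y : roots0 a -> gr a l x -> x != 0 ->
  gr (- a) (- l) y -> y != 0 -> form x y != 0.
Proof.
move=> ha gx x0 gy y0; have [z gz] := form_pairing gx x0.
have [c ->] := gr_prop H (rootN rs ha) gy y0 gz.
by rewrite formZr mulf_eq0 negb_or => /andP[].
Qed.

(** L is perfect: a root vector x is half of [h, x] for an sl2 element h, and L_0 is spanned by
    brackets by definition. *)
Lemma perfect_ind (Q : L -> Prop) : Q 0 ->
  (forall (c : K) x y, Q x -> Q y -> Q (c *: x + y)) ->
  (forall x y, Q (br x y)) -> forall x, Q x.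
Proof.
move=> Q0 QD Qb; apply: (gr_ind H) => // a l x gx.
have [->//|x0] := eqVneq x 0.
have [a0|a0] := pselect (a = 0).
  move: gx; rewrite a0 (lt_zero T); apply: (@lspan_min _ _ _ Q); first by [].
  by move=> z [b [m [u [v [_ _ _ ->]]]]]; exact: Qb.
have ha : roots0 a by split => //; exact: (gr_Delta H) gx x0.
have [e ge e0] := gr_zero_degree H ha; have [f [gf _ hef]] := sl2_partner H ha ge e0.
have : Q (2^-1 *: br (br e f) x + 0) by apply: QD => //; exact: Qb.
rewrite addr0 (hef _ _ _ gx) scalerA coroot_refl // mulVf ?scale1r //.
by rewrite pnatr_eq0.
Qed.

Lemma Gam0 : Gam 0. Proof. exact: cb_zero C. Qed.
Lemma GamN m : Gam m -> Gam (- m).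
Proof. by move=> h; rewrite -sub0r; apply: (cb_sub C) => //; exact: Gam0. Qed.
Lemma GamD m n : Gam m -> Gam n -> Gam (m + n).
Proof. by move=> hm hn; rewrite -[n]opprK; apply: (cb_sub C) => //; exact: GamN. Qed.

Lemma chi_centroid m : Gam m -> centroid br (chi m).
Proof.
by move=> hm; apply: (direct_sum_incl (cb_sum C) hm); apply: lspan_incl.
Qed.

Lemma chi_linear m : Gam m -> linear_for *:%R (chi m).
Proof. by case/chi_centroid. Qed.

Lemma chiZ m c x : Gam m -> chi m (c *: x) = c *: chi m x.
Proof. by move=> hm; exact: (linear_forZ (chi_linear hm)). Qed.
Lemma chiD m x y : Gam m -> chi m (x + y) = chi m x + chi m y.
Proof. by move=> hm; exact: (linear_forD (chi_linear hm)). Qed.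
Lemma chi_zero m : Gam m -> chi m 0 = 0.
Proof. by move=> hm; exact: (linear_for0 (chi_linear hm)). Qed.

Lemma chi_brl m x y : Gam m -> chi m (br x y) = br (chi m x) y.
Proof. by move=> /chi_centroid[_ h]; case: (h x y). Qed.
Lemma chi_brr m x y : Gam m -> chi m (br x y) = br x (chi m y).
Proof. by move=> /chi_centroid[_ h]; case: (h x y). Qed.

Lemma chi_mul m n x : Gam m -> Gam n -> chi m (chi n x) = chi (m + n) x.
Proof. by move=> hm hn; rewrite -(cb_mul C hm hn). Qed.

(* Write id in the basis of the centroid: then id = chi 0 \o id. *)
Lemma chi0 x : chi 0 x = x.
Proof.
suff : chi 0 \o id = (id : L -> L) by move=> /(congr1 (@^~ x)).
have : centroid br id by split.
move: (id : L -> L); apply: (direct_sum_ind (cb_sum C)).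
- by apply/funext => y /=; rewrite (chi_zero Gam0).
- move=> a f g ef eg; apply/funext => y /=.
  rewrite !fctE chiD ?chiZ //; [|exact: Gam0|exact: Gam0].
  by rewrite -[in RHS]ef -[in RHS]eg.
- move=> m f hm /lspan1P[a ->]; apply/funext => y /=; rewrite !fctE.
  by rewrite chiZ ?chi_mul ?add0r //; exact: Gam0.
Qed.

Lemma chiK m x : Gam m -> chi (- m) (chi m x) = x.
Proof. by move=> hm; rewrite chi_mul ?addNr ?chi0 //; exact: GamN. Qed.
Lemma chiNK m x : Gam m -> chi m (chi (- m) x) = x.
Proof. by move=> hm; rewrite chi_mul ?subrr ?chi0 //; exact: GamN. Qed.

Lemma chi_neq0 m x : Gam m -> x != 0 -> chi m x != 0.
Proof.
move=> hm; apply: contraNneq => e; rewrite -(chiK x hm) e.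
by rewrite chi_zero //; exact: GamN.
Qed.

(** [cb_deg] controls the [Lam]-degree; the [V]-degree is kept because chi^m commutes with the
    action of L_0^0. *)
Lemma chi_gr m a l x : Gam m -> gr a l x -> gr a (l + m) (chi m x).
Proof.
move=> hm gx; have [->|x0] := eqVneq x 0.
  by rewrite chi_zero //; case: (gr_sub H a (l + m)).
apply: (gr_of_wt H); first exact: (gr_Delta H) gx x0.
  exact: (cb_deg C) (gr_gr_Lam gx).
by move=> h hh; rewrite -chi_brr // (wt_act H hh gx) chiZ.
Qed.

(** On a bracket, chi^m passes from one factor to the other and invariance moves it across the form;
    perfectness does the rest. *)
Lemma form_chi m x y : Gam m -> form (chi m x) y = form x (chi m y).
Proof.
move=> hm; move: x; apply: perfect_ind.
- by rewrite chi_zero // !form0l.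
- by move=> c u v eu ev; rewrite chiD // chiZ // !formDl !formZl eu ev.
- move=> u v; rewrite chi_brr // (gf_inv (td_form H)) -chi_brl // chi_brr //.
  by rewrite -(gf_inv (td_form H)).
Qed.

Definition root_degree (l : Lam) := exists a x, [/\ roots0 a, gr a l x & x != 0].

(** The degrees of nonzero root vectors generate [Lam]: a degree occurring only in L_0 is a sum of
    two of them, since L_0 is spanned by brackets of root vectors. An additive functional is
    therefore determined by its values on root degrees. *)
Lemma root_degree_ind (Q : Lam -> Prop) : Q 0 ->
  (forall l m, Q l -> Q m -> Q (l - m)) ->
  (forall l, root_degree l -> Q l) -> forall l, Q l.
Proof.
move=> Q0 QB Qr l; have : [set: Lam] l by [].
have QN u : Q u -> Q (- u) by rewrite -sub0r; exact: QB.
have QD u v : Q u -> Q v -> Q (u + v).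
  by move=> hu /QN hv; rewrite -[v]opprK; exact: QB.
rewrite -(lt_full T); apply: zspan_ind => // {}l [a [x [Da gx x0]]].
have [a0|a0] := pselect (a = 0); last by apply: Qr; exists a, x.
(* Otherwise every bracket spanning L_0^l would vanish, and [x] with it. *)
have : exists b m, [/\ Q m & Q (l - m)] /\ roots0 b; last first.
  by move=> [_ [m [[hm hlm] _]]]; rewrite -[l](subrK m); exact: QD.
apply: contrapT => h; case/eqP: x0; move: gx; rewrite a0 (lt_zero T).
apply: (@lspan_min _ _ _ [set 0]).
  by split=> // c u v -> ->; rewrite scaler0 addr0.
move=> z [b [m [u [v [hb gu gv ->]]]]]; apply: contrapT => /eqP nz; apply: h.
exists b, m; split => //; split; apply: Qr.
  exists b, u; split => //; apply: contraNneq nz => ->; exact/eqP/(br0l H).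
exists (- b), v; split; [exact: rootN|exact: gv|].
by apply: contraNneq nz => ->; exact/eqP/(br0r H).
Qed.

End FormCentroid.

(** * Derivations *)

Section Derivations.
Context {K : numFieldType} {V : vectType K} {Lam : zmodType} {L : lmodType K}.
Context {Delta : set V} {X : eala_data V Lam L}.
Hypothesis H : torus_data Delta X.
Local Notation br := (br X).
Local Notation gr := (gr X).
Local Notation form := (form X).
Local Notation chi := (chi X).
Local Notation Gam := (Gam X).
Implicit Types th ps : Lam -> K^o.

Definition is_pd th (d : L -> L) :=
  linear_for *:%R d /\ forall l x, gr_Lam gr l x -> d x = th l *: x.

(** Defined for every function [th], so that [pd] is linear in [th] without side conditions;
    additivity of [th] is what makes it a derivation. *)
Definition pd th : L -> L := xget 0 [set d | is_pd th d].

Lemma pdP th : is_pd th (pd th).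
Proof.
apply: (@xgetPex _ 0 [set d | is_pd th d]).
have [d ld hd] := direct_sum_scale (fun i => th i.2) (lt_sum (td_torus H)).
exists d; split => // l; apply: (@lspan_min _ _ _ [set x | d x = th l *: x]).
  split; first by rewrite /= scaler0 (linear_for0 ld).
  move=> c x y /= ex ey; rewrite (linear_forD ld) (linear_forZ ld) /= ex ey.
  by rewrite scalerDr !scalerA mulrC.
by move=> x [a _ gx]; exact: (hd (a, l)).
Qed.

Lemma pd_linear th : linear_for *:%R (pd th). Proof. by case: (pdP th). Qed.

Lemma pd_act th a l x : gr a l x -> pd th x = th l *: x.
Proof. by move=> /gr_gr_Lam; case: (pdP th) => _; exact. Qed.

Lemma linear_fun_ext (f g : L -> L) : linear_for *:%R f -> linear_for *:%R g ->
  (forall a l x, gr a l x -> f x = g x) -> f = g.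
Proof.
move=> lf lg e; apply/funext; apply: (gr_ind H) => //.
  by rewrite (linear_for0 lf) (linear_for0 lg).
by move=> c x y ex ey; rewrite lf lg ex ey.
Qed.

Lemma pd_uniq th d : linear_for *:%R d ->
  (forall a l x, gr a l x -> d x = th l *: x) -> d = pd th.
Proof.
move=> ld hd; apply: linear_fun_ext => //; first exact: pd_linear.
by move=> a l x gx; rewrite (hd _ _ _ gx) (pd_act _ gx).
Qed.

Lemma pd_lin c th ps : pd (c *: th + ps) = c *: pd th + pd ps.
Proof.
apply/esym/pd_uniq.
  move=> a x y /=; rewrite !fctE !pd_linear /= !scalerDr !scalerA mulrC.
  by rewrite addrACA.
move=> a l x gx; rewrite !fctE !(pd_act _ gx) scalerDl scalerA.
by congr (_ + _).
Qed.

Lemma pd_degree (th : {additive Lam -> K}) d : degree_der gr th d <-> d = pd th.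
Proof.
split=> [[ld hd]|->]; last exact: pdP.
by apply: pd_uniq => // a l x /gr_gr_Lam; exact: hd.
Qed.

Lemma pd_der th x y : zmod_morphism th ->
  pd th (br x y) = br (pd th x) y + br x (pd th y).
Proof.
move=> ath; move: x; apply: (gr_ind H).
- by rewrite (br0l H) !(linear_for0 (pd_linear th)) !(br0l H) addr0.
- move=> c u v eu ev; rewrite !(brDl H) !(brZl H) pd_linear /= eu ev.
  by rewrite pd_linear !(brDl H) !(brZl H) /= scalerDr addrACA.
- move=> a l x gx; move: y; apply: (gr_ind H).
  + by rewrite (br0r H) !(linear_for0 (pd_linear th)) !(br0r H) addr0.
  + move=> c u v eu ev; rewrite !(brDr H) !(brZr H) pd_linear /= eu ev.
    by rewrite pd_linear !(brDr H) !(brZr H) /= scalerDr addrACA.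
  + move=> b m y gy; rewrite (pd_act _ (lt_grad (td_torus H) gx gy)).
    rewrite (pd_act _ gx) (pd_act _ gy) (brZl H) (brZr H) -scalerDl.
    by rewrite (zmod_morphD ath).
Qed.

Definition sd m th : L -> L := chi m \o pd th.

Lemma SCDer_pieceP m d : SCDer_piece gr chi m d <->
  exists th, [/\ zmod_morphism th, th m = 0 & d = sd m th].
Proof.
split=> [[th [d0 [/pd_degree-> e ->]]]|[th [ath e ->]]].
  by exists th; split => //; exact: raddfB.
pose g : {additive Lam -> K} := HB.pack (th : Lam -> K)
  (GRing.isZmodMorphism.Build Lam K th ath).
by exists g, (pd th); split => //; apply/pd_degree.
Qed.

Lemma sd_linear m th : Gam m -> linear_for *:%R (sd m th).
Proof. by move=> hm c x y; rewrite /sd /= pd_linear (chi_linear H hm). Qed.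

Lemma sd_act m th a l x : Gam m -> gr a l x -> sd m th x = th l *: chi m x.
Proof. by move=> hm gx; rewrite /sd /= (pd_act _ gx) (chiZ H). Qed.

Lemma sd_lin m c th ps : Gam m -> sd m (c *: th + ps) = c *: sd m th + sd m ps.
Proof.
move=> hm; apply/funext => x; rewrite /sd /= pd_lin !fctE.
by rewrite (chiD H) // (chiZ H).
Qed.

Lemma sd_zero m : Gam m -> sd m 0 = 0.
Proof.
move=> hm; have := sd_lin (-1) 0 0 hm.
by rewrite scaler0 addr0 scaleN1r addNr.
Qed.

Lemma sdZ m c th : Gam m -> sd m (c *: th) = c *: sd m th.
Proof. by move=> hm; rewrite -[_ *: _]addr0 sd_lin // sd_zero // addr0. Qed.

Lemma sdN m th : Gam m -> sd m (- th) = - sd m th.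
Proof. by move=> hm; rewrite -scaleN1r sdZ // scaleN1r. Qed.

Lemma sd_sum m (I : Type) (s : seq I) (P : pred I) (F : I -> Lam -> K^o) :
  Gam m -> sd m (\sum_(i <- s | P i) F i) = \sum_(i <- s | P i) sd m (F i).
Proof.
move=> hm; elim/big_rec2: _ => [|i f g _ <-]; first exact: sd_zero.
by rewrite -[F i]scale1r sd_lin // !scale1r.
Qed.

Lemma sd_der m th x y : Gam m -> zmod_morphism th ->
  sd m th (br x y) = br (sd m th x) y + br x (sd m th y).
Proof.
move=> hm ath; rewrite /sd /= pd_der // (chiD H) //.
by rewrite (chi_brl H) // (chi_brr H).
Qed.

(** For homogeneous x, y of degrees l, n a nonzero pairing forces l + m + n = 0, whence th(l) =
    -th(n) because th(m) = 0. *)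
Lemma sd_skew m th x y : Gam m -> zmod_morphism th -> th m = 0 ->
  form (sd m th x) y = - form x (sd m th y).
Proof.
move=> hm ath thm; move: x; apply: (gr_ind H).
- by rewrite (linear_for0 (sd_linear _ hm)) !(form0l H) oppr0.
- move=> c u v eu ev; rewrite (sd_linear _ hm) !(formDl H) !(formZl H) /= eu ev.
  by rewrite opprD mulrN.
- move=> a l x gx; move: y; apply: (gr_ind H).
  + by rewrite (linear_for0 (sd_linear _ hm)) !(form0r H) oppr0.
  + move=> c u v eu ev; rewrite (sd_linear _ hm) !(formDr H) !(formZr H) /= eu ev.
    by rewrite opprD mulrN.
  + move=> b n y gy; rewrite (sd_act _ hm gx) (sd_act _ hm gy).
    rewrite (formZl H) (formZr H) -mulNr -(form_chi H) //.
    have [e|ne] := eqVneq (a, l + m) (- b, - n); last first.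
      by rewrite (form_orth H (chi_gr H hm gx) gy ne) !mulr0.
    congr (_ * _); case: e => _ e; apply/eqP; rewrite -subr_eq0 opprK.
    have := congr1 th e; rewrite (zmod_morphD ath) thm addr0 (zmod_morphN ath).
    by move=> ->; rewrite addNr.
Qed.

Lemma sd_comm m n th ps : Gam m -> Gam n -> zmod_morphism th -> zmod_morphism ps ->
  commutator (sd m th) (sd n ps) = sd (m + n) (th n *: ps - ps m *: th).
Proof.
move=> hm hn ath aps; have hmn := GamD H hm hn; apply: linear_fun_ext.
- move=> c x y; rewrite /commutator (sd_linear _ hn) (sd_linear _ hm) /=.
  by rewrite (sd_linear _ hm) (sd_linear _ hn) /= scalerBr opprD addrACA.
- exact: sd_linear.
- move=> a l x gx; rewrite /commutator !(sd_act _ _ gx) //.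
  rewrite (linear_forZ (sd_linear _ hm)) (linear_forZ (sd_linear _ hn)) /=.
  rewrite (sd_act _ hm (chi_gr H hn gx)) (sd_act _ hn (chi_gr H hm gx)).
  rewrite !(chi_mul H) // [n + m]addrC !scalerA -scalerBl; congr (_ *: _).
  rewrite (zmod_morphD ath) (zmod_morphD aps) !fctE !mulrDr.
  rewrite /GRing.scale /= [ps l * th l]mulrC opprD addrACA subrr add0r.
  by rewrite mulrC [th l * _]mulrC.
Qed.

Lemma sd_inj m th ps : Gam m -> zmod_morphism th -> zmod_morphism ps ->
  sd m th = sd m ps -> th = ps.
Proof.
move=> hm ath aps e; apply/funext; apply: (root_degree_ind H).
- by rewrite (zmod_morph0 ath) (zmod_morph0 aps).
- by move=> l n el en; rewrite ath aps el en.
- move=> l [a [x [ha gx x0]]]; have := congr1 (@^~ x) e.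
  rewrite /= !(sd_act _ hm gx) => /eqP; rewrite -subr_eq0 -scalerBl scaler_eq0.
  by rewrite (negPf (chi_neq0 H hm x0)) orbF subr_eq0 => /eqP.
Qed.

Lemma zmod_morph_lin (c : K) th ps : zmod_morphism th -> zmod_morphism ps ->
  zmod_morphism (c *: th + ps).
Proof.
by move=> ath aps x y; rewrite !fctE ath aps scalerBr opprD addrACA.
Qed.

End Derivations.

Arguments pd {K V Lam L} X th _.
Arguments sd {K V Lam L} X m th _.

(** * The algebra E, its roots and its core *)

Lemma pair_lin (K : numFieldType) (U W : lmodType K) k (u v : U * W) :
  k *: u + v = (k *: u.1 + v.1, k *: u.2 + v.2).
Proof. by []. Qed.

(** Common form of the two cases of the theorem, with [G] equal to {0} or to [Gam X]: D is full in
    the degrees of [G] and zero elsewhere. *)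
Record der_data (K : numFieldType) (V : vectType K) (Lam : zmodType)
    (L : lmodType K) (Delta : set V) (X : eala_data V Lam L) (G : set Lam) : Prop :=
  DerData {
  dd_torus : torus_data Delta X;
  dd_subalg : subalgebra (@commutator K L) (der X);
  dd_graded : direct_sum (Gam X) (der_piece X) (der X);
  dd_0 : G 0;
  dd_sub : forall m n, G m -> G n -> G (m - n);
  dd_Gam : G `<=` Gam X;
  dd_in : forall m, G m -> der_piece X m = SCDer_piece (gr X) (chi X) m;
  dd_out : forall m d, Gam X m -> ~ G m -> der_piece X m d -> d = 0 }.

Section Eala.
Context {K : numFieldType} {V : vectType K} {Lam : zmodType} {L : lmodType K}.
Context {Delta : set V} {X : eala_data V Lam L} {G : set Lam}.
Hypothesis HD : der_data Delta X G.
Let H := dd_torus HD.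
Local Notation br := (br X).
Local Notation gr := (gr X).
Local Notation form := (form X).
Local Notation chi := (chi X).
Local Notation Gam := (Gam X).
Local Notation D := (der X).
Local Notation sd := (sd X).
Implicit Types (th ps : Lam -> K^o) (c : (L -> L) -> K^o).

Lemma GN m : G m -> G (- m).
Proof. by move=> h; rewrite -sub0r; apply: (dd_sub HD) => //; exact: dd_0 HD. Qed.
Lemma GD m n : G m -> G n -> G (m + n).
Proof. by move=> hm hn; rewrite -[n]opprK; apply: (dd_sub HD) => //; exact: GN. Qed.
Lemma G_Gam m : G m -> Gam m. Proof. exact: dd_Gam HD m. Qed.

Lemma D_sub : subspace D. Proof. by case: (dd_subalg HD). Qed.
Lemma D_comm d d' : D d -> D d' -> D (commutator d d').
Proof. by case: (dd_subalg HD) => _; exact. Qed.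

Lemma piece_sd m th : G m -> zmod_morphism th -> th m = 0 -> der_piece X m (sd m th).
Proof. by move=> Gm ath t0; rewrite (dd_in HD Gm); apply/(SCDer_pieceP H); exists th. Qed.

Lemma D_sd m th : G m -> zmod_morphism th -> th m = 0 -> D (sd m th).
Proof. by move=> Gm ath t0; case: (piece_sd Gm ath t0). Qed.

Lemma piece_ex m d : der_piece X m d -> exists th,
  [/\ zmod_morphism th, th m = 0 & d = sd m th].
Proof. by case=> _ /(SCDer_pieceP H). Qed.

Lemma D_ind (Q : (L -> L) -> Prop) : Q 0 ->
  (forall (k : K) d d', Q d -> Q d' -> Q (k *: d + d')) ->
  (forall m th, G m -> zmod_morphism th -> th m = 0 -> Q (sd m th)) ->
  forall d, D d -> Q d.
Proof.
move=> Q0 QD Qs; apply: (direct_sum_ind (dd_graded HD)) => // m d hm hd.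
have [Gm|nG] := pselect (G m); last by rewrite (dd_out HD hm nG hd).
by have [th [ath e ->]] := piece_ex hd; exact: Qs.
Qed.

Lemma D_linear d : D d -> linear_for *:%R d.
Proof.
move: d; apply: D_ind.
- by move=> a x y; rewrite /= scaler0 addr0.
- move=> k d d' ld ld' a x y; rewrite !fctE ld ld' /= !scalerDr !scalerA mulrC.
  by rewrite addrACA.
- by move=> m th /G_Gam Gm _ _; exact: (sd_linear H).
Qed.

Lemma D_der d x y : D d -> d (br x y) = br (d x) y + br x (d y).
Proof.
move: d; apply: D_ind.
- by rewrite /= (br0l H) (br0r H) addr0.
- move=> k d d' e e'; rewrite !fctE e e' (brDl H) (brDr H) (brZl H) (brZr H).
  by rewrite scalerDr addrACA.
- by move=> m th /G_Gam Gm ath _; exact: (sd_der H).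
Qed.

Lemma D_skew d x y : D d -> form (d x) y = - form x (d y).
Proof.
move: d; apply: D_ind.
- by rewrite /= (form0l H) (form0r H) oppr0.
- move=> k d d' e e'; rewrite !fctE (formDl H) (formDr H) (formZl H) (formZr H).
  by rewrite e e' opprD mulrN.
- by move=> m th /G_Gam Gm ath t0; exact: (sd_skew H).
Qed.

Lemma D_degree0 d a x : D d -> gr a 0 x -> d x = 0.
Proof.
move=> Dd gx; move: d Dd; apply: D_ind => //.
  by move=> k d d' e e'; rewrite !fctE e e' scaler0 addr0.
move=> m th /G_Gam Gm ath _.
by rewrite (sd_act H _ Gm gx) (zmod_morph0 ath) scale0r.
Qed.

Lemma comm0r d : D d -> commutator d 0 = 0.
Proof.
by move=> Dd; apply/funext => x; rewrite /commutator /= (linear_for0 (D_linear Dd)) subr0.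
Qed.

Lemma comm_linl d : D d -> forall k d1 d2,
  commutator (k *: d1 + d2) d = k *: commutator d1 d + commutator d2 d.
Proof.
move=> Dd k d1 d2; apply/funext => x; rewrite /commutator !fctE.
by rewrite (D_linear Dd) /= scalerBr opprD addrACA.
Qed.

Lemma comm_linr d : D d -> forall k d1 d2,
  commutator d (k *: d1 + d2) = k *: commutator d d1 + commutator d d2.
Proof.
move=> Dd k d1 d2; apply/funext => x; rewrite /commutator !fctE.
by rewrite (D_linear Dd) /= scalerBr opprD addrACA.
Qed.

Lemma der_actE d c d' : D d' -> der_act X d c d' = c (commutator d' d).
Proof. exact: zero_extE. Qed.

Lemma der_act_off d c d' : ~ D d' -> der_act X d c d' = 0.
Proof. exact: zero_extN. Qed.

Lemma der_act_lin d k c c' :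
  der_act X d (k *: c + c') = k *: der_act X d c + der_act X d c'.
Proof.
apply/funext => d'; rewrite !fctE; have [Dd'|nD] := pselect (D d').
  by rewrite !der_actE.
by rewrite !der_act_off // scaler0 addr0.
Qed.

Lemma der_act0r d : der_act X d 0 = 0.
Proof. by have := der_act_lin d (-1) 0 0; rewrite scaler0 addr0 scaleN1r addNr. Qed.

Lemma der_act0l c : dual D c -> der_act X 0 c = 0.
Proof.
move=> hc; apply/funext => d'; have [Dd'|nD] := pselect (D d').
  by rewrite der_actE // comm0r // (dual0 D_sub hc).
by rewrite der_act_off.
Qed.

Lemma der_act_dual d c : D d -> dual D c -> dual D (der_act X d c).
Proof.
move=> Dd hc; split; last by move=> x; exact: der_act_off.
move=> k x y Dx Dy; rewrite !der_actE //; last by apply: D_sub.2.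
by rewrite comm_linl // hc.1 //; apply: D_comm.
Qed.

Lemma sigmaE x y d : D d -> sigma X x y d = form (d x) y.
Proof. exact: zero_extE. Qed.

Lemma sigma_dual x y : dual D (sigma X x y).
Proof.
split; last by move=> d; exact: zero_extN.
move=> k d d' Dd Dd'; rewrite !sigmaE //; last by apply: D_sub.2.
by rewrite !fctE (formDl H) (formZl H).
Qed.

Lemma sigma_linl y : linear_for *:%R (fun x => sigma X x y).
Proof.
move=> k u v; apply: (dual_ext (sigma_dual _ _)) => /=.
  by apply: (dual_subspace D).2; exact: sigma_dual.
move=> d Dd; rewrite !fctE !sigmaE // (D_linear Dd).
by rewrite (formDl H) (formZl H).
Qed.

Lemma sigma_linr x : linear_for *:%R (fun y => sigma X x y).
Proof.
move=> k u v; apply: (dual_ext (sigma_dual _ _)) => /=.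
  by apply: (dual_subspace D).2; exact: sigma_dual.
move=> d Dd; rewrite !fctE !sigmaE //.
by rewrite (formDr H) (formZr H).
Qed.

Lemma sigma0l y : sigma X 0 y = 0. Proof. exact: (linear_for0 (sigma_linl y)). Qed.
Lemma sigma0r x : sigma X x 0 = 0. Proof. exact: (linear_for0 (sigma_linr x)). Qed.

Lemma piece_dual_subspace m : subspace (der_piece_dual X m).
Proof.
split; first by split; [exact: (dual_subspace D).1|].
move=> k c c' [hc zc] [hc' zc']; split; first exact: (dual_subspace D).2.
by move=> n d hn nm hd; rewrite !fctE (zc n) // (zc' n) // scaler0 addr0.
Qed.

Lemma gr_dual_subspace : subspace (gr_dual X).
Proof. exact: lspan_subspace. Qed.

Lemma gr_dual_dual c : gr_dual X c -> dual D c.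
Proof.
move: c; apply: (@lspan_min _ _ _ (dual D)); first exact: dual_subspace.
by move=> c [m _ []].
Qed.

Lemma piece_dual_gr m c : Gam m -> der_piece_dual X m c -> gr_dual X c.
Proof. by move=> hm hc; apply: lspan_incl; exists m. Qed.

Lemma sigma_piece a b l m x y : gr a l x -> gr b m y ->
  der_piece_dual X (- (l + m)) (sigma X x y).
Proof.
move=> gx gy; split; first exact: sigma_dual.
move=> n d hn nm hd; have [th [ath t0 e]] := piece_ex hd.
rewrite sigmaE; last by case: hd.
rewrite e (sd_act H _ hn gx) (formZl H) (form_orth H (chi_gr H hn gx) gy) ?mulr0 //.
apply: contraNneq nm => -[_ e2]; rewrite -[m]opprK -e2.
by rewrite opprB addrC addKr.
Qed.

(** For homogeneous arguments of degrees l, m the functional has degree l + m; if -(l + m) is not in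
    [Gam], no element of D can shift the degrees into a nonzero pairing, and the functional is 0. *)
Lemma sigma_gr_dual x y : gr_dual X (sigma X x y).
Proof.
move: x; apply: (gr_ind H); first by rewrite sigma0l; exact: gr_dual_subspace.1.
  by move=> k u v hu hv; rewrite sigma_linl; apply: gr_dual_subspace.2.
move=> a l x gx; move: y.
apply: (gr_ind H); first by rewrite sigma0r; exact: gr_dual_subspace.1.
  by move=> k u v hu hv; rewrite sigma_linr; apply: gr_dual_subspace.2.
move=> b m y gy; have [hG|nG] := pselect (Gam (- (l + m))).
  exact: piece_dual_gr hG (sigma_piece gx gy).
suff -> : sigma X x y = 0 by exact: gr_dual_subspace.1.
apply: (dual_ext (sigma_dual _ _) (dual_subspace D).1) => d Dd.
rewrite sigmaE //=; move: d Dd; apply: D_ind; first exact: (form0l H).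
  by move=> k d d' e e'; rewrite !fctE (formDl H) (formZl H) e e' mulr0 addr0.
move=> n th /G_Gam hn ath _; rewrite (sd_act H _ hn gx) (formZl H).
rewrite (form_orth H (chi_gr H hn gx) gy) ?mulr0 //.
apply: contra_not_neq nG => -[_ e2]; rewrite -[m]opprK -e2.
by rewrite opprB addrC addKr.
Qed.

(** The elements of D are derivations and the form is invariant; this is the 2-cocycle identity
    behind the central extension. *)
Lemma sigma_cocycle x y z :
  sigma X x (br y z) = sigma X (br x y) z + sigma X y (br x z).
Proof.
apply: (dual_ext (sigma_dual _ _)).
  by rewrite -[sigma X (br x y) z]scale1r; apply: (dual_subspace D).2; exact: sigma_dual.
move=> d Dd; rewrite !fctE !sigmaE // D_der // (formDl H).
have inv := gf_inv (td_form H).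
rewrite inv (br_anti H (d y) x) -scaleN1r (formZl H) inv mulN1r.
by rewrite -addrA addNr addr0.
Qed.

Lemma der_act_sigma d x y : D d ->
  der_act X d (sigma X x y) = sigma X (d x) y + sigma X x (d y).
Proof.
move=> Dd; apply: (dual_ext (der_act_dual Dd (sigma_dual _ _))).
  by rewrite -[sigma X (d x) y]scale1r; apply: (dual_subspace D).2; exact: sigma_dual.
move=> d' Dd'; rewrite der_actE // !fctE !sigmaE //; last exact: D_comm.
rewrite /commutator (formDl H) -scaleN1r (formZl H) mulN1r.
by rewrite (D_skew (d' x) y Dd) opprK.
Qed.

Local Notation E := (eala X).

Lemma ambient_linE k (u v : @ambient K L) : k *: u + v =
  (k *: u.1.1 + v.1.1, k *: u.1.2 + v.1.2, k *: u.2 + v.2).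
Proof. by rewrite (@pair_lin _ _ _ k u v) (@pair_lin _ _ _ k u.1 v.1). Qed.

Lemma eala_subspace : subspace E.
Proof.
split; first by split; [exact: gr_dual_subspace.1|exact: D_sub.1].
move=> k u v [cu du] [cv dv]; rewrite ambient_linE; split => /=.
  exact: (gr_dual_subspace.2 k _ _ cu cv).
exact: (D_sub.2 k _ _ du dv).
Qed.

(** Explicit description of the core, identified with it in [coreE]. *)
Definition core0 : set (@ambient K L) := [set u | gr_dual X u.1.2 /\ u.2 = 0].

Lemma core0_subspace : subspace core0.
Proof.
split; first by split; [exact: gr_dual_subspace.1|].
move=> k u v [cu du] [cv dv]; rewrite ambient_linE; split => /=.
  exact: (gr_dual_subspace.2 k _ _ cu cv).
by rewrite du dv scaler0 addr0.
Qed.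

Lemma core0_eala : core0 `<=` E.
Proof. by move=> u [cu du]; split => //; rewrite du; exact: D_sub.1. Qed.

Lemma injL_core0 x : core0 (injL x).
Proof. by split => //; exact: gr_dual_subspace.1. Qed.

Lemma injL_lin k x y : injL (k *: x + y) = k *: injL x + injL y :> @ambient K L.
Proof.
by congr (_, _, _) => /=; rewrite scaler0 addr0.
Qed.

Lemma injLZ k x : injL (k *: x) = k *: injL x :> @ambient K L.
Proof. by rewrite -[k *: x]addr0 injL_lin addr0. Qed.

Lemma injL_inj : injective (@injL K L).
Proof. by move=> x y []. Qed.

Lemma brE_injr u y : E u ->
  brE X u (injL y) = (br u.1.1 y + u.2 y, sigma X u.1.1 y, 0).
Proof.
move=> [cu du]; rewrite /brE /=; congr (_, _, _).
- by rewrite subr0.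
- by rewrite der_act0r der_act0l ?subr0 ?addr0 //; exact: gr_dual_dual.
- exact: comm0r.
Qed.

Lemma brE_core0 u v : core0 u -> core0 v ->
  brE X u v = (br u.1.1 v.1.1, sigma X u.1.1 v.1.1, 0).
Proof.
move=> [cu du] [cv dv]; rewrite /brE du dv; congr (_, _, _).
- by rewrite /= subr0 addr0.
- by rewrite !der_act0l ?subr0 ?addr0 //; exact: gr_dual_dual.
- exact/comm0r/D_sub.1.
Qed.

Lemma core0_subalgebra : subalgebra (brE X) core0.
Proof.
split; first exact: core0_subspace.
by move=> u v hu hv; rewrite brE_core0 //; split => //; exact: sigma_gr_dual.
Qed.

(** Applied to Cartan elements, for the weights of brackets, and to lifts of derivations, for
    integrality in isotropic degrees. *)
Lemma brE_jacobi u y z : E u -> brE X u (brE X (injL y) (injL z)) =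
  brE X (brE X u (injL y)) (injL z) + brE X (injL y) (brE X u (injL z)).
Proof.
move=> Eu; have [cu Du] := Eu.
have cI p q q' : core0 (p, sigma X q q', 0).
  by split => //; exact: sigma_gr_dual.
rewrite (brE_core0 (injL_core0 y) (injL_core0 z)) (brE_injr y Eu) (brE_injr z Eu).
rewrite (brE_core0 (cI _ u.1.1 y) (injL_core0 z)).
rewrite (brE_core0 (injL_core0 y) (cI _ u.1.1 z)).
rewrite /brE /=; congr (_, _, _).
- rewrite /= subr0 (br_jacobi H) (D_der y z Du) (brDl H) (brDr H).
  by rewrite addrACA.
- rewrite /= der_act0l ?subr0; last exact: gr_dual_dual.
  rewrite der_act_sigma // sigma_cocycle.
  rewrite (linear_forD (sigma_linl z)) (linear_forD (sigma_linr y)) /=.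
  by rewrite addrACA.
- by rewrite /= comm0r // addr0.
Qed.

End Eala.

Arguments core0 {K V Lam L} X _.

(** * Weights of the Cartan subalgebra *)

Section Roots.
Context {K : numFieldType} {V : vectType K} {Lam : zmodType} {L : lmodType K}.
Context {Delta : set V} {X : eala_data V Lam L} {G : set Lam}.
Hypothesis HD : der_data Delta X G.
Let H := dd_torus HD.
Local Notation br := (br X).
Local Notation gr := (gr X).
Local Notation Gam := (Gam X).
Local Notation D := (der X).
Local Notation sd := (sd X).
Local Notation pd := (pd X).
Local Notation wt := (wt X).
Local Notation E := (eala X).
Implicit Types (th ps : Lam -> K^o) (c : (L -> L) -> K^o) (h u : @ambient K L).
Implicit Types r : @ambient K L -> K^o.

Lemma Delta0 : Delta 0. Proof. by case: (td_rs H). Qed.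

Lemma pd_sd th : pd th = sd 0 th.
Proof. by apply/funext => x; rewrite /sd /= (chi0 H). Qed.

Lemma pd_piece th : zmod_morphism th -> der_piece X 0 (pd th).
Proof.
move=> ath; rewrite pd_sd; apply: (piece_sd HD) => //; first exact: dd_0 HD.
exact: zmod_morph0.
Qed.

Lemma D_pd th : zmod_morphism th -> D (pd th).
Proof. by move=> /pd_piece[]. Qed.

Lemma piece0_ex d : der_piece X 0 d -> exists2 th, zmod_morphism th & d = pd th.
Proof. by move=> /(piece_ex HD)[th [ath _ ->]]; exists th => //; rewrite -pd_sd. Qed.

Lemma pd_inj th ps : zmod_morphism th -> zmod_morphism ps -> pd th = pd ps -> th = ps.
Proof. by rewrite !pd_sd; apply: (sd_inj H); exact: Gam0 H. Qed.

Lemma ev_pd l th : zmod_morphism th -> ev X l (pd th) = th l.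
Proof.
move=> ath; rewrite /ev zero_extE; last exact: pd_piece.
apply: xget_unique.
  pose g : {additive Lam -> K} := HB.pack (th : Lam -> K)
    (GRing.isZmodMorphism.Build Lam K th ath).
  by exists g; split => //; apply/(pd_degree H).
move=> y [g [/(pd_degree H) e ->]]; rewrite (pd_inj ath _ e) //.
exact: raddfB.
Qed.

Lemma cartan_pd h : cartan X h -> exists2 th, zmod_morphism th & h.2 = pd th.
Proof. by case=> _ _ /piece0_ex. Qed.

Lemma cartan_subspace : subspace (cartan X).
Proof.
split.
  split; [exact: (gr_sub H 0 0).1|exact: (piece_dual_subspace 0).1|].
  exact: (direct_sum_subspace (dd_graded HD) (Gam0 H)).1.
move=> k u v [u1 u2 u3] [v1 v2 v3]; rewrite ambient_linE; split => /=.
- exact: (gr_sub H 0 0).2.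
- exact: ((piece_dual_subspace 0).2 k _ _ u2 v2).
- exact: ((direct_sum_subspace (dd_graded HD) (Gam0 H)).2 k _ _ u3 v3).
Qed.

Lemma cartan_eala : cartan X `<=` E.
Proof. by move=> h [_ h2 [h3 _]]; split => //; exact: piece_dual_gr (Gam0 H) h2. Qed.

Lemma cartan_pair t th : gr 0 0 t -> zmod_morphism th -> cartan X (t, 0, pd th).
Proof.
by move=> ht hth; split => //=; [exact: (piece_dual_subspace 0).1|exact: pd_piece].
Qed.

(** The component in (D^0)^* does not contribute, because it acts trivially on E
    ([der_act_piece0]). *)
Definition rt (a : V) (l : Lam) : @ambient K L -> K^o :=
  zero_ext (cartan X) (fun h => wt h.1.1 a + ev X l h.2).

Lemma rtE a l h th : cartan X h -> zmod_morphism th -> h.2 = pd th ->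
  rt a l h = wt h.1.1 a + th l.
Proof. by move=> hh ath e; rewrite /rt zero_extE // e ev_pd. Qed.

Lemma rt_pair a l t th : gr 0 0 t -> zmod_morphism th ->
  rt a l (t, 0, pd th) = wt t a + th l.
Proof. by move=> ht ath; apply: rtE => //; exact: cartan_pair. Qed.

Lemma rt_dual a l : dual (cartan X) (rt a l).
Proof.
split; last by move=> h; exact: zero_extN.
move=> k u v hu hv; have [th ath eu] := cartan_pd hu; have [ps aps ev_] := cartan_pd hv.
have huv := cartan_subspace.2 k u v hu hv.
rewrite (rtE a l hu ath eu) (rtE a l hv aps ev_).
rewrite (rtE a l (th := k *: th + ps) huv); last first.
- by rewrite ambient_linE /= eu ev_ (pd_lin H).
- exact: zmod_morph_lin.
rewrite ambient_linE /= (wt_lin H); [|by case: hu|by case: hv].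
by rewrite fctE mulrDr addrACA.
Qed.

Lemma rt_eq a l r : dual (cartan X) r ->
  (forall h, cartan X h -> r h = rt a l h) -> r = rt a l.
Proof. by move=> dr; apply: dual_ext => //; exact: rt_dual. Qed.

Lemma rtD a b l m : rt a l + rt b m = rt (a + b) (l + m).
Proof.
apply: rt_eq; first exact: (subspaceD (dual_subspace _) (rt_dual a l) (rt_dual b m)).
move=> h hh; have [th ath e] := cartan_pd hh; have h1 : gr 0 0 h.1.1 by case: hh.
rewrite fctE !(rtE _ _ hh ath e) (zmod_morphD ath).
by rewrite (linear_forD (wt_linear H h1)) addrACA.
Qed.

Lemma rtN a l : - rt a l = rt (- a) (- l).
Proof.
apply: rt_eq; first by apply: subspaceN; [exact: dual_subspace|exact: rt_dual].
move=> h hh; have [th ath e] := cartan_pd hh; have h1 : gr 0 0 h.1.1 by case: hh.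
rewrite fctE !(rtE _ _ hh ath e) (zmod_morphN ath) opprD.
by rewrite (linear_forN (wt_linear H h1)).
Qed.

Lemma wt0 b : wt 0 b = 0.
Proof.
have h0 := (gr_sub H 0 0).1; have := wt_lin H (-1) b h0 h0.
by rewrite scaler0 addr0 mulN1r addNr.
Qed.

Lemma zmod0 : zmod_morphism (0 : Lam -> K^o).
Proof. by move=> x y; rewrite /= subr0. Qed.

(** L_0^0 separates the roots of L and the additive functionals separate [Lam]; taking [th] or [t]
    to be 0 decouples the two. *)
Lemma rt_inj a b l m : Delta a -> Delta b ->
  (forall t th, gr 0 0 t -> zmod_morphism th -> wt t a + th l = wt t b + th m) ->
  a = b /\ l = m.
Proof.
move=> Da Db e; split.
  by apply: (wt_sep H) => // h hh; have := e h 0 hh zmod0; rewrite !addr0.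
apply: (zmod_morph_sep (K := K) (td_free H)) => th ath.
by have := e 0 th (gr_sub H 0 0).1 ath; rewrite !wt0 !add0r.
Qed.

Lemma sigma_degree0 a t x : gr a 0 t -> sigma X t x = 0.
Proof.
move=> ht; apply: (dual_ext (sigma_dual HD _ _) (dual_subspace D).1) => d Dd.
by rewrite sigmaE // (D_degree0 HD Dd ht) (form0l H).
Qed.

(** The functional sees only the degree-0 part of a commutator, and commutators of homogeneous
    elements of D have none. *)
Lemma der_act_piece0 c d : der_piece_dual X 0 c -> D d -> der_act X d c = 0.
Proof.
move=> [hc zc] Dd; apply: (dual_ext (der_act_dual HD Dd hc) (dual_subspace D).1).
move=> d' Dd'; rewrite der_actE //=.
(* Membership in D is carried through the induction because [c] is linear only on D. *)
suff [] : D d' /\ c (commutator d' d) = 0 by [].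
move: d' {Dd'}(Dd'); apply: (D_ind HD).
- split; first exact: (D_sub HD).1.
  have -> : commutator 0 d = 0.
    by apply/funext => x; rewrite /commutator /= (linear_for0 (D_linear HD Dd)) subr0.
  exact: (dual0 (D_sub HD) hc).
- move=> k d1 d2 [D1 e1] [D2 e2]; split; first exact: (D_sub HD).2.
  rewrite (comm_linl HD) // (hc.1 k _ _ (D_comm HD D1 Dd) (D_comm HD D2 Dd)).
  by rewrite e1 e2 mulr0 addr0.
- move=> m th Gm ath tm; have Dm := D_sd HD Gm ath tm; split => //.
  suff [] : D d /\ c (commutator (sd m th) d) = 0 by [].
  move: d {Dd}(Dd); apply: (D_ind HD).
  + by split; [exact: (D_sub HD).1|rewrite (comm0r HD) // (dual0 (D_sub HD) hc)].
  + move=> k d1 d2 [D1 e1] [D2 e2]; split; first exact: (D_sub HD).2.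
    rewrite (comm_linr HD) // (hc.1 k _ _ (D_comm HD Dm D1) (D_comm HD Dm D2)).
    by rewrite e1 e2 mulr0 addr0.
  + move=> n ps Gn aps pn; have Dn := D_sd HD Gn aps pn; split => //.
    have Dc := D_comm HD Dm Dn; move: Dc.
    rewrite (sd_comm H (G_Gam HD Gm) (G_Gam HD Gn) ath aps) => Dc.
    (* For n = -m both coefficients th(n) and ps(m) vanish; otherwise the commutator lies in a
       nonzero degree, where [c] is 0. *)
    have [e|ne] := eqVneq (m + n) 0.
      have en : n = - m by apply/eqP; rewrite -addr_eq0 addrC e.
      have -> : th n = 0 by rewrite en (zmod_morphN ath) tm oppr0.
      have -> : ps m = 0.
        by move: pn; rewrite en (zmod_morphN aps) => /eqP; rewrite oppr_eq0 => /eqP.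
      rewrite !scale0r subrr (sd_zero H); last exact: (G_Gam HD (GD HD Gm Gn)).
      exact: (dual0 (D_sub HD) hc).
    apply: (zc (m + n)) => //; first exact: (G_Gam HD (GD HD Gm Gn)).
    apply: (piece_sd HD (GD HD Gm Gn)).
      rewrite -scaleNr addrC; apply: zmod_morph_lin => //.
      by rewrite -[_ *: _]addr0; apply: zmod_morph_lin => //; exact: zmod0.
    rewrite !fctE (zmod_morphD ath) (zmod_morphD aps) tm pn add0r addr0.
    by rewrite /GRing.scale /= mulrC subrr.
Qed.

Lemma cartan_act h u th : cartan X h -> zmod_morphism th -> h.2 = pd th -> E u ->
  brE X h u = (br h.1.1 u.1.1 + pd th u.1.1, der_act X (pd th) u.1.2,
    commutator (pd th) u.2).
Proof.
move=> [h1 h2 h3] ath e [cu Du]; rewrite /brE -e; congr (_, _, _).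
- by rewrite (D_degree0 HD Du h1) subr0.
- by rewrite (sigma_degree0 _ h1) add0r (der_act_piece0 h2 Du) subr0.
Qed.

Lemma comm_pd_sd th m ps : zmod_morphism th -> zmod_morphism ps -> Gam m ->
  commutator (pd th) (sd m ps) = th m *: sd m ps.
Proof.
move=> ath aps Gm; rewrite {1}pd_sd (sd_comm H) //; last exact: Gam0 H.
by rewrite (zmod_morph0 aps) scale0r subr0 add0r (sdZ H).
Qed.

Lemma comm_sd_pd th m ps : zmod_morphism th -> zmod_morphism ps -> Gam m ->
  commutator (sd m ps) (pd th) = - th m *: sd m ps.
Proof.
move=> ath aps Gm; rewrite scaleNr -comm_pd_sd //.
by apply/funext => x; rewrite /commutator !fctE opprB.
Qed.

Lemma der_act_pd c th m ps : dual D c -> zmod_morphism th -> G m ->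
  zmod_morphism ps -> ps m = 0 ->
  der_act X (pd th) c (sd m ps) = - th m * c (sd m ps).
Proof.
move=> hc ath Gm aps pm; have Dm := D_sd HD Gm aps pm.
rewrite der_actE // comm_sd_pd //; last exact: (G_Gam HD Gm).
exact: (dualZ (D_sub HD) _ hc Dm).
Qed.

Lemma L_weight x (k : L -> (Lam -> K^o) -> K) : x != 0 ->
  (forall t th, gr 0 0 t -> zmod_morphism th -> br t x + pd th x = k t th *: x) ->
  exists a l, [/\ Delta a, gr a l x &
    forall t th, gr 0 0 t -> zmod_morphism th -> k t th = wt t a + th l].
Proof.
move=> x0 hx.
have [[a l] [_ gx e]] : exists i, [/\ setT i, gr i.1 i.2 x & forall j : L * (Lam -> K^o),
    gr 0 0 j.1 /\ zmod_morphism j.2 -> k j.1 j.2 = wt j.1 i.1 + j.2 i.2].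
  apply: (direct_sum_weight (T := fun j y => br j.1 y + pd j.2 y)
    (lt_sum (td_torus H))) => //.
  - move=> [t th] _ c y z _ _ /=; rewrite (brDr H) (brZr H) (pd_linear H) /=.
    by rewrite scalerDr addrACA.
  - move=> [t th] [a l] y [/= ht ath] _ gy.
    by rewrite (wt_act H ht gy) (pd_act H _ gy) -scalerDl.
  - move=> [a l] [b m] y z _ _ /= gy y0 gz z0 e.
    have [-> ->//] : a = b /\ l = m.
    apply: (rt_inj (gr_Delta H gy y0) (gr_Delta H gz z0)) => t th ht ath.
    exact: (e (t, th)).
  - by move=> [t th] [/= ht ath]; exact: hx.
exists a, l; split => //; first exact: (gr_Delta H) gx x0.
by move=> t th ht ath; exact: (e (t, th)).
Qed.

Lemma D_weight d (k : (Lam -> K^o) -> K) : D d -> d != 0 ->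
  (forall th, zmod_morphism th -> commutator (pd th) d = k th *: d) ->
  exists l, [/\ Gam l, der_piece X l d & forall th, zmod_morphism th -> k th = th l].
Proof.
move=> Dd d0 hd.
apply: (direct_sum_weight (T := fun th => commutator (pd th)) (dd_graded HD)) => //.
- by move=> th ath c d1 d2 _ _; apply: (comm_linr HD); exact: D_pd.
- move=> th l d' ath Gl /(piece_ex HD)[ps [aps pl ->]]; exact: comm_pd_sd.
- move=> l m d1 d2 _ _ _ _ _ _ e.
  exact: zmod_morph_sep (td_free H) e.
Qed.

Lemma dual_ext_sd c c' : dual D c -> dual D c' ->
  (forall m th, G m -> zmod_morphism th -> th m = 0 -> c (sd m th) = c' (sd m th)) ->
  c = c'.
Proof.
move=> hc hc' e; apply: (dual_ext hc hc') => d Dd.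
suff [] : D d /\ c d = c' d by [].
move: d {Dd}(Dd); apply: (D_ind HD).
- by split; [exact: (D_sub HD).1|rewrite !(dual0 (D_sub HD))].
- move=> a d1 d2 [D1 e1] [D2 e2]; split; first exact: (D_sub HD).2.
  by rewrite hc.1 // hc'.1 // e1 e2.
- by move=> m th Gm ath tm; split; [exact: (D_sd HD Gm ath tm)|exact: e].
Qed.

(** Evaluation at a single chi^l d_th on which [c] is nonzero reads off the weight; the sign is that
    of the dual action. *)
Lemma dual_weight c (k : (Lam -> K^o) -> K) : gr_dual X c -> c != 0 ->
  (forall th, zmod_morphism th -> der_act X (pd th) c = k th *: c) ->
  exists2 l, G l & forall th, zmod_morphism th -> k th = th (- l).
Proof.
move=> gc c0 hc; have dc := gr_dual_dual gc.
have [m [th [Gm ath tm nz]]] : exists m th,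
    [/\ G m, zmod_morphism th, th m = 0 & c (sd m th) != 0].
  apply: contrapT => h; case/eqP: c0.
  apply: (dual_ext_sd dc (dual_subspace D).1) => m th Gm ath tm /=.
  by apply/eqP/negPn/negP => nz; apply: h; exists m, th.
exists m => // ps aps; have := congr1 (@^~ (sd m th)) (hc ps aps).
rewrite /= der_act_pd // !fctE => /esym/(mulIf nz) ->.
by rewrite (zmod_morphN aps).
Qed.

End Roots.

Arguments rt {K V Lam L} X a l _.

Lemma ambientZ (K : numFieldType) (L : lmodType K) k (u : @ambient K L) :
  k *: u = (k *: u.1.1, k *: u.1.2, k *: u.2).
Proof. by rewrite -[k *: u]addr0 ambient_linE /= !addr0. Qed.

(** * Root spaces *)

Section RootSpaces.
Context {K : numFieldType} {V : vectType K} {Lam : zmodType} {L : lmodType K}.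
Context {Delta : set V} {X : eala_data V Lam L} {G : set Lam}.
Hypothesis HD : der_data Delta X G.
Let H := dd_torus HD.
Local Notation br := (br X).
Local Notation gr := (gr X).
Local Notation form := (form X).
Local Notation chi := (chi X).
Local Notation Gam := (Gam X).
Local Notation roots0 := (nonzero_roots Delta).
Local Notation D := (der X).
Local Notation sd := (sd X).
Local Notation pd := (pd X).
Local Notation wt := (wt X).
Local Notation rt := (rt X).
Local Notation E := (eala X).
Implicit Types (th ps : Lam -> K^o) (c : (L -> L) -> K^o) (h u : @ambient K L).
Implicit Types r : @ambient K L -> K^o.

Lemma root_space_injL a l x : gr a l x -> root_space X (rt a l) (injL x).
Proof.
move=> gx; split; first exact/(core0_eala HD)/injL_core0.
move=> h hh; have [th ath e] := cartan_pd HD hh.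
rewrite (cartan_act HD hh ath e) /=; last exact/(core0_eala HD)/injL_core0.
rewrite (rtE HD _ _ hh ath e) -injLZ (wt_act H _ gx); last by case: hh.
rewrite (pd_act H _ gx) -scalerDl der_act0r (comm0r HD) //.
exact: (D_pd HD).
Qed.

Lemma eala_sd m ps : G m -> zmod_morphism ps -> ps m = 0 -> E (0, 0, sd m ps).
Proof.
by move=> Gm aps pm; split => /=;
  [exact: (gr_dual_subspace (X := X)).1|exact: (D_sd HD Gm)].
Qed.

Lemma root_space_sd m ps : G m -> zmod_morphism ps -> ps m = 0 ->
  root_space X (rt 0 m) (0, 0, sd m ps).
Proof.
move=> Gm aps pm; have Es := eala_sd Gm aps pm; split => // h hh.
have [th ath e] := cartan_pd HD hh.
rewrite (cartan_act HD hh ath e Es) (rtE HD _ _ hh ath e) ambientZ /=.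
rewrite (br0r H) (linear_for0 (pd_linear H th)) addr0 der_act0r !scaler0.
rewrite (comm_pd_sd HD ath aps (G_Gam HD Gm)) (linear_for0 (wt_linear H _)) ?add0r //.
by case: hh.
Qed.

Lemma root_space_proj r u h th : root_space X r u -> cartan X h ->
  zmod_morphism th -> h.2 = pd th ->
  [/\ br h.1.1 u.1.1 + pd th u.1.1 = r h *: u.1.1,
      der_act X (pd th) u.1.2 = r h *: u.1.2 &
      commutator (pd th) u.2 = r h *: u.2].
Proof.
move=> [Eu hu] hh ath e; have := hu h hh.
by rewrite (cartan_act HD hh ath e Eu) ambientZ => -[-> -> ->].
Qed.

Lemma root_space_pair r u t th : root_space X r u -> gr 0 0 t ->
  zmod_morphism th ->
  [/\ br t u.1.1 + pd th u.1.1 = r (t, 0, pd th) *: u.1.1,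
      der_act X (pd th) u.1.2 = r (t, 0, pd th) *: u.1.2 &
      commutator (pd th) u.2 = r (t, 0, pd th) *: u.2].
Proof.
by move=> hu ht ath; apply: (root_space_proj hu (cartan_pair HD ht ath) ath).
Qed.

Let gr000 : gr 0 0 0 := (gr_sub H 0 0).1.

Lemma rt0E l h th : cartan X h -> zmod_morphism th -> h.2 = pd th ->
  rt 0 l h = th l.
Proof.
move=> hh ath e; rewrite (rtE HD _ _ hh ath e).
by rewrite (linear_for0 (wt_linear H _)) ?add0r //; case: hh.
Qed.

(** The Cartan subalgebra acts on the three components of [u] separately and with the same
    eigenvalues, so whichever component is nonzero determines [r]. *)
Lemma root_space_class r u : root_space X r u -> u != 0 -> dual (cartan X) r ->
  exists a l, Delta a /\ r = rt a l.
Proof.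
move=> hu u0 dr; have [Eu _] := hu; have [gu Du] := Eu.
have [x0|x0] := eqVneq u.1.1 0; last first.
  have [|a [l [Da gx _]]] := L_weight HD (k := fun t th => r (t, 0, pd th)) x0.
    by move=> t th ht ath; case: (root_space_pair hu ht ath).
  exists a, l; split => //; apply: (rt_eq HD dr) => h hh.
  have [th ath e] := cartan_pd HD hh; rewrite (rtE HD _ _ hh ath e).
  have [eq _ _] := root_space_proj hu hh ath e; apply: (scaler_inj x0).
  have h1 : gr 0 0 h.1.1 by case: hh.
  by rewrite -eq scalerDl (wt_act H h1 gx) (pd_act H _ gx).
have D0 := Delta0 HD.
have [c0|c0] := eqVneq u.1.2 0; last first.
  have [|l _ hl] := dual_weight HD (k := fun th => r (0, 0, pd th)) gu c0.
    by move=> th ath; case: (root_space_pair hu gr000 ath).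
  exists 0, (- l); split => //; apply: (rt_eq HD dr) => h hh.
  have [th ath e] := cartan_pd HD hh; rewrite (rt0E _ hh ath e) -hl //.
  have [_ e1 _] := root_space_proj hu hh ath e; apply: (scaler_inj c0).
  by rewrite -e1; have [_ -> _] := root_space_pair hu gr000 ath.
have [d0|d0] := eqVneq u.2 0.
  by case/eqP: u0; case: u x0 c0 d0 {hu Eu gu Du} => -[x c] d /= -> -> ->.
have [|l [_ _ hl]] := D_weight HD (k := fun th => r (0, 0, pd th)) Du d0.
  by move=> th ath; case: (root_space_pair hu gr000 ath).
exists 0, l; split => //; apply: (rt_eq HD dr) => h hh.
have [th ath e] := cartan_pd HD hh; rewrite (rt0E _ hh ath e) -hl //.
have [_ _ e1] := root_space_proj hu hh ath e; apply: (scaler_inj d0).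
by rewrite -e1; have [_ _ ->] := root_space_pair hu gr000 ath.
Qed.

Lemma root_space_L a l u : Delta a -> root_space X (rt a l) u -> gr a l u.1.1.
Proof.
move=> Da hu; have [->|x0] := eqVneq u.1.1 0; first exact: (gr_sub H a l).1.
have [|b [m [Db gx e]]] := L_weight HD (k := fun t th => rt a l (t, 0, pd th)) x0.
  by move=> t th ht ath; case: (root_space_pair hu ht ath).
have [-> ->//] : a = b /\ l = m.
by apply: (rt_inj HD) => // t th ht ath; rewrite -e // (rt_pair HD).
Qed.

Lemma root_space_D a l u : Delta a -> root_space X (rt a l) u -> u.2 != 0 ->
  a = 0 /\ der_piece X l u.2.
Proof.
move=> Da hu d0; have [[_ Du] _] := hu.
have [|m [_ hd e]] := D_weight HD (k := fun th => rt a l (0, 0, pd th)) Du d0.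
  by move=> th ath; case: (root_space_pair hu gr000 ath).
have [-> ->//] : a = 0 /\ l = m.
apply: (rt_inj HD) => //; first exact: (Delta0 HD).
move=> t th ht ath; have := root_space_pair hu ht ath => -[_ _].
have := root_space_pair hu gr000 ath => -[_ _ ->] /(scaler_inj d0).
rewrite e // (rt_pair HD) // => <-.
by rewrite (linear_for0 (wt_linear H ht)) add0r.
Qed.

Lemma root_space_c a l u : Delta a -> root_space X (rt a l) u -> u.1.2 != 0 -> a = 0.
Proof.
move=> Da hu c0; have [[gu _] _] := hu.
have [|m _ e] := dual_weight HD (k := fun th => rt a l (0, 0, pd th)) gu c0.
  by move=> th ath; case: (root_space_pair hu gr000 ath).
have [//] : a = 0 /\ l = - m.
apply: (rt_inj HD) => //; first exact: (Delta0 HD).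
move=> t th ht ath; have := root_space_pair hu ht ath => -[_ + _].
have := root_space_pair hu gr000 ath => -[_ -> _] /(scaler_inj c0).
rewrite e // (rt_pair HD) // => <-.
by rewrite (linear_for0 (wt_linear H ht)) add0r.
Qed.

(** D and its graded dual have [V]-weight 0, so they cannot contribute when a is nonzero. *)
Lemma root_space_noniso a l u : roots0 a -> root_space X (rt a l) u ->
  exists2 x, gr a l x & u = injL x.
Proof.
move=> [Da a0] hu; exists u.1.1; first exact: root_space_L.
have c0 : u.1.2 = 0 by apply/eqP/negPn/negP => /(root_space_c Da hu).
have d0 : u.2 = 0 by apply/eqP/negPn/negP => /(root_space_D Da hu)[].
by case: u c0 d0 {hu} => -[x c] d /= -> ->.
Qed.

(** * Subalgebras containing the nonisotropic root vectors *)

Section Generation.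
Variable A : set (@ambient K L).
Hypothesis sA : subalgebra (brE X) A.
Hypothesis hA : forall a l x, roots0 a -> gr a l x -> A (injL x).

Let sA' : subspace A := sA.1.

(* All the brackets [x, y] with x in L_a^l and y normalised in L_-a^-l are the
   same element; the bracket with l = 0 has no component in the dual of D. *)
Lemma sigma_generated a l x y m : roots0 a -> gr a l x -> gr (- a) (- l) y ->
  wt (br x y) = coroot Delta a -> Gam m -> A (0, sigma X x (chi m y), 0).
Proof.
move=> ha gx gy hw hm; have hna := rootN (td_rs H) ha.
have [x0 gx0 x00] := gr_zero_degree H ha.
have [y0 [gy0 _ g0 hw0]] := wt_sl2 H ha gx0 x00.
have e : br x y = br x0 y0.
  have gxy := sl2_degree H gx gy.
  apply/eqP; rewrite -subr_eq0 addrC -scaleN1r; apply/eqP.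
  apply: (wt_inj H); first exact: (gr_sub H 0 0).2.
  by move=> b _; rewrite (wt_lin H) // hw hw0 mulN1r addNr.
have gB b n z : gr b n z -> gr b (n + m) (chi m z) by exact: (chi_gr H hm).
have A1 := sA.2 _ _ (hA ha gx) (hA hna (gB _ _ _ gy)).
have A2 := sA.2 _ _ (hA ha gx0) (hA hna (gB _ _ _ gy0)).
have := sA'.2 (-1) _ _ A2 A1.
rewrite !(brE_core0 HD (injL_core0 _) (injL_core0 _)) /=.
rewrite (sigma_degree0 HD _ gx0) -!(chi_brr H) // e ambient_linE /=.
by rewrite !scaler0 !addr0 !add0r scaleN1r addNr.
Qed.

(** Evaluation at l is additive in l, so root degrees suffice, and there a normalised sigma(x,
    chi^-m y) works. With [A] the core this yields the dual part of the core; with [A] everything it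
    just supplies evaluation functionals on D^m. *)
Lemma dual_generated m l : G m -> exists c, [/\ der_piece_dual X m c, A (0, c, 0) &
  forall th, zmod_morphism th -> th m = 0 -> c (sd m th) = th l].
Proof.
move=> Gm; have hm := G_Gam HD Gm; have hnm := GamN H hm.
move: l; apply: (root_degree_ind H).
- exists 0; split; [exact: (piece_dual_subspace m).1|exact: sA'.1|].
  by move=> th ath _; rewrite (zmod_morph0 ath).
- move=> l n [c [hc Ac vc]] [c' [hc' Ac' vc']]; exists (c - c'); split.
  + by apply: subspaceB => //; exact: piece_dual_subspace.
  + have := sA'.2 (-1) _ _ Ac' Ac; rewrite ambient_linE /= !scaler0 !addr0.
    by rewrite scaleN1r addrC.
  + by move=> th ath tm; rewrite !fctE vc // vc' // ath.
- move=> l [a [x [ha gx x0]]].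
  have [y [gy y0 _ hw]] := wt_sl2 H ha gx x0.
  have nz := form_pair_root H ha gx x0 gy y0.
  (* Applied to chi^m d_th, sigma gives th(l) (chi^m x, chi^-m y) = th(l) (x, y). *)
  exists ((form x y)^-1 *: sigma X x (chi (- m) y)); split.
  + apply: subspaceZ; first exact: piece_dual_subspace.
    have := sigma_piece HD gx (chi_gr H hnm gy).
    by rewrite addrA subrr add0r opprK.
  + have := sA'.2 (form x y)^-1 _ _ (sigma_generated ha gx gy hw hnm) sA'.1.
    by rewrite ambient_linE /= !scaler0 !addr0.
  + move=> th ath tm; rewrite fctE sigmaE; last exact: (D_sd HD Gm ath tm).
    rewrite (sd_act H _ hm gx) (formZl H) (form_chi H) // (chiNK H) //.
    by rewrite /GRing.scale /= mulrCA mulVf ?mulr1.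
Qed.

Lemma gr_dual_generated c : gr_dual X c -> A (0, c, 0).
Proof.
have lin : subspace [set c : (L -> L) -> K^o | A (0, c, 0)].
  split; first exact: sA'.1.
  move=> k c1 c2 h1 h2 /=; have := sA'.2 k _ _ h1 h2.
  by rewrite ambient_linE /= !scaler0 !addr0.
move: c; apply: (lspan_min lin) => c [m hm [hc zc]] /=.
have [Gm|nG] := pselect (G m); last first.
  suff -> : c = 0 by exact: sA'.1.
  apply: (dual_ext_sd HD hc (dual_subspace D).1) => n th Gn ath tn /=.
  apply: (zc n); [exact: (G_Gam HD Gn)| |exact: (piece_sd HD Gn ath tn)].
  by apply: contra_not_neq nG => <-.
have [n [b [t had]]] := adapted_choice (td_free H); have [ad _ _] := had m.
pose tK i l := ((t m i l)%:~R : K^o).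
have tKm i : zmod_morphism (tK i).
  by move=> x y; rewrite /tK (ad_morph ad) intrB.
have ex i := dual_generated (b m i) Gm.
have [f fP] := choice ex.
have tKm0 i : t m i m == 0 -> tK i m = 0 by rewrite /tK => /eqP ->.
(* The evaluations [f i] at the adapted basis vectors form the basis of (D^m)^* dual to the
   derivations chi^m d_th with th = [tK i]. *)
have sumE : c = \sum_(i < n | t m i m == 0) (c (sd m (tK i)) : K) *: f i.
  apply: (dual_ext_sd HD hc).
    rewrite -big_filter; apply: subspace_sum; first exact: dual_subspace.
    move=> i _; apply: subspaceZ; first exact: dual_subspace.
    by have [[]] := fP i.
  move=> p th Gp ath tp; rewrite fct_sumE.
  have [epm|npm] := eqVneq p m; last first.
    rewrite (zc p (sd p th)) //; [|exact: (G_Gam HD Gp)|exact: (piece_sd HD Gp ath tp)].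
    rewrite big1 // => i _; rewrite fctE; have [[_ zi] _ _] := fP i.
    by rewrite (zi p) ?scaler0 //; [exact: (G_Gam HD Gp)|exact: (piece_sd HD Gp ath tp)].
  move: tp; rewrite epm => tm.
  have esd : sd m th = \sum_(i < n | t m i m == 0) th (b m i) *: sd m (tK i).
    rewrite [in LHS](adapted_expand ad ath tm) (sd_sum H _ _ _ hm).
    by apply: eq_bigr => i _; exact: (sdZ H _ _ hm).
  rewrite [in LHS]esd -[X in c X]big_filter -[RHS]big_filter.
  rewrite (linear_on_sum (fun i => th (b m i)) (x := fun i => sd m (tK i))
    (D_sub HD) (dual_linear_on hc)); last first.
    move=> i; rewrite mem_filter => /andP[/tKm0 ti _].
    exact: (D_sd HD Gm (tKm i) ti).
  apply: eq_bigr => i _; have [_ _ fv] := fP i; rewrite fctE (fv th ath tm).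
  by rewrite /GRing.scale /= mulrC.
rewrite sumE -big_filter; apply: (subspace_sum lin) => i _.
by apply: (subspaceZ _ lin); have [] := fP i.
Qed.

(** A bracket of opposite root vectors is [x, y] + sigma(x, y), and its sigma part is already in
    [A]; subtracting it leaves the generators of L_0. *)
Lemma core0_generated : core0 X `<=` A.
Proof.
have inj x : A (injL x).
  move: x; apply: (gr_ind H); first exact: sA'.1.
    by move=> k x y hx hy; rewrite injL_lin; apply: sA'.2.
  move=> a l x gx; have [a0|a0] := pselect (a = 0); last first.
    have [Da|nDa] := pselect (Delta a); first exact: (hA (conj Da a0) gx).
    by rewrite (gr_notDelta H nDa gx); exact: sA'.1.
  move: x gx; rewrite a0 (lt_zero (td_torus H)).
  apply: (@lspan_min _ _ _ [set x | A (injL x)]).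
    by split; [exact: sA'.1|move=> k x y hx hy /=; rewrite injL_lin; apply: sA'.2].
  move=> _ [b [m [x [y [hb gx gy ->]]]]] /=.
  have := sA.2 _ _ (hA hb gx) (hA (rootN (td_rs H) hb) gy).
  rewrite (brE_core0 HD (injL_core0 _) (injL_core0 _)) /=.
  move=> /(sA'.2 (-1) _ _ (gr_dual_generated (sigma_gr_dual HD x y))).
  by rewrite ambient_linE /= !scaler0 add0r addr0 scaleN1r addNr.
move=> [[x c] d] [/= hc ->]; have := sA'.2 1 _ _ (inj x) (gr_dual_generated hc).
by rewrite ambient_linE /= !scaler0 !scale1r !addr0 add0r.
Qed.

End Generation.
End RootSpaces.

(** * Isotropic and nonisotropic roots; the core *)

Section Core.
Context {K : numFieldType} {V : vectType K} {Lam : zmodType} {L : lmodType K}.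
Context {Delta : set V} {X : eala_data V Lam L} {G : set Lam}.
Hypothesis HD : der_data Delta X G.
Let H := dd_torus HD.
Local Notation br := (br X).
Local Notation gr := (gr X).
Local Notation form := (form X).
Local Notation roots0 := (nonzero_roots Delta).
Local Notation pd := (pd X).
Local Notation wt := (wt X).
Local Notation rt := (rt X).
Local Notation E := (eala X).
Local Notation noniso := (nonisotropic_roots X).
Local Notation iso := (isotropic_roots X).
Implicit Types (th ps : Lam -> K^o) (c : (L -> L) -> K^o) (h u : @ambient K L).
Implicit Types r : @ambient K L -> K^o.

Lemma formE_sym u v : formE X u v = formE X v u.
Proof. by rewrite /formE (gf_sym (td_form H)) addrAC. Qed.

Lemma dual_evaluation l : exists2 c, der_piece_dual X 0 c &
  forall th, zmod_morphism th -> c (pd th) = th l.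
Proof.
have [//|//|c [hc _ vc]] := dual_generated HD (A := setT) _ _ l (dd_0 HD).
exists c => // th ath; rewrite (pd_sd HD) vc //; exact: zmod_morph0.
Qed.

Lemma formE_cartan x c h th : cartan X h -> h.2 = pd th ->
  formE X (x, c, 0) h = form x h.1.1 + c (pd th).
Proof.
move=> [_ [h2 _] _] e; rewrite /formE /= e (dual0 (D_sub HD) h2).
by rewrite addr0.
Qed.

Definition represents r h := cartan X h /\ forall h', cartan X h' -> formE X h h' = r h'.

Lemma pd_zero : pd 0 = 0.
Proof. by rewrite (pd_sd HD) (sd_zero H (Gam0 H)). Qed.

Lemma cartan_dual t c : gr 0 0 t -> der_piece_dual X 0 c -> cartan X (t, c, 0).
Proof. by move=> ht hc; split => //=; rewrite -pd_zero; exact: (pd_piece HD (@zmod0 K Lam)). Qed.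

Lemma rt_at_pair a l t c : gr 0 0 t -> der_piece_dual X 0 c ->
  rt a l (t, c, 0) = wt t a.
Proof.
move=> ht hc.
rewrite (rtE HD a l (cartan_dual ht hc) (@zmod0 K Lam)) ?pd_zero //=.
exact: addr0.
Qed.

(** The representing vector is [x, y] / (x, y) plus evaluation at l: by invariance ([x, y], h) = (x,
    [y, h]), which is a(h) (x, y). On it the root takes the value 2 / (x, y). *)
Lemma represents_noniso a l : roots0 a ->
  exists2 h, represents (rt a l) h & rt a l h != 0.
Proof.
move=> ha; have [x gx x0] := gr_zero_degree H ha.
have [y [gy y0 g0 hw]] := wt_sl2 H ha gx x0.
have nz := form_pair_root H ha gx x0 gy y0.
have [c hc vc] := dual_evaluation l.
set t := (form x y)^-1 *: br x y.
have ht : gr 0 0 t by apply: subspaceZ => //; exact: (gr_sub H 0 0).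
have Ct := cartan_dual ht hc.
exists (t, c, 0).
  split => // h hh; have [th ath e] := cartan_pd HD hh.
  have h1 : gr 0 0 h.1.1 by case: hh.
  rewrite (formE_cartan _ _ hh e) (rtE HD a l hh ath e) vc //; congr (_ + _).
  rewrite (formZl H) (gf_inv (td_form H)) (br_anti H) (wt_act H h1 gy).
  rewrite (linear_forN (wt_linear H h1)) scaleNr opprK (formZr H).
  by rewrite mulrCA mulVf ?mulr1.
rewrite rt_at_pair // -[t]addr0 (wt_lin H) //; last exact: (gr_sub H 0 0).1.
rewrite (wt0 HD) addr0 hw coroot_refl //; last exact: (td_rs H).
by rewrite mulf_neq0 ?invr_eq0 ?pnatr_eq0.
Qed.

(** The representing vector lies in (D^0)^*, on which all roots vanish. *)
Lemma represents_iso l : exists2 h, represents (rt 0 l) h & rt 0 l h = 0.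
Proof.
have [c hc vc] := dual_evaluation l.
have g0 := (gr_sub H 0 0).1.
have Ct := cartan_dual g0 hc.
exists (0, c, 0); last by rewrite rt_at_pair // (wt0 HD).
split => // h hh; have [th ath e] := cartan_pd HD hh.
by rewrite (formE_cartan _ _ hh e) (rt0E HD _ hh ath e) vc // (form0l H) add0r.
Qed.

Lemma t_root_represents r h : represents r h -> represents r (t_root X r).
Proof. by move=> hr; exact: (xgetI 0 hr). Qed.

(** Pair the chosen [t_root] with [h] and use the representing property of both, together with
    symmetry of the form. *)
Lemma form_root_represents r h : represents r h -> form_root X r r = r h.
Proof.
move=> hr; have [Ct et] := t_root_represents hr; have [Ch eh] := hr.
by rewrite /form_root et // -eh // formE_sym et.
Qed.

Lemma form_root_rt a l : roots0 a -> form_root X (rt a l) (rt a l) != 0.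
Proof. by move=> /represents_noniso -/(_ l)[h /form_root_represents -> ]. Qed.

Lemma form_root_rt0 l : form_root X (rt 0 l) (rt 0 l) = 0.
Proof. by have [h /form_root_represents ->] := represents_iso l. Qed.

Lemma h_root_rt a l : roots0 a ->
  cartan X (h_root X (rt a l)) /\ rt a l (h_root X (rt a l)) = 2.
Proof.
move=> ha; have [h hr _] := represents_noniso l ha.
have [Ct et] := t_root_represents hr.
rewrite /h_root; split; first by apply: subspaceZ => //; exact: cartan_subspace HD.
rewrite (dualZ (cartan_subspace HD)) //; last exact: rt_dual HD a l.
by rewrite -et // divfK // form_root_rt.
Qed.

Lemma noniso_rt a l x : roots0 a -> gr a l x -> x != 0 -> noniso (rt a l).
Proof.
move=> ha gx x0; split.
  split; first exact: (rt_dual HD).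
  exists (injL x); first exact: (root_space_injL HD).
  by apply: contraNneq x0 => -[->].
by move=> [_ /eqP]; apply/negP; exact: form_root_rt.
Qed.

Lemma iso_rt l : roots X (rt 0 l) -> iso (rt 0 l).
Proof. by move=> hr; split => //; exact: form_root_rt0. Qed.

Lemma root_class r : roots X r -> exists a l, Delta a /\ r = rt a l.
Proof. by move=> [dr [u hu u0]]; exact: (root_space_class HD hu u0 dr). Qed.

Lemma noniso_class r : noniso r -> exists a l x,
  [/\ roots0 a, gr a l x, x != 0 & r = rt a l].
Proof.
move=> [rr nr]; have [a [l [Da e]]] := root_class rr.
have a0 : a <> 0 by move=> a0; apply: nr; rewrite e a0 in rr *; exact: iso_rt.
have [_ [u hu u0]] := rr; rewrite e in hu.
have [x gx ux] := root_space_noniso HD (conj Da a0) hu.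
exists a, l, x; split => //; apply: contraNneq u0 => x0.
by rewrite ux x0; exact/eqP.
Qed.

Lemma iso_class r : iso r -> exists l, r = rt 0 l.
Proof.
move=> [rr fr]; have [a [l [Da e]]] := root_class rr; exists l; rewrite e.
have [->//|a0] := pselect (a = 0).
by have := form_root_rt l (conj Da a0 : roots0 a); rewrite -e fr eqxx.
Qed.

Lemma core_injL a l x : roots0 a -> gr a l x -> core X (injL x).
Proof.
move=> ha gx; have [->|x0] := eqVneq x 0.
  by move=> A [sA _]; exact: sA.1.1.
apply: sub_gen_smallest; exists (rt a l); first exact: noniso_rt gx x0.
exact: (root_space_injL HD).
Qed.

Lemma core_subalgebra : subalgebra (brE X) (core X).
Proof.
split; first split.
- by move=> A [sA _]; exact: sA.1.1.
- by move=> k u v hu hv A hA; apply: hA.1.1.2; [exact: hu|exact: hv].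
- by move=> u v hu hv A hA; apply: hA.1.2; [exact: hu|exact: hv].
Qed.

Lemma coreE : core X = core0 X.
Proof.
apply/seteqP; split; last first.
  exact: core0_generated HD _ core_subalgebra core_injL.
apply: smallest_sub; first exact: (core0_subalgebra HD).
move=> u [r /noniso_class[a [l [x [ha _ _ ->]]]]] /(root_space_noniso HD ha)[y _ ->].
exact: injL_core0.
Qed.

Lemma core_eala : core X `<=` E.
Proof. by rewrite coreE; exact: (core0_eala HD). Qed.

Lemma noniso_opp r : noniso r -> noniso (- r).
Proof.
move=> /noniso_class[a [l [x [ha gx x0 ->]]]]; rewrite (rtN HD).
have [y [gy y0 _ _]] := wt_sl2 H ha gx x0.
by apply: noniso_rt gy y0; exact: (rootN (td_rs H)).
Qed.

Lemma root_space_sub r : subspace (root_space X r).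
Proof.
have E0 := (eala_subspace HD).1.
split.
  split => // h hh; have [th ath e] := cartan_pd HD hh.
  rewrite (cartan_act HD hh ath e E0) scaler0 /= (br0r H).
  rewrite (linear_for0 (pd_linear H th)) addr0 der_act0r (comm0r HD) //.
  exact: (D_pd HD).
move=> k u v [Eu hu] [Ev hv]; have Euv := (eala_subspace HD).2 k u v Eu Ev.
split => // h hh; have [th ath e] := cartan_pd HD hh.
rewrite scalerDr scalerA mulrC -scalerA -hu // -hv //.
rewrite !(cartan_act HD hh ath e) // !ambient_linE /=; congr (_, _, _).
- rewrite (brDr H) (brZr H) (linear_forD (pd_linear H th)).
  rewrite (linear_forZ (pd_linear H th)) /=.
  by rewrite scalerDr addrACA.
- exact: der_act_lin.
- by apply: (comm_linr HD); exact: (D_pd HD).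
Qed.

End Core.

(** * The involution on the derivations *)

Section Involution.
Context {K : numFieldType} {V : vectType K} {Lam : zmodType} {L : lmodType K}.
Context {Delta : set V} {X : eala_data V Lam L} {G : set Lam}.
Context {tau : @ambient K L -> @ambient K L} {Bc : set (@ambient K L)}.
Hypothesis HD : der_data Delta X G.
Hypothesis tau_chev : chevalley_involution X tau.
Hypothesis basis_Bc : chevalley_basis_core X (zero_ext (core X) tau) Bc.
Hypothesis chi_int : forall m l a x, G m -> nonzero_roots Delta a -> gr X a l x ->
  Bc (injL x) -> zspan Bc (injL (chi X m x)).
Let H := dd_torus HD.
Local Notation br := (br X).
Local Notation gr := (gr X).
Local Notation chi := (chi X).
Local Notation roots0 := (nonzero_roots Delta).
Local Notation sd := (sd X).
Local Notation wt := (wt X).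
Local Notation rt := (rt X).
Local Notation E := (eala X).
Local Notation noniso := (nonisotropic_roots X).
Implicit Types (th ps : Lam -> K^o) (c : (L -> L) -> K^o) (h u v : @ambient K L).
Implicit Types r : @ambient K L -> K^o.

Lemma tau_lin k u v : E u -> E v -> tau (k *: u + v) = k *: tau u + tau v.
Proof. by case: tau_chev => -[_ lin _] _ _; exact: lin. Qed.

Lemma tau_br u v : E u -> E v -> tau (brE X u v) = brE X (tau u) (tau v).
Proof. by case: tau_chev => -[_ _ hb] _ _; exact: hb. Qed.

Lemma tau_E u : E u -> E (tau u).
Proof. by case: tau_chev => -[[hf _ _] _ _] _ _; exact: hf. Qed.

Let E0 := (eala_subspace HD).1.

Lemma tau0 : tau 0 = 0.
Proof. by have := tau_lin (-1) E0 E0; rewrite scaler0 addr0 scaleN1r addNr. Qed.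

Lemma tauZ k u : E u -> tau (k *: u) = k *: tau u.
Proof. by move=> Eu; rewrite -[k *: u]addr0 tau_lin // tau0 addr0. Qed.

Lemma tauD u v : E u -> E v -> tau (u + v) = tau u + tau v.
Proof. by move=> Eu Ev; rewrite -[u]scale1r tau_lin // !scale1r. Qed.

Lemma tauN u : E u -> tau (- u) = - tau u.
Proof. by move=> Eu; rewrite -scaleN1r tauZ // scaleN1r. Qed.

Lemma tau_root r u : roots X r -> root_space X r u -> root_space X (- r) (tau u).
Proof. by case: tau_chev => _ _ h /h <- hu; exists u. Qed.

Lemma injL_E x : E (injL x).
Proof. exact/(core0_eala HD)/injL_core0. Qed.

Lemma Bc_core u : Bc u -> core X u.
Proof. by case: basis_Bc => -[h _ _ _ _] _; exact: h. Qed.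

Lemma Bc_lin_indep : lin_indep Bc. Proof. by case: basis_Bc => _ []. Qed.
Lemma Bc_span : lspan Bc = core X. Proof. by case: basis_Bc => _ []. Qed.

(* The L-component of the element of the Chevalley system in the root space of
   rt a l. *)
Definition cv (a : V) (l : Lam) : L := (xget 0 (Bc `&` root_space X (rt a l))).1.1.

(** Transfers the Chevalley system to L, which contains the nonisotropic root vectors. *)
Lemma cvP a l : roots0 a -> noniso (rt a l) ->
  [/\ gr a l (cv a l), cv a l != 0,
      Bc `&` root_space X (rt a l) = [set injL (cv a l)],
      tau (injL (cv a l)) = - injL (cv (- a) (- l)) &
      wt (br (cv a l) (cv (- a) (- l))) a = 2].
Proof.
have [[_ _ _ [x hx hB] _] _] := basis_Bc.
have aux b m : roots0 b -> noniso (rt b m) ->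
    gr b m (cv b m) /\ x (rt b m) = injL (cv b m).
  move=> hb hr; have := hB _ hr => e; have [rx _ _] := hx _ hr.
  have exg : xget 0 (Bc `&` root_space X (rt b m)) = x (rt b m).
    by rewrite e; apply: xget_unique.
  have [y gy ey] := root_space_noniso HD hb rx.
  by rewrite /cv exg ey.
move=> ha hr; have hr' := noniso_opp HD hr.
have [gx ex] := aux _ _ ha hr; have [rx bx tx] := hx _ hr.
rewrite (rtN HD) in hr' bx tx.
have [gy ey] := aux _ _ (rootN (td_rs H) ha) hr'.
have Bx : Bc (x (rt a l)).
  by have : [set x (rt a l)] (x (rt a l)) by []; rewrite -hB // => -[].
split => //.
- have := lin_indep_neq0 Bc_lin_indep Bx.
  by rewrite ex; apply: contraNneq => ->; exact/eqP.
- by rewrite hB // ex.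
- by rewrite -ex -ey -tx zero_extE //; exact: Bc_core.
(* The root takes the value 2 on [h_root], and only the L-component of the bracket contributes to
   it. *)
- have [Ch] := h_root_rt HD l ha; rewrite -bx ex ey.
  rewrite (brE_core0 HD (injL_core0 _) (injL_core0 _)) /= => <-.
  rewrite (rt_at_pair HD) //; first by have := sl2_degree H gx gy.
  by move: Ch; rewrite -bx ex ey (brE_core0 HD (injL_core0 _) (injL_core0 _)) => -[].
Qed.

Lemma noniso_shift a l m : roots0 a -> noniso (rt a l) -> G m -> noniso (rt a (l + m)).
Proof.
move=> ha hr Gm; have [gx x0 _ _ _] := cvP ha hr; have hm := G_Gam HD Gm.
exact: (noniso_rt HD ha (chi_gr H hm gx) (chi_neq0 H hm x0)).
Qed.

Lemma Bc_cv a l : roots0 a -> noniso (rt a l) -> Bc (injL (cv a l)).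
Proof.
move=> ha hr; have [_ _ e _ _] := cvP ha hr.
by have : [set injL (cv a l)] (injL (cv a l)) by []; rewrite -e => -[].
Qed.

(** The image is a scalar multiple of a basis vector since the root space is a line, and that scalar
    is an integer by [lin_indep_zspan]. *)
Lemma chi_cv a l m : roots0 a -> noniso (rt a l) -> G m ->
  exists n : int, chi m (cv a l) = n%:~R *: cv a (l + m).
Proof.
move=> ha hr Gm; have hr' := noniso_shift ha hr Gm; have hm := G_Gam HD Gm.
have [gx x0 _ _ _] := cvP ha hr; have [gy y0 _ _ _] := cvP ha hr'.
have [k e] := gr_prop H ha gy y0 (chi_gr H hm gx).
have := chi_int Gm ha gx (Bc_cv ha hr); rewrite e injLZ.
move=> /(lin_indep_zspan Bc_lin_indep (Bc_cv ha hr'))[n en].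
by exists n; rewrite -en.
Qed.

Lemma noniso_gr a l x : roots0 a -> gr a l x -> x != 0 -> noniso (rt a l).
Proof. exact: (noniso_rt HD). Qed.

Lemma gr_cv a l x : roots0 a -> gr a l x -> x != 0 -> exists k, x = k *: cv a l.
Proof.
move=> ha gx x0; have [gy y0 _ _ _] := cvP ha (noniso_gr ha gx x0).
exact: (gr_prop H ha gy y0 gx).
Qed.

(* Writing chi^m x_r = n x_(r + m) and chi^-m x_-r = n' x_-(r + m), comparison of
   [x_r, x_-r] with [x_(r + m), x_-(r + m)] gives n n' = 1, so n = n'. *)
Lemma tau_chi a l x m : roots0 a -> gr a l x -> G m -> exists2 y, gr (- a) (- l) y &
  [/\ tau (injL x) = injL y, tau (injL (chi m x)) = injL (chi (- m) y) & 
      x != 0 -> y != 0].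
Proof.
move=> ha gx Gm; have hm := G_Gam HD Gm; have hm' := GamN H hm.
have [->|x0] := eqVneq x 0.
  exists 0; first exact: (gr_sub H _ _).1.
  by rewrite !(chi_zero H) // (_ : injL 0 = 0) // tau0; split => //; rewrite eqxx.
have hr := noniso_gr ha gx x0; have [k ek] := gr_cv ha gx x0.
have k0 : k != 0 by apply: contraNneq x0 => k0; rewrite ek k0 scale0r.
have ha' := rootN (td_rs H) ha.
have hr' : noniso (rt (- a) (- l)) by rewrite -(rtN HD); exact: (noniso_opp HD).
have hrm := noniso_shift ha hr Gm; have [n en] := chi_cv ha hr Gm.
have [n' en'] := chi_cv ha' hr' (GN HD Gm).
have [gx0 x00 _ tx wx] := cvP ha hr; have [gy0 y00 _ _ _] := cvP ha' hr'.
have [gx1 x10 _ txm wxm] := cvP ha hrm.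
rewrite -opprD in en'.
have nn' : (n%:~R * n'%:~R : K) = 1.
  have : br (chi m (cv a l)) (chi (- m) (cv (- a) (- l))) = br (cv a l) (cv (- a) (- l)).
    by rewrite -(chi_brl H) // -(chi_brr H) // (chiNK H).
  rewrite en en' (brZl H) (brZr H) scalerA => e.
  have g0 : gr 0 0 (br (cv a (l + m)) (cv (- a) (- (l + m)))).
    have hrm' : noniso (rt (- a) (- (l + m))).
      by rewrite -(rtN HD); exact: (noniso_opp HD).
    by have [gy1 _ _ _ _] := cvP ha' hrm'; exact: (sl2_degree H gx1 gy1).
  move: wx; rewrite -e -[_ *: _]addr0 (wt_lin H) //; last exact: (gr_sub H 0 0).1.
  rewrite (wt0 HD) addr0 wxm -[RHS]mul1r => /mulIf; apply.
  by rewrite pnatr_eq0.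
have nE : n = n'.
  move/eqP: nn'; rewrite -intrM -[1]/(1%:~R) eqr_int => /eqP e.
  have /intUnitRing.unitzPl : n' * n = 1 by rewrite mulrC.
  rewrite qualifE /= => /orP[]/eqP en1; move: e; rewrite en1; first by rewrite mul1r.
  by rewrite mulN1r => /(congr1 -%R); rewrite opprK.
exists (- k *: cv (- a) (- l)).
  by apply: subspaceZ => //; exact: (gr_sub H).
split.
- rewrite ek !injLZ tauZ ?tx; last exact: injL_E.
  by rewrite scalerN scaleNr.
- rewrite ek !(chiZ H) // !injLZ tauZ; last exact: injL_E.
  rewrite en en' !injLZ tauZ; last exact: injL_E.
  by rewrite txm nE !scalerN scaleNr.
- by move=> _; rewrite scaler_eq0 oppr_eq0 negb_or k0.
Qed.

(** The Chevalley system gives x_r -> -x_-r -> x_r on nonisotropic root spaces, and these generate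
    the core. *)
Lemma tau2_core u : core X u -> core X (tau u) /\ tau (tau u) = u.
Proof.
have sc := core_subalgebra (X := X).
(* Both memberships are included because [tau] is linear and multiplicative only on E. *)
suff : core X `<=` [set u | core X u /\ (core X (tau u) /\ tau (tau u) = u)].
  by move=> h /h[].
have cE := core_eala HD.
apply: smallest_sub.
  split; first split.
  - by rewrite /= !tau0; split; [exact: sc.1.1|split => //; exact: sc.1.1].
  - move=> k v w [hv [htv ev]] [hw [htw ew]]; split; first exact: (sc.1.2 k v w).
    rewrite (tau_lin k (cE _ hv) (cE _ hw)) (tau_lin k (cE _ htv) (cE _ htw)) ev ew.
    by split => //; exact: (sc.1.2 k _ _ htv htw).
  - move=> v w [hv [htv ev]] [hw [htw ew]]; split; first exact: (sc.2 v w).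
    rewrite (tau_br (cE _ hv) (cE _ hw)) (tau_br (cE _ htv) (cE _ htw)) ev ew.
    by split => //; exact: (sc.2 _ _ htv htw).
move=> v [r hr]; have [a [l [x [ha gx x0 er]]]] := noniso_class HD hr.
rewrite er => /(root_space_noniso HD ha)[y gy ->].
have [-> |y0] := eqVneq y 0.
  by rewrite (_ : injL 0 = 0) // /= !tau0; split; [|split => //]; exact: sc.1.1.
have hra := noniso_gr ha gy y0; have [k ->] := gr_cv ha gy y0.
have hra' : noniso (rt (- a) (- l)) by rewrite -(rtN HD); exact: (noniso_opp HD).
have ha' := rootN (td_rs H) ha.
have [gx1 _ _ tx _] := cvP ha hra; have [gy1 _ _ ty _] := cvP ha' hra'.
have e : tau (injL (k *: cv a l)) = injL (- k *: cv (- a) (- l)).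
  by rewrite !injLZ tauZ ?tx; [rewrite scalerN scaleNr|exact: injL_E].
split; first by apply: (core_injL HD ha (l := l)); apply: (subspaceZ _ (gr_sub H a l)).
rewrite e; split.
  by apply: (core_injL HD ha' (l := - l)); apply: (subspaceZ _ (gr_sub H _ _)).
rewrite !injLZ tauZ ?ty; last exact: injL_E.
by rewrite !opprK scalerN scaleNr opprK.
Qed.

Lemma ambient_split c d : ((0, c, d) : @ambient K L) = (0, c, 0) + (0, 0, d).
Proof.
by rewrite -[(0, c, 0)]scale1r ambient_linE /= !scaler0 !scale1r !addr0 !add0r.
Qed.

Lemma ambient_c0 c : gr_dual X c -> core X (0, c, 0).
Proof. by move=> hc; rewrite (coreE HD). Qed.

(** The image is tested against root vectors, where [tau_chi] gives the action; this fixes its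
    components in L and D but leaves the one in the graded dual undetermined. *)
Lemma tau_sd m th : G m -> zmod_morphism th -> th m = 0 ->
  exists2 c, gr_dual X c & tau (0, 0, sd m th) = (0, c, - sd (- m) th).
Proof.
move=> Gm ath tm; have hm := G_Gam HD Gm; have hm' := GamN H hm.
have z0 := @zmod0 K Lam.
(* The zero case is separate because [tau_root] requires [rt 0 m] to be a root. *)
have [d0|d0] := eqVneq (sd m th) 0.
  exists 0; first exact: (gr_dual_subspace (X := X)).1.
  have -> : th = 0 by apply: (sd_inj H hm ath z0); rewrite d0 (sd_zero H).
  by rewrite !(sd_zero H) // oppr0; exact: tau0.
set v := (0, 0, sd m th) : @ambient K L; set w := tau v.
have Ev : E v by exact: (eala_sd HD Gm ath tm).
have hv : root_space X (rt 0 m) v by exact: (root_space_sd HD Gm ath tm).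
have hr : roots X (rt 0 m).
  split; first exact: (rt_dual HD).
  by exists v => //; apply: contraNneq d0 => -[->].
have := tau_root hr hv; rewrite (rtN HD) oppr0 -/w => hw.
have D0 := Delta0 HD; have gw := root_space_L HD D0 hw.
have Ew : E w by exact: tau_E.
have [ps [aps ew]] : exists ps, zmod_morphism ps /\ w.2 = sd (- m) ps.
  have [w0|w0] := eqVneq w.2 0; first by exists 0; rewrite w0 (sd_zero H).
  by have [_ /(piece_ex HD)[ps [aps _ e]]] := root_space_D HD D0 hw w0; exists ps.
(* Apply [tau] to [v, x] = th(l) chi^m x and compare L-components. *)
have key a l x : roots0 a -> gr a l x -> exists2 y, gr (- a) (- l) y &
    th l *: chi (- m) y = br w.1.1 y - ps l *: chi (- m) y /\ (x != 0 -> y != 0).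
  move=> ha gx; have [y gy [tx tcx y0]] := tau_chi ha gx Gm; exists y => //; split => //.
  have := tau_br Ev (injL_E x); rewrite tx -/w !(brE_injr HD) //=.
  rewrite (sigma0l HD) (br0l H) add0r (sd_act H th hm gx).
  rewrite -[(_, 0, 0)]/(injL _) injLZ tauZ ?tcx; last exact: injL_E.
  rewrite -injLZ => /(congr1 (fun p => p.1.1)) /= ->; rewrite ew (sd_act H ps hm' gy).
  by rewrite (zmod_morphN aps) scaleNr.
(* For root vectors of degree 0 both th and ps terms vanish, so the L-component of [w] commutes with
   them; chi^m moves it into L_0^0, where [wt_inj] applies. *)
have w0 : w.1.1 = 0.
  rewrite -(chiK H w.1.1 hm) (_ : chi m w.1.1 = 0) ?(chi_zero H) //.
  have g0 : gr 0 0 (chi m w.1.1) by rewrite -(addNr m); exact: (chi_gr H).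
  apply: (wt_inj H g0) => b hb; have hb' := rootN (td_rs H) hb.
  have [x gx x0] := gr_zero_degree H hb'.
  have [y gy [e /(_ x0) y0]] := key _ _ _ hb' gx; rewrite opprK oppr0 in gy.
  apply: (scaler_inj y0); rewrite -(wt_act H g0 gy) scale0r -(chi_brl H) //.
  move: e; rewrite (zmod_morph0 ath) (zmod_morph0 aps) !scale0r subr0 => <-.
  exact: (chi_zero H).
have eps : ps = - th.
  apply/funext; apply: (root_degree_ind H).
  - by rewrite fctE (zmod_morph0 ath) (zmod_morph0 aps) oppr0.
  - by move=> l n; rewrite !fctE ath aps => -> ->; rewrite opprB opprK addrC.
  - move=> l [a [x [ha gx x0]]]; have [y gy [+ /(_ x0) y0]] := key _ _ _ ha gx.
    rewrite w0 (br0l H) sub0r -scaleNr => /(scaler_inj (chi_neq0 H hm' y0)) e.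
    by rewrite fctE e opprK.
exists w.1.2; first by case: Ew.
have -> : w = (w.1.1, w.1.2, w.2) by case: (w) => -[].
by rewrite w0 ew eps (sdN H).
Qed.

(** By [tau_sd] the square of [tau] changes the vector by some [g] in the core. It fixes [g], so
    powers accumulate multiples of [g], against finite order in characteristic 0. *)
Lemma tau2_sd m th : G m -> zmod_morphism th -> th m = 0 ->
  tau (tau (0, 0, sd m th)) = (0, 0, sd m th).
Proof.
move=> Gm ath tm; set v : @ambient K L := (0, 0, sd m th).
have tm' : th (- m) = 0 by rewrite (zmod_morphN ath) tm oppr0.
have [c gc ev] := tau_sd Gm ath tm.
have [c' gc' ev'] := tau_sd (GN HD Gm) ath tm'; rewrite opprK in ev'.
set v' : @ambient K L := (0, 0, sd (- m) th).
have Ev : E v by exact: (eala_sd HD Gm ath tm).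
have Ev' : E v' by exact: (eala_sd HD (GN HD Gm) ath tm').
have cc := ambient_c0 gc; have cc' := ambient_c0 gc'; have cE := core_eala HD.
pose g := tau (0, c, 0) - (0, c', 0).
have cg : core X g.
  exact: (subspaceB (core_subalgebra (X := X)).1 (tau2_core cc).1 cc').
have neg d : ((0, 0, - d) : @ambient K L) = - (0, 0, d).
  by rewrite -[RHS]scaleN1r ambientZ /= !scaler0 scaleN1r.
have e : tau (tau v) = v + g.
  rewrite ev (ambient_split c) neg tauD; [|exact: cE|]; last first.
    exact: (subspaceN (eala_subspace HD) Ev').
  by rewrite tauN // ev' (ambient_split c') neg opprB /g addrCA.
have eg : tau (tau g) = g by case: (tau2_core cg).
have [_ [n [n0 hn]] _] := tau_chev.
have it k : iter k (iter 2 tau) v = v + g *+ k.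
  elim: k => [|k IH]; first by rewrite mulr0n addr0.
  rewrite iterS IH /= mulrSr addrA.
  have Eg : E (g *+ k).
    by rewrite -scaler_nat; exact: (subspaceZ _ (eala_subspace HD) (cE _ cg)).
  have egk : tau (tau (g *+ k)) = g *+ k.
    have Eg0 := cE _ cg.
    by rewrite -scaler_nat (tauZ _ Eg0) (tauZ _ (tau_E Eg0)) eg.
  rewrite (tauD Ev Eg) (tauD (tau_E Ev) (tau_E Eg)) e egk.
  by rewrite addrAC.
have := it n; rewrite -iterM muln2 -addnn iterD !hn // => /esym/eqP.
rewrite -subr_eq0 addrAC subrr add0r -scaler_nat scaler_eq0 pnatr_eq0 eqn0Ngt n0 /=.
by move=> /eqP g0; rewrite e g0 addr0.
Qed.

End Involution.

Arguments cv {K V Lam L} X Bc a l.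

(** * A lift of D compatible with the involution *)

Section Lift.
Context {K : numFieldType} {V : vectType K} {Lam : zmodType} {L : lmodType K}.
Context {Delta : set V} {X : eala_data V Lam L} {G : set Lam}.
Context {tau : @ambient K L -> @ambient K L} {Bc : set (@ambient K L)}.
Hypothesis HD : der_data Delta X G.
Hypothesis tau_chev : chevalley_involution X tau.
Hypothesis basis_Bc : chevalley_basis_core X (zero_ext (core X) tau) Bc.
Hypothesis chi_int : forall m l a x, G m -> nonzero_roots Delta a -> gr X a l x ->
  Bc (injL x) -> zspan Bc (injL (chi X m x)).
Let H := dd_torus HD.
Local Notation gr := (gr X).
Local Notation D := (der X).
Local Notation sd := (sd X).
Local Notation rt := (rt X).
Local Notation E := (eala X).
Implicit Types (th ps : Lam -> K^o) (c : (L -> L) -> K^o) (h u v : @ambient K L).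
Implicit Types r : @ambient K L -> K^o.

Definition annihilator (m : Lam) : set (Lam -> K^o) :=
  [set th | zmod_morphism th /\ th m = 0].

Lemma annihilator_sub m : subspace (annihilator m).
Proof.
split; first by split => //; exact: zmod0.
move=> k th ps [ath tm] [aps pm]; split; first exact: zmod_morph_lin.
by rewrite !fctE tm pm scaler0 addr0.
Qed.

Lemma annihilatorN m th : annihilator m th -> annihilator (- m) th.
Proof. by move=> [ath tm]; split => //; rewrite (zmod_morphN ath) tm oppr0. Qed.

(* tau maps (0, 0, chi^-m d_th) to -(0, lift_dual m th, chi^m d_th), and lift m th
   is the average of (0, 0, chi^m d_th) and (0, lift_dual m th, chi^m d_th): both
   families are subalgebras lifting D, interchanged up to sign by tau. *)
Definition lift_dual m th : (L -> L) -> K^o := - (tau (0, 0, sd (- m) th)).1.2.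
Definition lift m th : @ambient K L := (0, 2^-1 *: lift_dual m th, sd m th).

Lemma tau_lift_dual m th : G m -> annihilator m th ->
  gr_dual X (lift_dual m th) /\
  tau (0, 0, sd (- m) th) = - (0, lift_dual m th, sd m th).
Proof.
move=> Gm /annihilatorN[ath tm].
have [c gc e] := tau_sd HD tau_chev basis_Bc chi_int (GN HD Gm) ath tm.
rewrite opprK in e; rewrite /lift_dual e; split => /=.
  exact: (subspaceN (gr_dual_subspace (X := X)) gc).
by rewrite -[RHS]scaleN1r ambientZ /= scaler0 !scaleN1r opprK.
Qed.

Lemma lift_E m th : G m -> annihilator m th -> E (lift m th).
Proof.
move=> Gm hth; have [gc _] := tau_lift_dual Gm hth; split => /=.
  exact: (subspaceZ _ (gr_dual_subspace (X := X)) gc).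
by case: hth => ath tm; exact: (D_sd HD Gm ath tm).
Qed.

Lemma eala_sd_annihilator m th : G m -> annihilator m th -> E (0, 0, sd m th).
Proof. by move=> Gm [ath tm]; exact: (eala_sd HD Gm ath tm). Qed.

(** In this form [tau] visibly exchanges the two summands up to sign, once tau^2 = 1 on them. *)
Lemma liftE m th : G m -> annihilator m th ->
  lift m th = 2^-1 *: ((0, 0, sd m th) - tau (0, 0, sd (- m) th)).
Proof.
move=> Gm hth; have [_ ->] := tau_lift_dual Gm hth; rewrite opprK.
rewrite -[(0, 0, sd m th)]scale1r ambient_linE ambientZ /=.
rewrite !scale1r !add0r scaler0; congr (_, _, _).
by rewrite -mulr2n -[sd m th *+ 2]scaler_nat scalerA mulVf ?scale1r ?pnatr_eq0.
Qed.

Lemma tau_lift m th : G m -> annihilator m th -> tau (lift m th) = - lift (- m) th.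
Proof.
move=> Gm hth; have Gm' := GN HD Gm; have hth' := annihilatorN hth.
have Ev := eala_sd_annihilator Gm hth; have Ev' := eala_sd_annihilator Gm' hth'.
have Et := tau_E tau_chev Ev'.
rewrite (liftE Gm hth) (liftE Gm' hth') opprK.
rewrite (tauZ HD tau_chev); last exact: (subspaceB (eala_subspace HD) Ev Et).
rewrite (tauD tau_chev Ev (subspaceN (eala_subspace HD) Et)) (tauN HD tau_chev Et).
rewrite (tau2_sd HD tau_chev basis_Bc chi_int Gm' hth'.1 hth'.2).
by rewrite -scalerN opprB.
Qed.

Lemma lift_lin m : G m -> linear_on (annihilator m) (lift m).
Proof.
move=> Gm k th ps hth hps; have hk := (annihilator_sub m).2 k th ps hth hps.
have hm := G_Gam HD Gm; have Gm' := GN HD Gm.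
rewrite /lift /lift_dual (sd_lin H _ _ _ hm) (sd_lin H _ _ _ (G_Gam HD Gm')).
have -> : (0, 0, k *: sd (- m) th + sd (- m) ps) =
    k *: (0, 0, sd (- m) th) + (0, 0, sd (- m) ps) :> @ambient K L.
  by rewrite ambient_linE /= !scaler0 !addr0.
rewrite (tau_lin tau_chev k (eala_sd_annihilator Gm' (annihilatorN hth))
  (eala_sd_annihilator Gm' (annihilatorN hps))).
rewrite !ambient_linE /= scaler0 addr0; congr (_, _, _).
by rewrite opprD scalerDr; congr (_ + _); rewrite -scalerN !scalerA mulrC.
Qed.

(** The correction in the graded dual acts trivially on L. *)
Lemma lift_act m th x : G m -> annihilator m th ->
  brE X (lift m th) (injL x) = injL (sd m th x).
Proof.
move=> Gm hth; rewrite (brE_injr HD _ (lift_E Gm hth)) /=.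
by rewrite (br0l H) add0r (sigma0l HD).
Qed.

Lemma der_actNN d c : D d -> dual D c -> der_act X (- d) (- c) = der_act X d c.
Proof.
move=> Dd hc; apply/funext => d'; have [Dd'|nD] := pselect (D d'); last first.
  by rewrite !der_act_off.
rewrite !der_actE // fctE -[- d]scaleN1r -[-1 *: d]addr0 (comm_linr HD) //.
rewrite (comm0r HD) // addr0 (dualZ (D_sub HD) _ hc); last exact: (D_comm HD).
by rewrite mulN1r opprK.
Qed.

Lemma brE_dual c c' d d' : dual D c -> dual D c' -> D d -> D d' ->
  brE X (0, c, d) (0, c', d') =
  (0, der_act X d c' - der_act X d' c, commutator d d').
Proof.
move=> hc hc' Dd Dd'; rewrite /brE /=.
rewrite (br0l H) (linear_for0 (D_linear HD Dd)) (linear_for0 (D_linear HD Dd')).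
by rewrite subr0 addr0 (sigma0l HD) add0r.
Qed.

Lemma bracket_annihilator m n th ps : annihilator m th -> annihilator n ps ->
  annihilator (m + n) (th n *: ps - ps m *: th).
Proof.
move=> [ath tm] [aps pn]; split.
  rewrite -scaleNr addrC; apply: zmod_morph_lin => //.
  by rewrite -[_ *: _]addr0; apply: zmod_morph_lin => // x y; rewrite /= subr0.
rewrite !fctE (zmod_morphD ath) (zmod_morphD aps) tm pn add0r addr0.
by rewrite /GRing.scale /= mulrC subrr.
Qed.

Lemma lift_dual_br m n th ps : G m -> G n -> annihilator m th -> annihilator n ps ->
  der_act X (sd m th) (lift_dual n ps) - der_act X (sd n ps) (lift_dual m th) =
  lift_dual (m + n) (th n *: ps - ps m *: th).
Proof.
move=> Gm Gn hth hps; have [ath tm] := hth; have [aps pn] := hps.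
have [gc1 e1] := tau_lift_dual Gm hth; have [gc2 e2] := tau_lift_dual Gn hps.
have Gm' := GN HD Gm; have Gn' := GN HD Gn.
have hmn := bracket_annihilator hth hps.
have [gc3 e3] := tau_lift_dual (GD HD Gm Gn) hmn.
have neg c d : - ((0, c, d) : @ambient K L) = (0, - c, - d).
  by rewrite -[LHS]scaleN1r ambientZ /= scaler0 !scaleN1r.
have neg0 d : ((0, 0, - d) : @ambient K L) = - (0, 0, d) by rewrite neg oppr0.
have := tau_br tau_chev (eala_sd_annihilator Gm' (annihilatorN hth))
  (eala_sd_annihilator Gn' (annihilatorN hps)).
have dz := (dual_subspace D).1.
have D1 := D_sd HD Gm ath tm; have D2 := D_sd HD Gn aps pn.
have D1' := D_sd HD Gm' (annihilatorN hth).1 (annihilatorN hth).2.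
have D2' := D_sd HD Gn' (annihilatorN hps).1 (annihilatorN hps).2.
rewrite (brE_dual dz dz D1' D2') !der_act0r subrr.
rewrite (sd_comm H (G_Gam HD Gm') (G_Gam HD Gn') ath aps) -opprD.
rewrite (zmod_morphN ath) (zmod_morphN aps).
(* Negating the degrees negates the bracket, which matches the sign in [tau_lift_dual]. *)
have -> : - th n *: ps - - ps m *: th = - (th n *: ps - ps m *: th).
  by rewrite !scaleNr opprB opprK addrC.
rewrite (sdN H _ (G_Gam HD (GN HD (GD HD Gm Gn)))) neg0.
rewrite (tauN HD tau_chev (eala_sd_annihilator (GN HD (GD HD Gm Gn)) (annihilatorN hmn))).
rewrite e1 e2 e3 opprK !neg.
have DN d : D d -> D (- d) by exact: (subspaceN (D_sub HD)).
have dN c : gr_dual X c -> dual D (- c).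
  by move=> /gr_dual_dual hc; exact: (subspaceN (dual_subspace D)).
rewrite (brE_dual (dN _ gc1) (dN _ gc2) (DN _ D1) (DN _ D2)).
rewrite (der_actNN D1 (gr_dual_dual gc2)) (der_actNN D2 (gr_dual_dual gc1)).
by move=> /(congr1 (fun p => p.1.2)) /= ->.
Qed.

(** The graded dual is an abelian ideal, so the correction enters the bracket linearly and half of a
    cocycle is still a cocycle. *)
Lemma lift_br m n th ps : G m -> G n -> annihilator m th -> annihilator n ps ->
  brE X (lift m th) (lift n ps) = lift (m + n) (th n *: ps - ps m *: th).
Proof.
move=> Gm Gn hth hps; have [ath tm] := hth; have [aps pn] := hps.
have [gc1 _] := tau_lift_dual Gm hth; have [gc2 _] := tau_lift_dual Gn hps.
have D1 := D_sd HD Gm ath tm; have D2 := D_sd HD Gn aps pn.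
have dz c : gr_dual X c -> dual D (2^-1 *: c).
  by move=> /gr_dual_dual; exact: (subspaceZ _ (dual_subspace D)).
rewrite /lift (brE_dual (dz _ gc1) (dz _ gc2) D1 D2); congr (_, _, _).
  rewrite -(lift_dual_br Gm Gn hth hps) scalerBr.
  by congr (_ - _); rewrite -[_ *: lift_dual _ _]addr0 der_act_lin der_act0r addr0.
exact: (sd_comm H (G_Gam HD Gm) (G_Gam HD Gn) ath aps).
Qed.

Lemma lift_root m th : G m -> annihilator m th -> root_space X (rt 0 m) (lift m th).
Proof.
move=> Gm hth; have [ath tm] := hth; rewrite (liftE Gm hth).
have sr := root_space_sub HD (rt 0 m).
have [ath' tm'] := annihilatorN hth.
apply: (subspaceZ _ sr); apply: (subspaceB sr); first exact: (root_space_sd HD Gm ath tm).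
have [d0|d0] := eqVneq (sd (- m) th) 0.
  by rewrite d0 (tau0 HD tau_chev); exact: sr.1.
have hv := root_space_sd HD (GN HD Gm) ath' tm'.
have hr : roots X (rt 0 (- m)).
  split; first exact: (rt_dual HD).
  by exists (0, 0, sd (- m) th); [exact: hv|apply: contraNneq d0 => -[->]].
by have := tau_root tau_chev hr hv; rewrite (rtN HD) oppr0 opprK.
Qed.

End Lift.
Arguments lift {K V Lam L} X tau m th.
Arguments lift_dual {K V Lam L} X tau m th _.

(** * The extended basis *)

Section Extension.
Context {K : numFieldType} {V : vectType K} {Lam : zmodType} {L : lmodType K}.
Context {Delta : set V} {X : eala_data V Lam L} {G : set Lam}.
Context {tau : @ambient K L -> @ambient K L} {Bc : set (@ambient K L)}.
Hypothesis HD : der_data Delta X G.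
Hypothesis tau_chev : chevalley_involution X tau.
Hypothesis basis_Bc : chevalley_basis_core X (zero_ext (core X) tau) Bc.
Hypothesis chi_int : forall m l a x, G m -> nonzero_roots Delta a -> gr X a l x ->
  Bc (injL x) -> zspan Bc (injL (chi X m x)).
Context {n : nat} {b : Lam -> 'I_n -> Lam} {t : Lam -> 'I_n -> Lam -> int}.
Hypothesis hbt : forall m, [/\ adapted m (b m) (t m), b (- m) = b m & t (- m) = t m].
Let H := dd_torus HD.
Local Notation br := (br X).
Local Notation gr := (gr X).
Local Notation roots0 := (nonzero_roots Delta).
Local Notation D := (der X).
Local Notation rt := (rt X).
Local Notation E := (eala X).
Local Notation noniso := (nonisotropic_roots X).
Local Notation iso := (isotropic_roots X).
Local Notation lift := (lift X tau).
Implicit Types (th ps : Lam -> K^o) (c : (L -> L) -> K^o) (h u v : @ambient K L).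
Implicit Types r : @ambient K L -> K^o.

Definition coord m i : Lam -> K^o := fun l => (t m i l)%:~R.

Lemma coord_annihilator m i : t m i m = 0 -> annihilator m (coord m i).
Proof.
move=> e; split; last by rewrite /coord e.
by have [ad _ _] := hbt m; move=> x y; rewrite /coord (ad_morph ad) intrB.
Qed.

Lemma coord_b m i j : coord m i (b m j) = (i == j)%:R.
Proof.
by have [ad _ _] := hbt m; rewrite /coord (ad_dual ad); case: (i == j).
Qed.

Definition lift_basis : set (@ambient K L) :=
  [set u | exists m i, [/\ G m, t m i m = 0 & u = lift m (coord m i)]].


Lemma coord_expand m th : annihilator m th ->
  th = \sum_(i <- [seq i <- index_enum 'I_n | t m i m == 0])
    (th (b m i) : K) *: coord m i.
Proof.
move=> [ath tm]; have [ad _ _] := hbt m.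
by rewrite big_filter; exact: (adapted_expand ad ath tm).
Qed.

Lemma coord_neq0 m i : coord m i != 0.
Proof.
apply/eqP => /(congr1 (@^~ (b m i))); rewrite /= coord_b eqxx => /eqP.
by rewrite (oner_eq0 K).
Qed.

Lemma lift_basis_neq0 u : lift_basis u -> u.2 != 0.
Proof.
move=> [m [i [Gm e ->]]] /=; have [ath tm] := coord_annihilator e.
have hm := G_Gam HD Gm; apply: contra_neq (coord_neq0 m i) => s0.
apply: (sd_inj H hm ath) => [x y|]; first by rewrite /= subr0.
by rewrite s0 (sd_zero H).
Qed.

Lemma lift_basis_root u : lift_basis u -> exists2 m, G m & root_space X (rt 0 m) u.
Proof.
move=> [m [i [Gm e ->]]]; exists m => //.
exact: (lift_root HD tau_chev basis_Bc chi_int Gm (coord_annihilator e)).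
Qed.

Lemma lift_basis_E : lift_basis `<=` E.
Proof. by move=> u /lift_basis_root[m _ []]. Qed.

Lemma lift_basis_core u : lift_basis u -> ~ core X u.
Proof. by move=> /lift_basis_neq0 /eqP u0; rewrite (coreE HD) => -[_]. Qed.

Lemma lift_basis_noniso r u : noniso r -> lift_basis u -> ~ root_space X r u.
Proof.
move=> /(noniso_class HD)[a [l [x [ha _ _ ->]]]] hu /(root_space_noniso HD ha)[y _ uy].
by have := lift_basis_neq0 hu; rewrite uy eqxx.
Qed.

(** The coordinates of [th] are its values at the adapted basis vectors, hence integers. *)
Lemma lift_zspan m (th : Lam -> int) : G m -> annihilator m (fun l => (th l)%:~R : K^o) ->
  zspan lift_basis (lift m (fun l => (th l)%:~R : K^o)).
Proof.
move=> Gm hth; rewrite (coord_expand hth).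
rewrite (linear_on_sum _ (annihilator_sub m) (lift_lin HD tau_chev Gm)).
  rewrite big_filter; apply: zspan_sum => i /eqP ti.
  by rewrite scaler_int; apply/zspanMz/zspan_incl; exists m, i.
by move=> i; rewrite mem_filter => /andP[/eqP ti _]; exact: coord_annihilator.
Qed.

(** The functional of the bracket is integer-valued because all coordinates are, so [lift_zspan]
    applies in degree m + p. *)
Lemma lift_basis_br u v : lift_basis u -> lift_basis v -> zspan lift_basis (brE X u v).
Proof.
move=> [m [i [Gm ti ->]]] [p [j [Gp tj ->]]].
have ha := coord_annihilator ti; have hb := coord_annihilator tj.
rewrite (lift_br HD tau_chev basis_Bc chi_int Gm Gp ha hb).
have := bracket_annihilator ha hb.
have -> : coord m i p *: coord p j - coord p j m *: coord m i =
    fun l => (t m i p * t p j l - t p j m * t m i l)%:~R : K^o.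
  by apply/funext => l; rewrite !fctE intrB !intrM.
by apply: lift_zspan; exact: (GD HD).
Qed.

Lemma Bc_noniso u r : Bc u -> root_space X r u -> noniso r ->
  exists a l, [/\ roots0 a, gr a l u.1.1, r = rt a l & u = injL u.1.1].
Proof.
move=> Bu hu /(noniso_class HD)[a [l [x [ha _ _ e]]]]; exists a, l.
by rewrite e in hu; have [y gy ->] := root_space_noniso HD ha hu.
Qed.

Lemma lift_basis_br_noniso m i a l x : G m -> t m i m = 0 -> roots0 a ->
  gr a l x ->
  brE X (lift m (coord m i)) (injL x) = injL (chi X m x) *~ t m i l.
Proof.
move=> Gm ti ha gx.
rewrite (lift_act HD tau_chev basis_Bc chi_int _ Gm (coord_annihilator ti)).
by rewrite (sd_act H _ (G_Gam HD Gm) gx) /coord injLZ scaler_int.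
Qed.

Lemma Bc_shift m a l x : G m -> roots0 a -> gr a l x -> Bc (injL x) ->
  exists (k : int) y, [/\ gr a (l + m) y, Bc (injL y) &
    injL (chi X m x) = injL y *~ k].
Proof.
move=> Gm ha gx Bx.
have x0 : x != 0.
  by apply: contraNneq (lin_indep_neq0 (Bc_lin_indep basis_Bc) Bx) => ->; exact/eqP.
have hr := noniso_gr HD ha gx x0.
have [_ _ e _ _] := cvP HD basis_Bc ha hr.
have ex : x = cv X Bc a l.
  have : (Bc `&` root_space X (rt a l)) (injL x).
    by split => //; exact: (root_space_injL HD).
  by rewrite e => /injL_inj.
have [k ek] := chi_cv HD basis_Bc chi_int ha hr Gm.
have hr' := noniso_shift HD basis_Bc ha hr Gm.
have [gy _ _ _ _] := cvP HD basis_Bc ha hr'.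
exists k, (cv X Bc a (l + m)); split => //; first exact: (Bc_cv HD basis_Bc ha hr').
by rewrite ex ek injLZ scaler_int.
Qed.

Lemma brE_injL_Mz x y (k : int) :
  brE X (injL x *~ k) (injL y) = brE X (injL x) (injL y) *~ k /\
  brE X (injL y) (injL x *~ k) = brE X (injL y) (injL x) *~ k.
Proof.
have scal (w : @ambient K L) : w *~ k = k%:~R *: w by rewrite scaler_int.
rewrite !scal -injLZ !(brE_core0 HD (injL_core0 _) (injL_core0 _)) /=.
rewrite (brZl H) (brZr H) (linear_forZ (sigma_linl HD y)) (linear_forZ (sigma_linr HD y)).
by rewrite !ambientZ /= !scaler0.
Qed.

Lemma brE_injLZ x y (k : K) :
  brE X (k *: injL x) (injL y) = k *: brE X (injL x) (injL y) /\
  brE X (injL y) (k *: injL x) = k *: brE X (injL y) (injL x).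
Proof.
rewrite -injLZ !(brE_core0 HD (injL_core0 _) (injL_core0 _)) /=.
rewrite (brZl H) (brZr H) (linear_forZ (sigma_linl HD y)) (linear_forZ (sigma_linr HD y)).
by rewrite !ambientZ /= !scaler0.
Qed.

Lemma brE_core_linear u : E u -> linear_on (core X) (brE X u).
Proof.
move=> Eu k v w; rewrite (coreE HD) => hv hw.
have hk := (core0_subspace (X := X)).2 k v w hv hw.
have [gu Du] := Eu.
have f z : core0 X z -> brE X u z = (br u.1.1 z.1.1 + u.2 z.1.1,
    sigma X u.1.1 z.1.1 + der_act X u.2 z.1.2, 0).
  move=> [gz z2]; rewrite /brE z2; congr (_, _, _).
  - by rewrite /= subr0.
  - by rewrite (der_act0l HD) ?subr0 //; exact: (gr_dual_dual gu).
  - exact: (comm0r HD).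
rewrite !f // !ambient_linE /= (brDr H) (brZr H) (linear_forD (D_linear HD Du)).
rewrite (linear_forZ (D_linear HD Du)) (linear_forD (sigma_linr HD _)).
rewrite (linear_forZ (sigma_linr HD _)) der_act_lin /= !scalerDr scaler0 addr0.
by congr (_, _, _); rewrite addrACA.
Qed.

Lemma root_space_br a l a' l' x y : gr a l x -> gr a' l' y ->
  root_space X (rt (a + a') (l + l')) (brE X (injL x) (injL y)).
Proof.
move=> gx gy; have hx := root_space_injL HD gx; have hy := root_space_injL HD gy.
split; first exact/(core0_eala HD)/(core0_subalgebra HD).2/injL_core0/injL_core0.
move=> h hh; rewrite (brE_jacobi HD _ _ (cartan_eala HD hh)).
rewrite (hx.2 h hh) (hy.2 h hh).
apply: (etrans (congr2 +%R (brE_injLZ x y (rt a l h)).1 (brE_injLZ y x (rt a' l' h)).2)).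
by rewrite -scalerDl -(rtD HD).
Qed.

(** The bracket has isotropic degree, where [isc_iso] places such brackets in the integral span. *)
Lemma Bc_bracket a l l' x y : roots0 a -> gr a l x -> gr (- a) l' y ->
  Bc (injL x) -> Bc (injL y) -> zspan Bc (brE X (injL x) (injL y)).
Proof.
move=> ha gx gy Bx By; have [[_ _ _ _ hiso] _] := basis_Bc.
have [->|nz] := eqVneq (brE X (injL x) (injL y)) 0; first exact: zspan0.
have := root_space_br gx gy; rewrite subrr => hs.
have hr : roots X (rt 0 (l + l')).
  by split; [exact: (rt_dual HD)|exists (brE X (injL x) (injL y))].
(* In [isc_iso] take s = [rt 0 (l + l')] and the root [rt a (- l')]: their sum is [rt a l], and the
   opposite root is [rt (- a) l']. *)
have := hiso _ (iso_rt HD hr) => e.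
have : zspan (Bc `&` root_space X (rt 0 (l + l'))) (brE X (injL x) (injL y)).
  rewrite e; apply: zspan_incl; exists (rt a (- l')).
    have y0 : y != 0.
      by apply: contraNneq nz => ->; rewrite (brE_core0 HD (injL_core0 _) (injL_core0 _))
         /= (br0r H) (sigma0r HD).
    rewrite -[a]opprK -(rtN HD); apply: (noniso_opp HD).
    exact: (noniso_rt HD (rootN (td_rs H) ha) gy y0).
  rewrite (rtD HD) addr0 addrCA [- l' + l']addrC subrr addr0 (rtN HD) opprK.
  exists (injL x); first by split => //; exact: (root_space_injL HD).
  by exists (injL y) => //; split => //; exact: (root_space_injL HD).
by apply: zspan_sub => w [Bw _]; exact: zspan_incl.
Qed.

(* For isotropic r, the degree r part of Bc lies in the Z-span of brackets of
   elements of Bc of non-isotropic degree, to which the Jacobi identity applies. *)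
Lemma lift_basis_br_iso r u w : iso r -> Bc w -> root_space X r w -> lift_basis u ->
  zspan Bc (brE X u w).
Proof.
move=> hr Bw hw [m [i [Gm ti ->]]]; have hth := coord_annihilator ti.
have [l er] := iso_class HD hr.
have [[_ _ _ _ hiso] _] := basis_Bc.
have Eu := lift_E HD tau_chev basis_Bc chi_int Gm hth.
have lin := brE_core_linear Eu; have sc := (core_subalgebra (X := X)).1.
have zB : zspan (Bc `&` root_space X r) w by apply: zspan_incl.
move: zB; rewrite (hiso r hr) => zB.
(* Core membership accompanies the induction because linearity of the bracket in [w] is available on
   the core. *)
suff [] : core X w /\ zspan Bc (brE X (lift m (coord m i)) w) by [].
move: w zB {Bw hw}; apply: zspan_ind.
- split; first exact: sc.1.
  have := lin (-1) 0 0 sc.1 sc.1; rewrite scaler0 addr0 scaleN1r addNr => ->.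
  exact: zspan0.
- move=> v w [hv zv] [hw zw]; split; first exact: (subspaceB sc hv hw).
  by rewrite addrC -scaleN1r lin // scaleN1r addrC; exact: zspanB.
- move=> w [a0 /(noniso_class HD)[a [p [x0 [ha gx0 x00 ->]]]]] [y [By hy] [z [Bz hz] <-]].
  rewrite er (rtD HD) addr0 in hy; rewrite (rtN HD) in hz.
  have [x gx ey] := root_space_noniso HD ha hy.
  have ha' := rootN (td_rs H) ha.
  have [x' gx' ez] := root_space_noniso HD ha' hz.
  rewrite ey in By *; rewrite ez in Bz *.
  split.
    apply: (core_subalgebra (X := X)).2; first exact: (core_injL HD ha gx).
    exact: (core_injL HD ha' gx').
  rewrite (brE_jacobi HD _ _ Eu).
  rewrite (lift_basis_br_noniso Gm ti ha gx) (lift_basis_br_noniso Gm ti ha' gx').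
  have [k1 [y1 [gy1 By1 e1]]] := Bc_shift Gm ha gx By.
  have [k2 [y2 [gy2 By2 e2]]] := Bc_shift Gm ha' gx' Bz.
  rewrite e1 e2 -!mulrzA (brE_injL_Mz _ _ _).1 (brE_injL_Mz _ _ _).2.
  apply: zspanD; apply: zspanMz.
    exact: (Bc_bracket ha gy1 gx' By1 Bz).
  exact: (Bc_bracket ha gx gy2 By By2).
Qed.

Let B := Bc `|` lift_basis.

Lemma extension_sub : B `<=` E.
Proof.
move=> u [/(Bc_core basis_Bc)|]; first exact: (core_eala HD).
exact: lift_basis_E.
Qed.

Lemma extension_core : B `&` core X = Bc.
Proof.
apply/seteqP; split => [u [[//|hu] hc]|u Bu]; first by case: (lift_basis_core hu).
by split; [left|exact: (Bc_core basis_Bc)].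
Qed.

Lemma extension_noniso r : noniso r -> B `&` root_space X r = Bc `&` root_space X r.
Proof.
move=> hr; apply/seteqP; split => u [hu hs]; split => //; last by left.
by case: hu => // /(lift_basis_noniso hr).
Qed.

(** A lift differs from (0, 0, chi^m d_th) by an element of the graded dual, which is in the core
    and so in the span of [Bc]. *)
Lemma extension_span : lspan B = E.
Proof.
apply/seteqP; split; first exact: (lspan_min (eala_subspace HD) extension_sub).
have sB := lspan_subspace B.
have cB : core X `<=` lspan B.
  by rewrite -(Bc_span basis_Bc); apply: lspan_sub; exact: subsetUl.
have dB d : D d -> lspan B (0, 0, d).
  have lin : subspace [set d : L -> L | lspan B (0, 0, d)].
    split; first exact: sB.1.
    move=> k d1 d2 h1 h2 /=; have := sB.2 k _ _ h1 h2.
    by rewrite ambient_linE /= !scaler0 !addr0.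
  move: d; apply: (D_ind HD); [exact: lin.1|exact: lin.2|].
  move=> m th Gm ath tm; have hm := G_Gam HD Gm.
  rewrite (coord_expand (conj ath tm)) (sd_sum H _ _ _ hm).
  apply: (subspace_sum lin) => i; rewrite mem_filter => /andP[/eqP ti _].
  rewrite (sdZ H _ _ hm); apply: (subspaceZ _ lin) => /=.
  have [gc _] := tau_lift_dual HD tau_chev basis_Bc chi_int Gm (coord_annihilator ti).
  have Nl : lspan B (lift m (coord m i)) by apply: lspan_incl; right; exists m, i.
  have cl : lspan B (0, - (2^-1 *: lift_dual X tau m (coord m i)), 0).
    have sg := gr_dual_subspace (X := X).
    exact: (cB _ (ambient_c0 HD (subspaceN sg (subspaceZ 2^-1 sg gc)))).
  have := sB.2 1 _ _ Nl cl.
  by rewrite ambient_linE /= !scale1r subrr !addr0.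
move=> [[x c] d] [/= hc hd].
have hx : lspan B (x, c, 0) by apply: cB; rewrite (coreE HD).
have := sB.2 1 _ _ hx (dB _ hd).
by rewrite ambient_linE /= !scale1r !addr0 !add0r.
Qed.

(** The separating functional is evaluation at [b m i] on the degree-m part of the D-component: it
    kills the core and the other degrees, and is a Kronecker delta on the lifts of degree m. *)
Lemma extension_lin_indep : lin_indep B.
Proof.
apply: (lin_indep_setU (Bc_lin_indep basis_Bc) (eala_subspace HD) extension_sub).
move=> _ [m [i [Gm ti ->]]]; have [ath tm] := coord_annihilator ti.
have [//|//|c [[hc zc] _ vc]] := dual_generated HD (A := setT) _ _ (b m i) Gm.
exists (fun u => c u.2); split.
- move=> k u v [_ Du] [_ Dv]; rewrite ambient_linE /=; exact: (hc.1 k _ _ Du Dv).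
- by rewrite /= vc // coord_b eqxx oner_eq0.
- move=> v [Bv|[p [j [Gp tj ->]]]] nv.
    have := Bc_core basis_Bc Bv; rewrite (coreE HD) => -[_ ->].
    exact: (dual0 (D_sub HD) hc).
  have [aps pp] := coord_annihilator tj; rewrite /=.
  have [epm|npm] := eqVneq p m; last first.
    by apply: (zc p) => //; [exact: (G_Gam HD Gp)|exact: (piece_sd HD Gp aps pp)].
  rewrite epm in tj aps pp nv *; rewrite vc // coord_b; case: eqP => // eji.
  by rewrite eji eqxx in nv.
Qed.

Lemma extension_tau : tau @` B = -%R @` B.
Proof.
have [[_ _ tB _ _] _] := basis_Bc.
(* The shared basis for m and -m makes [tau] permute the lifts up to sign. *)
have coordN m i : coord (- m) i = coord m i by have [_ _ e] := hbt m; rewrite /coord e.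
have liftN m i : G m -> t m i m = 0 -> lift_basis (lift (- m) (coord m i)).
  move=> Gm ti; exists (- m), i; rewrite coordN; split => //; first exact: (GN HD).
  have [_ _ e] := hbt m; rewrite e.
  have [_ tm] := annihilatorN (coord_annihilator ti).
  by apply/eqP; rewrite -(intr_eq0 K); apply/eqP.
have tl m i (Gm : G m) (ti : t m i m = 0) :=
  tau_lift HD tau_chev basis_Bc chi_int Gm (coord_annihilator ti).
apply/seteqP; split => _ [u [Bu|[m [i [Gm ti ->]]]] <-].
- have : (zero_ext (core X) tau @` Bc) (tau u).
    by exists u => //; rewrite zero_extE //; exact: (Bc_core basis_Bc).
  by rewrite tB => -[v Bv <-]; exists v => //; left.
- by rewrite (tl m i Gm ti); exists (lift (- m) (coord m i)) => //; right; exact: liftN.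
- have : (-%R @` Bc) (- u) by exists u.
  rewrite -tB => -[v Bv]; rewrite zero_extE; last exact: (Bc_core basis_Bc).
  by move=> <-; exists v => //; left.
- exists (lift (- m) (coord m i)); first by right; exact: liftN.
  rewrite (tau_lift HD tau_chev basis_Bc chi_int (GN HD Gm)) ?opprK //.
  exact: annihilatorN (coord_annihilator ti).
Qed.

Lemma extension_int : brackets X (B `\` core X) B `<=` zspan B.
Proof.
have sub1 : zspan Bc `<=` zspan B by apply: zspan_sub => u Bu; apply: zspan_incl; left.
have sub2 : zspan lift_basis `<=` zspan B.
  by apply: zspan_sub => u Bu; apply: zspan_incl; right.
move=> _ [u [[Bu|Nu] nu] [v Bv <-]]; first by case: nu; exact: (Bc_core basis_Bc).
case: Bv => [Bv|Nv]; last exact/sub2/lift_basis_br.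
apply: sub1; have [[_ hroot _ _ _] _] := basis_Bc.
have [_ [r hr hv]] := hroot v Bv.
have [hi|hn] := pselect (iso r); first exact: (lift_basis_br_iso hi).
have [a [l [ha gx _ ev]]] := Bc_noniso Bv hv (conj hr hn).
case: Nu => m [i [Gm ti ->]]; rewrite ev in Bv *.
rewrite (lift_basis_br_noniso Gm ti ha gx).
exact/zspanMz/(chi_int Gm ha gx).
Qed.

Lemma extension_chevalley : chevalley_basis X tau B.
Proof.
have [[_ hroot _ hsys hiso] _] := basis_Bc.
split; last by split; [exact: extension_lin_indep|exact: extension_span].
split.
- exact: extension_sub.
- exact: extension_span.
- move=> u [/hroot//|Nu]; split.
    by apply: contraNneq (lift_basis_neq0 Nu) => ->.
  have [m Gm hu] := lift_basis_root Nu; exists (rt 0 m) => //.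
  split; first exact: (rt_dual HD).
  by exists u => //; apply: contraNneq (lift_basis_neq0 Nu) => ->.
- exact: extension_tau.
- move=> r hr; have [x hx hB] := hsys; have hr' := noniso_opp HD hr.
  rewrite !extension_noniso // !hB //; have [_ e _] := hx r hr.
  apply/seteqP; split => [_ [_ -> [_ -> <-]]|_ ->]; first exact: e.
  by exists (x r) => //; exists (x (- r)).
(* Adding an isotropic root keeps the nonzero [V]-part, so the lifts add nothing to the root space
   of r + s, whether or not r + s is a root. *)
- move=> s hs; rewrite extension_core hiso //; congr zspan.
  apply: eq_bigcupr => r hr; have [l es] := iso_class HD hs.
  rewrite (extension_noniso (noniso_opp HD hr)); congr brackets.
  apply/seteqP; split => u [hu hus]; split => //; first by left.
  case: hu => // Nu; have [a [p [x [ha _ _ er]]]] := noniso_class HD hr.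
  rewrite er es (rtD HD) addr0 in hus.
  have [y _ uy] := root_space_noniso HD ha hus.
  by have := lift_basis_neq0 Nu; rewrite uy eqxx.
- exact: extension_int.
Qed.

End Extension.

(** * The two cases of the theorem *)

Section DerData.
Context {K : numFieldType} {V : vectType K} {Lam : zmodType} {L : lmodType K}.
Context {Delta : set V} {X : eala_data V Lam L}.
Hypotheses (H : torus_data Delta X) (P : permissible X).

(** A piece of nonzero degree lies in D = D^0, so it meets degree 0 and vanishes by directness of
    the grading. *)
Lemma der_data_degree0 : der X = der_piece X 0 ->
  der_piece X 0 = SCDer_piece (gr X) (chi X) 0 -> der_data Delta X [set 0].
Proof.
move=> D0 D0E; split => //.
- exact: perm_subalg P.
- exact: perm_graded P.
- by move=> m n -> ->; rewrite /= subr0.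
- by move=> m ->; exact: (Gam0 H).
- by move=> m ->.
- move=> m d hm /eqP m0 [Dd hd].
  apply: (direct_sum_disjoint (perm_graded P) hm (Gam0 H) m0); first by split.
  by rewrite -D0.
Qed.

Lemma der_data_full : der X = SCDer (gr X) (Gam X) (chi X) -> der_data Delta X (Gam X).
Proof.
move=> DE; split => //.
- exact: perm_subalg P.
- exact: perm_graded P.
- exact: (Gam0 H).
- by move=> m n hm hn; apply: (cb_sub (td_cent H)).
- move=> m hm; apply/seteqP; split => d; first by case.
  by move=> hd; split => //; rewrite DE; apply: lspan_incl; exists m.
Qed.

End DerData.

Lemma chevalley_extension (K : numFieldType) (V : vectType K) (Lam : zmodType)
    (L : lmodType K) (Delta : set V) (X : eala_data V Lam L) (G : set Lam)
    (tau : @ambient K L -> @ambient K L) (Bc : set (@ambient K L)) :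
  der_data Delta X G -> chevalley_involution X tau ->
  chevalley_basis_core X (zero_ext (core X) tau) Bc ->
  (forall m l a x, G m -> nonzero_roots Delta a -> gr X a l x ->
    Bc (injL x) -> zspan Bc (injL (chi X m x))) ->
  exists2 B, chevalley_basis X tau B & Bc `<=` B.
Proof.
move=> HD tau_chev basis_Bc chi_int.
have [n [b [t hbt]]] := adapted_choice (td_free (dd_torus HD)).
exists (Bc `|` lift_basis (X := X) (G := G) (tau := tau) (t := t)).
  exact: (extension_chevalley HD tau_chev basis_Bc chi_int hbt).
exact: subsetUl.
Qed.

Theorem corollary4p2p3 (R : realType) (V : vectType R[i]) (Lam : zmodType)
    (L : lmodType R[i]) (Delta : set V) (X : eala_data V Lam L)
    (tau : @ambient R[i] L -> @ambient R[i] L)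
    (Lam_free : free_of_finite_rank Lam)
    (Delta_irr : irreducible_root_system Delta)
    (Delta_red : reduced_root_system Delta)
    (L_torus : lie_torus Delta (br X) (gr X))
    (L_centerless : centerless (br X))
    (form_L : graded_form (br X) (gr X) (form X))
    (centroid_L : centroid_basis (br X) (gr X) (Gam X) (chi X))
    (D_perm : permissible X)
    (tau_chev : chevalley_involution X tau)
    (Bc : set (@ambient R[i] L)) :
  let tau_c := zero_ext (core X) tau in
  (der X = der_piece X 0 /\ der_piece X 0 = SCDer_piece (gr X) (chi X) 0)
  \/
  (der X = SCDer (gr X) (Gam X) (chi X) /\
   forall mu lam a x, Gam X mu -> nonzero_roots Delta a -> gr X a lam x ->
     Bc (injL x) -> zspan Bc (injL (chi X mu x))) ->
  chevalley_basis_core X tau_c Bc ->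
  exists2 B, chevalley_basis X tau B & Bc `<=` B.
Proof.
move=> /= cases basis_Bc; have [rsD _ _] := Delta_irr.
have H : torus_data Delta X by split.
case: cases => [[D0 D0E]|[DE chi_int]].
  apply: (chevalley_extension (der_data_degree0 H D_perm D0 D0E) tau_chev basis_Bc).
  (* With G = {0} the only operator is chi^0 = id, which preserves [Bc]. *)
  by move=> m l a x -> _ _ Bx; rewrite (chi0 H); exact: zspan_incl.
exact: (chevalley_extension (der_data_full H D_perm DE) tau_chev basis_Bc chi_int).
Qed.
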